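(* Let $X$ be an infinite-dimensional real Banach space. The following statements are equivalent. (a) $\ell_1$ embeds isomorphically into $X$. (b) There is a bounded $wc_0^*$-stable biorthogonal system in $X\times X^*$. If moreover $X$ is separable, then (a) and (b) are also equivalent to: (c) There is a bounded fundamental total $wc_0^*$-stable biorthogonal system $\{x_n,x_n^*\}_{n=1}^\infty$ in $X\times X^*$. Furthermore, for each $\varepsilon>0$: if (b) holds, then the system in (b) can be taken to be $(1+\varepsilon)$-bounded; if ($X$ is separable and) (c) holds, then the system in (c) can be taken to be $[(1+\sqrt2)+\varepsilon]$-bounded and so that the closed linear span $[x_n^*]$ $(2+\varepsilon)$-norms $X$.
   Context: All Banach spaces are real and infinite-dimensional. $[A]$ denotes the closed linear span of $A$. An isomorphic embedding $T:X\to Y$ is a bounded linear operator for which there are $a,b>0$ with $a^{-1}\|x\|\le\|Tx\|\le b\|x\|$ for all $x\in X$ (it need not be surjective). A sequence of pairs $\{x_n,x_n^*\}_{n=1}^\infty$ in $X\times X^*$ is a biorthogonal system if $x_n^*(x_m)=\delta_{nm}$. It is $M$-bounded if $\{x_n\}$ and $\{x_n^*\}$ are bounded and $\sup_n\|x_n\|\,\|x_n^*\|\le M$; bounded if it is $M$-bounded for some finite $M$; fundamental if $[x_n]_n=X$; total if the weak$^*$-closure of the linear span of $\{x_n^*\}$ is $X^*$ (equivalently, $x_n^*(x)=0$ for all $n$ implies $x=0$). A biorthogonal system $\{x_n,x_n^*\}$ in $X\times X^*$ is a $wc_0^*$-stable biorthogonal system if for each isomorphic embedding $T$ of $X$ into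 some Banach space $Y$ there exists a sequence $\{y_n^*\}$ in $Y^*$ with $T^*y_n^*=x_n^*$ for each $n$ such that $\{y_n^*\}$ is a semi-normalized (bounded and bounded away from zero in norm) weakly null sequence in $Y^*$. For $\tau\ge1$, a subset $Z\subset X^*$ $\tau$-norms $X$ if $\|x\|\le\tau\sup_{z\in Z\setminus\{0\}} z(x)/\|z\|$ for each $x\in X$. *)

(* Defs.v *)
(* Real Banach spaces are [completeNormedModType R] with
   [R : realType]; scalars seen as a normed space are [R^o]. *)
From HB Require Import structures.
From mathcomp Require Import all_boot all_order all_algebra.
From mathcomp Require Import all_classical all_reals all_analysis.

Set Implicit Arguments.
Unset Strict Implicit.
Unset Printing Implicit Defensive.

Import Order.TTheory GRing.Theory Num.Theory.
Import numFieldNormedType.Exports.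

Local Open Scope classical_set_scope.
Local Open Scope ring_scope.

Section DualSpace.
Variables (R : realType) (X : normedModType R).

Definition dual_pred : {pred X -> R^o} :=
  mem [set f : X -> R^o | linear f /\ continuous f].

Record dual := Dual { dual_fun :> X -> R^o; dualP : dual_fun \in dual_pred }.

HB.instance Definition _ := [isSub for dual_fun].
HB.instance Definition _ := [Choice of dual by <:].

Lemma dual_submod_closed : submod_closed dual_pred.
Proof.
split.
  rewrite inE; split; last exact: cst_continuous.
  by move=> a u v; rewrite /= scaler0 addr0.
move=> a f g; rewrite !inE => -[lf cf] [lg cg]; split.
  move=> b u v; rewrite !fctE lf lg !scalerDr !scalerA mulrC.
  by rewrite addrACA.
move=> x.
apply: (@cvgD R R^o X _ _ (fun y => a *: f y) g); last exact: cg.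
by apply: (@cvgZl_tmp); exact: cf.
Qed.

HB.instance Definition _ := GRing.isSubmodClosed.Build _ _ dual_pred
  dual_submod_closed.
HB.instance Definition _ := [SubChoice_isSubLmodule of dual by <:].

Definition dual_norm (f : dual) : R :=
  sup [set `|f x| | x in [set x : X | `|x| <= 1]].

Lemma dual_linear (f : dual) : linear f.
Proof. by have := dualP f; rewrite inE => -[]. Qed.

Lemma dual_continuous (f : dual) : continuous f.
Proof. by have := dualP f; rewrite inE => -[]. Qed.

HB.instance Definition _ (f : dual) :=
  GRing.isLinear.Build R X R^o *:%R (dual_fun f) (dual_linear f).

Lemma dual_has_sup (f : dual) :
  has_sup [set `|f x| | x in [set x : X | `|x| <= 1]].
Proof.
split; first by exists `|f 0|, 0 => //=; rewrite normr0.
have /(@linear_bounded_continuous _ _ R^o)/bounded_funP/(_ 1)[M fM] :=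
  @dual_continuous f.
by exists M => _ [x /= x1 <-]; exact: fM.
Qed.

Lemma dual_norm_ub (f : dual) x : `|x| <= 1 -> `|f x| <= dual_norm f.
Proof. by move=> x1; apply: (ub_le_sup (dual_has_sup f).2); exists x. Qed.

Lemma dual_normP (f : dual) x : `|f x| <= dual_norm f * `|x|.
Proof.
have [->|x0] := eqVneq x 0; first by rewrite linear0 !normr0 mulr0.
have nx : 0 < `|x| by rewrite normr_gt0.
rewrite -ler_pdivrMr//; have := @dual_norm_ub f (`|x|^-1 *: x).
rewrite linearZ !normrZ ger0_norm ?invr_ge0// mulVf ?gt_eqF// => /(_ (lexx _)).
by rewrite mulrC.
Qed.

Lemma dual_norm_le (f : dual) (M : R) :
  (forall x, `|x| <= 1 -> `|f x| <= M) -> dual_norm f <= M.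
Proof.
move=> fM; apply: ge_sup; first exact: (dual_has_sup f).1.
by move=> _ [x /= x1 <-]; exact: fM.
Qed.

Lemma dual_norm_ge0 (f : dual) : 0 <= dual_norm f.
Proof. by apply: le_trans (dual_norm_ub f (x := 0) _); rewrite ?normr0. Qed.

Lemma dual_normD (f g : dual) : dual_norm (f + g) <= dual_norm f + dual_norm g.
Proof.
apply: dual_norm_le => x x1.
by apply: le_trans (ler_normD (f x) (g x)) _; rewrite lerD// dual_norm_ub.
Qed.

Lemma dual_normZ (a : R) (f : dual) : dual_norm (a *: f) = `|a| * dual_norm f.
Proof.
have le_normZ b (g : dual) : dual_norm (b *: g) <= `|b| * dual_norm g.
  apply: dual_norm_le => x x1.
  have -> : (b *: g) x = b *: g x by [].
  by rewrite normrZ ler_wpM2l// dual_norm_ub.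
apply/eqP; rewrite eq_le le_normZ/=.
have [->|a0] := eqVneq a 0; first by rewrite normr0 mul0r dual_norm_ge0.
have na : 0 < `|a| by rewrite normr_gt0.
have := le_normZ a^-1 (a *: f).
by rewrite scalerA mulVf// scale1r normfV ler_pdivlMl.
Qed.

Lemma dual_norm0_eq0 (f : dual) : dual_norm f = 0 -> f = 0.
Proof.
move=> f0; apply/val_inj/funext => x; apply/eqP; rewrite -[_ == _]normr_le0.
by have := dual_normP f x; rewrite f0 mul0r.
Qed.

HB.instance Definition _ :=
  Lmodule_isNormed.Build R dual dual_normD dual_normZ dual_norm0_eq0.

Lemma dual_normE (f : dual) : `|f| = dual_norm f.
Proof. by []. Qed.

End DualSpace.

Section Ell1.
Variable R : realType.

Definition ell1_pred : {pred nat -> R^o} :=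
  mem [set u : nat -> R^o | cvgn [normed series u]].

Record ell1 := Ell1 { ell1_seq :> nat -> R^o; ell1P : ell1_seq \in ell1_pred }.

HB.instance Definition _ := [isSub for ell1_seq].
HB.instance Definition _ := [Choice of ell1 by <:].

Lemma ell1_submod_closed : submod_closed ell1_pred.
Proof.
split.
  rewrite inE /=.
  have -> : [normed series (0 : nat -> R^o)] = cst 0.
    by apply/funext => n; rewrite /series; apply: big1 => i _; exact: normr0.
  exact: is_cvg_cst.
move=> a u v; rewrite !inE /= => cu cv.
apply: (@series_le_cvg _ _ (fun n => `|a| * `|u n| + `|v n|)).
- by move=> n; exact: normr_ge0.
- by move=> n; apply: addr_ge0 => //; exact: mulr_ge0.
- by move=> n /=; apply: le_trans (ler_normD _ _) _; rewrite lerD2r normrM.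
- apply: is_cvg_seriesD => //.
  exact: (@is_cvg_seriesZ R (fun n => `|u n|) `|a| cu).
Qed.

HB.instance Definition _ := GRing.isSubmodClosed.Build _ _ ell1_pred
  ell1_submod_closed.
HB.instance Definition _ := [SubChoice_isSubLmodule of ell1 by <:].

Definition ell1_norm (u : ell1) : R := limn [normed series u].

Lemma ell1_cvg (u : ell1) : cvgn [normed series u].
Proof. by have := ell1P u; rewrite inE. Qed.

Arguments ell1_cvg : clear implicits.

Lemma ell1_normD (u v : ell1) : ell1_norm (u + v) <= ell1_norm u + ell1_norm v.
Proof.
rewrite /ell1_norm -(lim_seriesD (ell1_cvg u) (ell1_cvg v)).
apply: lim_series_le; first exact: ell1_cvg.
  by apply: is_cvg_seriesD; exact: ell1_cvg.
by move=> n; exact: ler_normD.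
Qed.

Lemma ell1_normZ (a : R) (u : ell1) : ell1_norm (a *: u) = `|a| * ell1_norm u.
Proof.
rewrite /ell1_norm -[RHS](lim_seriesZ `|a| (ell1_cvg u)).
by congr (limn (series _)); apply/funext => n; exact: normrM.
Qed.

Lemma ell1_norm0_eq0 (u : ell1) : ell1_norm u = 0 -> u = 0.
Proof.
move=> u0; apply/val_inj/funext => n; apply/eqP.
rewrite -[_ == _]normr_le0 -[leRHS]u0.
apply: (@le_trans _ _ ([normed series u] n.+1)).
  rewrite [leRHS](_ : _ = [normed series u] n + `|u n|); last exact: seriesSr.
  by rewrite lerDr; apply: sumr_ge0 => k _; exact: normr_ge0.
apply: nondecreasing_cvgn_le; last exact: ell1_cvg.
by apply: nondecreasing_series => k _ _; exact: normr_ge0.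
Qed.

HB.instance Definition _ :=
  Lmodule_isNormed.Build R ell1 ell1_normD ell1_normZ ell1_norm0_eq0.

Lemma ell1_normE (u : ell1) : `|u| = ell1_norm u.
Proof. by []. Qed.

End Ell1.

Section Spaces.
Variable R : realType.

Definition lspan (V : lmodType R) (A : set V) : set V :=
  [set v | exists (n : nat) (a : 'I_n -> R) (u : 'I_n -> V),
     (forall i, A (u i)) /\ v = \sum_i a i *: u i].

Definition cspan (V : normedModType R) (A : set V) : set V := closure (lspan A).

Definition infinite_dim (V : lmodType R) : Prop :=
  ~ exists s : seq V, lspan [set v | v \in s] = setT.

Definition separable (V : topologicalType) : Prop :=
  exists A : set V, countable A /\ dense A.

Definition iso_embedding (X Y : normedModType R) (T : {linear X -> Y}) : Prop :=
  exists a b : R, [/\ 0 < a, 0 < b &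
    forall x, a^-1 * `|x| <= `|T x| /\ `|T x| <= b * `|x|].

Definition embeds (X Y : normedModType R) : Prop :=
  exists T : {linear X -> Y}, iso_embedding T.

(* X^* with the weak-star topology: the initial topology for the inclusion of
   X^* in the space of all functions X -> R with pointwise convergence *)
Definition weak_star (X : normedModType R) : Type :=
  initial_topology (fun f : dual X => dual_fun f : {ptws X -> R^o}).

Definition weakly_null (V : normedModType R) (v : nat -> V) : Prop :=
  forall phi : dual V, phi (v n) @[n --> \oo] --> (0 : R^o).

Definition semi_normalized (V : normedModType R) (v : nat -> V) : Prop :=
  bounded_set (range v) /\ exists2 c : R, 0 < c & forall n, c <= `|v n|.

(* the real-valued [sup] is meaningful: the set is bounded above by [`|x|], and
   it is empty (with [sup] equal to 0) only if Z has no nonzero element *)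
Definition norms (X : normedModType R) (tau : R) (Z : set (dual X)) : Prop :=
  forall x : X, `|x| <= tau * sup [set z x / `|z| | z in Z `\ 0].

End Spaces.

Section Systems.
Variables (R : realType) (X : normedModType R).
Implicit Types (x : nat -> X) (xs : nat -> dual X).

Definition biorthogonal x xs : Prop := forall n m, xs n (x m) = (n == m)%:R.

Definition M_bounded (M : R) x xs : Prop :=
  [/\ bounded_set (range x), bounded_set (range xs) &
      forall n, `|x n| * `|xs n| <= M].

Definition bounded_system x xs : Prop := exists M : R, M_bounded M x xs.

Definition fundamental x : Prop := cspan (range x) = setT.

Definition total_functionals xs : Prop :=
  closure (lspan (range xs) : set (weak_star X)) = setT.

(* [ys n \o T = xs n] is the equation T^* y_n^* = x_n^*.  Y is
   infinite-dimensional as soon as X is, because T is injective. *)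
Definition wc0s_stable x xs : Prop :=
  biorthogonal x xs /\
  forall (Y : completeNormedModType R) (T : {linear X -> Y}), iso_embedding T ->
    exists ys : nat -> dual Y,
      [/\ forall n, (ys n : Y -> R^o) \o T = xs n :> (X -> R^o),
          semi_normalized ys & weakly_null ys].

End Systems.

(* Main.v *)
(* (a) => (b).  By James' distortion theorem X contains a sequence e_j with |e_j| <= 1
   and lower l1-estimate 1 + eps, so for each sign pattern t there is a functional s_t of
   norm at most 1 + eps with s_t(e_j) = t_j.  Averaging t |-> s_t against the Rademacher
   functions gives e_j^* biorthogonal to e_j with |sum b_j e_j^*| <= (1 + eps) |b|_2.
   Given an embedding of X in Y, extend every s_t to Y by Hahn-Banach and average again:
   the extensions of e_j^* satisfy an upper l2-estimate, hence are weakly null.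

   (b) => (a).  Embed X in the space of bounded functions on X^*.  Let y_n be weakly null
   extensions of x_n^*, and L_n a positive functional with |y_n f| <= L_n |f|.  If (x_n) is
   Cauchy along a free ultrafilter in each L^1(L_n), a sliding hump argument contradicts
   the weak nullness.  Otherwise, for some L = L_n, the ultrafilter limits of the
   indicators of x_m < r and of x_m > q are not disjoint for suitable r < q, and this
   yields a subsequence whose sets {x_m < r}, {x_m > q} are independent, so that it
   generates l1 by Rosenthal's argument.

   (a) => (c).  Replacing e_j by differences one may assume g_i(e_j) -> 0 for a norming
   sequence g_i.  Enlarge a finite biorthogonal system alternately by vectors of a dense
   sequence and by the g_i; each new pair, of uncontrolled norm, is rotated with fresh pairs
   e_j, e_j^* by a Haar matrix, as in the Ovsepian-Pelczynski theorem.  The rows of that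
   matrix have l1-norm at most 1 + sqrt 2 and l2-norm 1, hence the bound; up to a vanishing
   error the new functionals are l2-normalised combinations of late e_j^*, which keeps them
   stable. *)
Require Import Defs.
From HB Require Import structures.
From mathcomp Require Import all_boot all_order all_algebra.
From mathcomp Require Import ring lra.
From mathcomp Require Import all_classical all_reals all_analysis.
Set Implicit Arguments.
Unset Strict Implicit.
Unset Printing Implicit Defensive.
Import Order.TTheory GRing.Theory Num.Theory.
Import numFieldNormedType.Exports.
Local Open Scope classical_set_scope.
Local Open Scope ring_scope.

(** * Hahn-Banach *)

(** Extending the e_j^* to Y one at a time would lose the upper l2-estimate. Extending the sign
    functionals s_t and averaging afterwards keeps it, with the constant multiplied by that of the
    embedding. The map t |-> s_t is arbitrary, so nothing can be integrated: finite averages,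
    finitely additive positive functionals and ultrafilter limits take the place of measures
    throughout. In (b) => (a), stability is tested on a single space, chosen because every
    functional on bounded functions is dominated by a positive one. In (a) => (c), the condition
    g_i(e_j) -> 0 lets the g_i enter the dual system while late pairs e_j, e_j^* stay almost
    biorthogonal to it. The sum of all powers of 1 / sqrt 2 is 1 + sqrt 2, which bounds what fresh
    vectors of norm about 1 contribute to one row of the Haar matrix; the new functionals feel only
    the l2-norm of a row, so their norms stay close to 1. Since [x_n^*] contains the norming
    sequence g_i itself, it norms X even with constant 1. *)

Section HahnBanach.
Variables (R : realType) (V : lmodType R).
Implicit Types (p q : V -> R) (C : set (V * R)).

Definition sublinear p : Prop :=
  (forall x y, p (x + y) <= p x + p y) /\
  (forall t x, 0 <= t -> p (t *: x) = t * p x).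

Definition cone C : Prop :=
  [/\ C !=set0, forall c d, C c -> C d -> C (c.1 + d.1, c.2 + d.2) &
      forall t c, 0 <= t -> C c -> C (t *: c.1, t * c.2)].

Lemma sublinear0 p : sublinear p -> p 0 = 0.
Proof. by move=> [_ pZ]; rewrite -(scale0r 0) pZ// mul0r. Qed.

Lemma sublinearN p x : sublinear p -> - p (- x) <= p x.
Proof.
move=> sp; have := sp.1 x (- x); rewrite subrr (sublinear0 sp); lra.
Qed.

(** Absorbs the constraints into the bound: a linear [l] below [inf_along p C] is below [p] and, by
    evaluation at [- c.1], satisfies [c.2 <= l c.1] on [C]. *)
Definition inf_along p C x := inf [set p (x + c.1) - c.2 | c in C].

Section InfAlong.
Variables (p : V -> R) (C : set (V * R)).
Hypotheses (sp : sublinear p) (cC : cone C) (Cp : forall c, C c -> c.2 <= p c.1).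

Let inf_along_lbound x : lbound [set p (x + c.1) - c.2 | c in C] (- p (- x)).
Proof.
move=> _ [c Cc <-]; have := Cp Cc; have := sp.1 (x + c.1) (- x).
by rewrite addrAC subrr add0r; lra.
Qed.

Let inf_alongP x c : C c -> inf_along p C x <= p (x + c.1) - c.2.
Proof.
by move=> Cc; apply: ge_inf; [exists (- p (- x)); exact: inf_along_lbound|exists c].
Qed.

Let le_inf_along x a :
  (forall c, C c -> a <= p (x + c.1) - c.2) -> a <= inf_along p C x.
Proof.
move=> h; have [[c Cc] _ _] := cC; apply: lb_le_inf.
  by exists (p (x + c.1) - c.2), c.
by move=> _ [d Cd <-]; exact: h.
Qed.

Lemma inf_along_le x : inf_along p C x <= p x.
Proof.
have [[c Cc] _ CZ] := cC; have := inf_alongP x (CZ 0 c (lexx _) Cc).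
by rewrite scale0r addr0 mul0r subr0.
Qed.

Lemma inf_along_opp c : C c -> inf_along p C (- c.1) <= - c.2.
Proof.
by move=> /(inf_alongP (- c.1)); rewrite addNr sublinear0// sub0r.
Qed.

Lemma sublinear_inf_along : sublinear (inf_along p C).
Proof.
have [_ CD CZ] := cC; split=> [x y|t x].
  rewrite -lerBlDr; apply: (@le_inf_along _ _) => c Cc.
  rewrite lerBlDr -lerBlDl; apply: (@le_inf_along _ _) => d Cd.
  have := inf_alongP (x + y) (CD _ _ Cc Cd); rewrite /=.
  by have := sp.1 (x + c.1) (y + d.1); rewrite addrACA; lra.
have le t' y : 0 < t' -> inf_along p C (t' *: y) <= t' * inf_along p C y.
  move=> t0; rewrite -ler_pdivrMl//; apply: (@le_inf_along _ _) => c Cc.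
  rewrite ler_pdivrMl// mulrBr -sp.2 ?(ltW t0)// scalerDr.
  by have := inf_alongP (t' *: y) (CZ _ _ (ltW t0) Cc).
rewrite le_eqVlt => /predU1P[<-|t0].
  rewrite scale0r mul0r; apply/eqP; rewrite eq_le -{1}(sublinear0 sp).
  rewrite inf_along_le/=.
  by apply: (@le_inf_along _ _) => c Cc; rewrite add0r subr_ge0 Cp.
apply/eqP; rewrite eq_le le//= -ler_pdivlMl//.
have := le t^-1 (t *: x); rewrite scalerA mulVf ?gt_eqF// scale1r.
by apply; rewrite invr_gt0.
Qed.

End InfAlong.

(** Zorn's lemma for the reversed pointwise order. The infimum of a chain is finite because a
    sublinear function below [p] is at least [- p (- x)] at [x]; it is subadditive because two
    members of a chain are comparable. *)
Lemma sublinear_minimal p : sublinear p -> exists q,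
  [/\ sublinear q, forall x, q x <= p x &
      forall q', sublinear q' -> (forall x, q' x <= q x) -> q' = q].
Proof.
move=> sp; pose T := {q : V -> R | sublinear q /\ forall x, q x <= p x}.
pose le (f g : T) : bool := `[< forall x, sval g x <= sval f x >].
have [| | | |m mP] := @Zorn T le.
- by move=> f; apply/asboolP.
- move=> f g h /asboolP gf /asboolP hg; apply/asboolP => x.
  exact: le_trans (hg x) (gf x).
- move=> [f fP] [g gP] /asboolP /= gf /asboolP /= fg.
  have E : f = g by apply/funext => x; apply/eqP; rewrite eq_le gf fg.
  by subst g; congr exist; exact: Prop_irrelevance.
- move=> A Atot; have [->|/set0P[f0 Af0]] := eqVneq A set0.
    by exists (exist _ p (conj sp (fun x => lexx _))).
  pose E x := [set sval f x | f in A]; pose q x := inf (E x).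
  have lbE x : lbound (E x) (- p (- x)).
    move=> _ [f Af <-]; have [sf fp] := svalP f.
    by have := sublinearN x sf; have := fp (- x); lra.
  have qle x f : A f -> q x <= sval f x.
    by move=> Af; apply: ge_inf; [exists (- p (- x)); exact: lbE|exists f].
  have qge x a : (forall f, A f -> a <= sval f x) -> a <= q x.
    move=> h; apply: lb_le_inf; first by exists (sval f0 x), f0.
    by move=> _ [f Af <-]; exact: h.
  have sq : sublinear q.
    split=> [x y|t x t0].
      rewrite -lerBlDr; apply: (@qge _ _) => f Af.
      rewrite lerBlDr -lerBlDl; apply: (@qge y _) => g Ag.
      rewrite lerBlDl; have [fg|gf] := Atot _ _ Af Ag.
        apply: le_trans (qle _ _ Ag) _; apply: le_trans ((svalP g).1.1 x y) _.
        by rewrite lerD2r; move/asboolP: fg.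
      apply: le_trans (qle _ _ Af) _; apply: le_trans ((svalP f).1.1 x y) _.
      by rewrite lerD2l; move/asboolP: gf.
    move: t0; rewrite le_eqVlt => /predU1P[<-|t0].
      rewrite scale0r mul0r; apply/eqP; rewrite eq_le; apply/andP; split.
        by rewrite -(sublinear0 (svalP f0).1) qle.
      by apply: (@qge _ _) => f Af; rewrite (sublinear0 (svalP f).1).
    apply/eqP; rewrite eq_le; apply/andP; split.
      rewrite -ler_pdivrMl//; apply: (@qge _ _) => f Af.
      by rewrite ler_pdivrMl// -(svalP f).1.2 ?(ltW t0)// qle.
    by apply: (@qge _ _) => f Af; rewrite (svalP f).1.2 ?(ltW t0)// ler_pM2l// qle.
  have qp x : q x <= p x by apply: le_trans (qle x _ Af0) ((svalP f0).2 x).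
  by exists (exist _ q (conj sq qp)) => f Af; apply/asboolP => x; exact: qle.
have [sm mp] := svalP m; exists (sval m); split=> // q' sq' q'm.
have q'p x : q' x <= p x by exact: le_trans (q'm x) (mp x).
by have <- : exist _ q' (conj sq' q'p) = m by apply: mP; apply/asboolP.
Qed.

(* [inf_along q] for the ray through [(y, q y)] is sublinear and below [q], so it
   equals [q]; this gives [q x + q y <= q (x + y)]. *)
Lemma sublinear_minimal_linear q : sublinear q ->
  (forall q', sublinear q' -> (forall x, q' x <= q x) -> q' = q) ->
  linear (q : V -> R^o).
Proof.
move=> sq qmin.
have qD x y : q (x + y) = q x + q y.
  apply/eqP; rewrite eq_le sq.1/=.
  pose C := [set (t *: y, t * q y) | t in [set t : R | 0 <= t]].
  have cC : cone C.
    split; first by exists (0 *: y, 0 * q y), 0 => /=.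
      move=> _ _ [s /= s0 <-] [t /= t0 <-]; exists (s + t); rewrite /= ?addr_ge0//.
      by rewrite scalerDl mulrDl.
    move=> t _ t0 [s /= s0 <-]; exists (t * s); rewrite /= ?mulr_ge0//.
    by rewrite scalerA mulrA.
  have Cq c : C c -> c.2 <= q c.1 by move=> [t /= t0 <-] /=; rewrite sq.2.
  have C1 : C (y, q y) by exists 1; rewrite /= ?ler01// scale1r mul1r.
  have E := qmin _ (sublinear_inf_along sq cC Cq) (inf_along_le sq cC Cq).
  rewrite addrC -lerBrDl -[leLHS]/(q x) -[in leLHS]E.
  apply: ge_inf; last by exists (y, q y).
  exists (- q (- x)) => _ [c Cc <-]; have := Cq _ Cc.
  have := sq.1 (x + c.1) (- x).
  by rewrite addrAC subrr add0r; lra.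
have qN x : q (- x) = - q x.
  by apply/eqP; rewrite -subr_eq0 opprK -qD addNr sublinear0.
move=> a x y; rewrite qD; congr (_ + _).
have [a0|a0] := leP 0 a; first exact: sq.2.
by rewrite -[a]opprK scaleNr qN sq.2 ?oppr_ge0 ?(ltW a0)// scaleNr.
Qed.

(* Mazur-Orlicz form of the Hahn-Banach theorem. *)
Theorem sublinear_separation p C : sublinear p -> cone C ->
  (forall c, C c -> c.2 <= p c.1) ->
  exists l : V -> R^o, [/\ linear l, forall x, l x <= p x &
    forall c, C c -> c.2 <= l c.1].
Proof.
move=> sp cC Cp; have [q [sq qle qmin]] :=
  sublinear_minimal (sublinear_inf_along sp cC Cp).
have lq := sublinear_minimal_linear sq qmin.
exists q; split=> //.
  by move=> x; apply: le_trans (qle x) _; exact: inf_along_le.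
move=> c Cc; have := le_trans (qle (- c.1)) (inf_along_opp sp Cp Cc).
have := sublinearN (- c.1) sq; rewrite opprK; lra.
Qed.

End HahnBanach.

Section DualExtension.
Variable R : realType.

Lemma dualE (V : normedModType R) (l : V -> R^o) (K : R) : linear l ->
  (forall x, `|l x| <= K * `|x|) -> exists f : dual V, (f : V -> R^o) = l.
Proof.
move=> ll lK.
pose L : {linear V -> R^o} := HB.pack l (GRing.isLinear.Build _ _ _ _ l ll).
have cl : continuous l.
  apply: (@bounded_linear_continuous _ _ _ L).
  apply/bounded_funP => r; exists (`|K| * `|r|) => x xr.
  apply: le_trans (lK x) _; apply: le_trans (ler_norm _) _.
  by rewrite normrM normr_id ler_wpM2l// (le_trans xr)// ler_norm.
have lP : l \in @dual_pred R V by rewrite inE.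
by exists (Dual lP).
Qed.

Lemma dual_bound (V : normedModType R) (f : dual V) x : `|f x| <= `|f| * `|x|.
Proof. exact: dual_normP. Qed.

Lemma dual_norm_bound (V : normedModType R) (f : dual V) K : 0 <= K ->
  (forall x, `|f x| <= K * `|x|) -> `|f| <= K.
Proof.
move=> K0 h; apply: dual_norm_le => x x1; apply: le_trans (h x) _.
by rewrite -[leRHS]mulr1 ler_wpM2l.
Qed.

(** The pairs [(A z, s z)] form a subspace, so the one-sided inequality of [sublinear_separation] at
    [z] and [- z] becomes an equality. [Z] carries no norm and [A] need not be injective, so that
    values can also be prescribed along a sequence of vectors. *)
Lemma dual_extension (Z : lmodType R) (V : normedModType R) (A : {linear Z -> V})
    (s : Z -> R^o) (K : R) : 0 <= K -> linear s ->
  (forall z, s z <= K * `|A z|) ->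
  exists2 t : dual V, `|t| <= K & forall z, t (A z) = s z.
Proof.
move=> K0 ls sK.
pose S : {linear Z -> R^o} := HB.pack s (GRing.isLinear.Build _ _ _ _ s ls).
pose p (v : V) := K * `|v|.
have sp : sublinear p.
  split=> [x y|t x t0]; first by rewrite /p -mulrDr ler_wpM2l// ler_normD.
  by rewrite /p normrZ ger0_norm// mulrCA.
pose C := [set (A z, s z : R) | z in [set: Z]].
have cC : cone C.
  split; first by exists (A 0, s 0), 0.
    move=> _ _ [x _ <-] [y _ <-]; exists (x + y) => //=.
    by rewrite linearD -[s]/(S : _ -> _) linearD.
  move=> t _ t0 [x _ <-]; exists (t *: x) => //=.
  by rewrite linearZ -[s]/(S : _ -> _) linearZ.
have [|l [ll lp lC]] := sublinear_separation sp cC.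
  by move=> _ [z _ <-]; exact: sK.
have lN x : l (- x) = - l x.
  pose L : {linear V -> R^o} := HB.pack l (GRing.isLinear.Build _ _ _ _ l ll).
  exact: (linearN L).
have lK x : `|l x| <= K * `|x|.
  rewrite ler_norml lp andbT lerNl -lN; apply: le_trans (lp _) _.
  by rewrite /p normrN.
have [f fE] := dualE ll lK; exists f.
  by apply: dual_norm_bound => // x; rewrite fE.
move=> z; rewrite fE; apply/eqP; rewrite eq_le.
have h z' : s z' <= l (A z') by exact: (lC (A z', s z') (ex_intro2 _ _ z' I erefl)).
rewrite h andbT; have := h (- z).
by rewrite linearN lN -[s]/(S : _ -> _) linearN lerN2.
Qed.

End DualExtension.

(** * Limits along an ultrafilter *)

Section Bounded.
Variables (R : realType) (T : Type).
Implicit Types f g : T -> R.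

Definition bdd f := exists M, forall n, `|f n| <= M.

Lemma bdd_cst (a : R) : bdd (fun=> a : R).
Proof. by exists `|a|. Qed.

Lemma bddD f g : bdd f -> bdd g -> bdd (fun n => f n + g n).
Proof.
move=> [M fM] [N gN]; exists (M + N) => n.
by apply: le_trans (ler_normD _ _) _; rewrite lerD.
Qed.

Lemma bddM f g : bdd f -> bdd g -> bdd (fun n => f n * g n).
Proof.
move=> [M fM] [N gN]; exists (M * N) => n.
by rewrite normrM ler_pM.
Qed.

Lemma bddZ a f : bdd f -> bdd (fun n => a * f n).
Proof. by move=> bf; apply: bddM => //; exact: bdd_cst. Qed.

Lemma bdd_sum (I : Type) (r : seq I) (P : pred I) (F : I -> T -> R) :
  (forall i, bdd (F i)) -> bdd (fun n => \sum_(i <- r | P i) F i n).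
Proof.
move=> bF; elim: r => [|i r [M rM]]; first by exists 0 => n; rewrite big_nil normr0.
have [N FN] := bF i; exists (N + M) => n; rewrite big_cons; case: ifP => _.
  by apply: le_trans (ler_normD _ _) _; rewrite lerD.
by apply: le_trans (rM n) _; rewrite lerDr (le_trans _ (FN n)).
Qed.

Lemma bdd_norm f : bdd f -> bdd (fun t => `|f t|).
Proof. by move=> [M fM]; exists M => t; rewrite normr_id. Qed.

Lemma bddN f : bdd f -> bdd (fun t => - f t).
Proof. by move=> [M fM]; exists M => t; rewrite normrN. Qed.

Lemma bddX f n : bdd f -> bdd (fun t => f t ^+ n).
Proof.
move=> [M fM]; exists (M ^+ n) => t.
by rewrite normrX lerXn2r ?nnegrE// (le_trans _ (fM t)).
Qed.

End Bounded.

Section UltraLimit.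
Variable R : realType.

Lemma free_ultrafilter : exists U : set_system nat, UltraFilter U /\ \oo `<=` U.
Proof. exact: ultraFilterLemma. Qed.

Definition freeU : set_system nat := sval (cid free_ultrafilter).

#[global] Instance freeU_ultra : UltraFilter freeU.
Proof. by have [] := svalP (cid free_ultrafilter). Qed.

#[global] Instance freeU_proper : ProperFilter freeU.
Proof. exact: ultra_proper. Qed.

Lemma near_freeU (P : nat -> Prop) : (\forall n \near \oo, P n) -> \forall n \near freeU, P n.
Proof. by have [_] := svalP (cid free_ultrafilter); apply. Qed.

Lemma freeU_ge N : \forall n \near freeU, (N <= n)%N.
Proof. by apply: near_freeU; exists N. Qed.

Implicit Types f g : nat -> R.

Definition ulim f : R := lim (f n @[n --> freeU]).

(** A bounded sequence clusters in a compact interval, and an ultrafilter converges to each of its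
    cluster points. *)
Lemma ulim_cvg f : bdd f -> f n @[n --> freeU] --> ulim f.
Proof.
move=> [M fM]; have := @segment_compact R (- M) M.
move=> /(_ (f n @[n --> freeU]) _)[|l [_ fl]].
  apply: (filterS _ (@filterT _ freeU _)) => n _ /=.
  by rewrite in_itv /= -ler_norml fM.
suff fUl : f n @[n --> freeU] --> l by rewrite /ulim (cvg_lim _ fUl).
move=> A Al; have [//|UC] := in_ultra_setVsetC (f @^-1` A) freeU_ultra.
by have [x [Ax]] := fl (~` A) A UC Al.
Qed.

Lemma ulimE f l : f n @[n --> freeU] --> l -> ulim f = l.
Proof. exact: cvg_lim. Qed.

Lemma eq_ulim f g : (\forall n \near freeU, f n = g n) -> bdd f -> ulim g = ulim f.
Proof.
move=> fg bf; apply: ulimE; apply: cvg_trans (ulim_cvg bf).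
by apply: near_eq_cvg; apply: filterS fg => n ->.
Qed.

Lemma ulim_cst (a : R) : ulim (fun=> a) = a.
Proof. by apply: ulimE; exact: cvg_cst. Qed.

Lemma ulimD f g : bdd f -> bdd g -> ulim (fun n => f n + g n) = ulim f + ulim g.
Proof. by move=> bf bg; apply: ulimE; apply: cvgD; exact: ulim_cvg. Qed.

Lemma ulimM f g : bdd f -> bdd g -> ulim (fun n => f n * g n) = ulim f * ulim g.
Proof. by move=> bf bg; apply: ulimE; apply: cvgM; exact: ulim_cvg. Qed.

Lemma ulimZ a f : bdd f -> ulim (fun n => a * f n) = a * ulim f.
Proof. by move=> bf; rewrite ulimM ?ulim_cst//; exact: bdd_cst. Qed.

Lemma ulim_sum (I : Type) (r : seq I) (P : pred I) (F : I -> nat -> R) :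
  (forall i, bdd (F i)) ->
  ulim (fun n => \sum_(i <- r | P i) F i n) = \sum_(i <- r | P i) ulim (F i).
Proof.
move=> bF; elim: r => [|i r IH].
  rewrite big_nil -[RHS](ulim_cst 0); congr ulim.
  by apply/funext => n; rewrite big_nil.
rewrite big_cons -IH; case: ifP => Pi.
  rewrite -ulimD//; last exact: bdd_sum.
  by congr ulim; apply/funext => n; rewrite big_cons Pi.
by congr ulim; apply/funext => n; rewrite big_cons Pi.
Qed.

Lemma ulim_le f g : bdd f -> bdd g -> (\forall n \near freeU, f n <= g n) ->
  ulim f <= ulim g.
Proof. by move=> bf bg fg; apply: ler_cvg_to fg; exact: ulim_cvg. Qed.

Lemma ulim_ge_cst f a : bdd f -> (\forall n \near freeU, a <= f n) -> a <= ulim f.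
Proof. by move=> bf af; rewrite -(ulim_cst a); apply: ulim_le => //; exact: bdd_cst. Qed.

Lemma ulim_le_cst f a : bdd f -> (\forall n \near freeU, f n <= a) -> ulim f <= a.
Proof. by move=> bf af; rewrite -(ulim_cst a); apply: ulim_le => //; exact: bdd_cst. Qed.

Lemma ulim_norm_le f a : bdd f -> (\forall n \near freeU, `|f n| <= a) -> `|ulim f| <= a.
Proof.
move=> bf af; rewrite ler_norml; apply/andP; split.
  by apply: ulim_ge_cst => //; apply: filterS af => n; rewrite ler_norml => /andP[].
by apply: ulim_le_cst => //; apply: filterS af => n; rewrite ler_norml => /andP[].
Qed.

Lemma near_ulim f e : bdd f -> 0 < e -> \forall n \near freeU, `|f n - ulim f| < e.
Proof.
move=> bf e0; have /cvgrPdist_lt/(_ _ e0) := ulim_cvg bf.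
by apply: filterS => n; rewrite distrC.
Qed.

Lemma near_ulim_lt f a : bdd f -> ulim f < a -> \forall n \near freeU, f n < a.
Proof.
move=> bf fa; have := near_ulim bf (e := a - ulim f); rewrite subr_gt0 => /(_ fa).
by apply: filterS => n; rewrite ltr_norml; lra.
Qed.

Lemma near_ulim_gt f a : bdd f -> a < ulim f -> \forall n \near freeU, a < f n.
Proof.
move=> bf fa; have := near_ulim bf (e := ulim f - a); rewrite subr_gt0 => /(_ fa).
by apply: filterS => n; rewrite ltr_norml; lra.
Qed.

Lemma near_freeU_ex (P : nat -> Prop) N : (\forall n \near freeU, P n) ->
  exists2 n, (N <= n)%N & P n.
Proof.
move=> UP; have [n [Nn Pn]] := @filter_ex _ freeU _ _ (@filterI _ freeU _ _ _ (freeU_ge N) UP).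
by exists n.
Qed.

End UltraLimit.

(** * Rademacher functionals *)

Section Rademacher.
Variable R : realType.

Definition sgnb (b : bool) : R := (-1) ^+ b.

Lemma sgnb_norm b : `|sgnb b| = 1.
Proof. by rewrite /sgnb normrX normrN1 expr1n. Qed.

Lemma sgnb_sqr b : sgnb b * sgnb b = 1.
Proof. by rewrite /sgnb -signr_addb addbb. Qed.

Definition pattern k (t : {ffun 'I_k -> bool}) (n : nat) : bool :=
  if insub n is Some i then t i else false.

Lemma pattern_ord k (t : {ffun 'I_k -> bool}) (i : 'I_k) : pattern t i = t i.
Proof. by rewrite /pattern valK. Qed.

(** Expectation over independent uniform signs in the first [k] coordinates; [pattern] sets the
    remaining coordinates to [false], so [F] is only sampled at finitely many infinite patterns. *)
Definition avg k (F : (nat -> bool) -> R) : R :=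
  (2 ^+ k)^-1 * \sum_(t : {ffun 'I_k -> bool}) F (pattern t).

Lemma avgD k F G : avg k (fun t => F t + G t) = avg k F + avg k G.
Proof. by rewrite /avg big_split mulrDr. Qed.

Lemma avgZ k a F : avg k (fun t => a * F t) = a * avg k F.
Proof. by rewrite /avg -mulr_sumr mulrCA. Qed.

Lemma avg_sum k (I : Type) (r : seq I) (F : I -> (nat -> bool) -> R) :
  avg k (fun t => \sum_(i <- r) F i t) = \sum_(i <- r) avg k (F i).
Proof. by rewrite /avg exchange_big/= mulr_sumr. Qed.

Lemma avg_cst k (a : R) : avg k (fun=> a) = a.
Proof.
rewrite /avg sumr_const cardT -cardE card_ffun card_bool card_ord.
rewrite -[_ *+ (2 ^ k)]mulr_natl natrX mulrA.
by rewrite mulVf ?mul1r// expf_neq0// pnatr_eq0.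
Qed.

Lemma avg_le k F G : (forall t, F t <= G t) -> avg k F <= avg k G.
Proof.
by move=> FG; rewrite ler_wpM2l ?invr_ge0 ?exprn_ge0// ler_sum.
Qed.

Lemma avg_norm k F : `|avg k F| <= avg k (fun t => `|F t|).
Proof.
rewrite /avg normrM ger0_norm ?invr_ge0 ?exprn_ge0//.
by rewrite ler_wpM2l ?invr_ge0 ?exprn_ge0// ler_norm_sum.
Qed.

Lemma avg_norm_le k F M : (forall t, `|F t| <= M) -> `|avg k F| <= M.
Proof.
by move=> FM; apply: le_trans (avg_norm _ _) _; rewrite -(avg_cst k M) avg_le.
Qed.

(** For [n != m], flipping the [n]-th sign permutes the patterns and changes the sign of the
    product, so the sum equals its own opposite. *)
Lemma avg_orthogonal k n m : (n < k)%N -> (m < k)%N ->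
  avg k (fun t => sgnb (t n) * sgnb (t m)) = (n == m)%:R.
Proof.
move=> nk mk; have [->|nm] := eqVneq n m.
  rewrite -[RHS](avg_cst k) /avg; congr (_ * _).
  by apply: eq_bigr => t _; exact: sgnb_sqr.
pose i := Ordinal nk; pose j := Ordinal mk.
rewrite /avg.
rewrite (eq_bigr (fun t : {ffun 'I_k -> bool} => sgnb (t i) * sgnb (t j))); last first.
  by move=> t _; rewrite -!pattern_ord.
pose h (t : {ffun 'I_k -> bool}) := [ffun l => t l (+) (l == i)].
have hK : involutive h.
  by move=> t; apply/ffunP => l; rewrite !ffunE -addbA addbb addbF.
set S := \sum__ _; suff SS : S = - S.
  by rewrite (_ : S = 0) ?mulr0//; lra.
rewrite {1}/S (reindex_inj (inv_inj hK)) -sumrN; apply: eq_bigr => t _.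
rewrite !ffunE eqxx (_ : (j == i) = false); last by rewrite -val_eqE /= eq_sym (negbTE nm).
by rewrite addbF addbT /sgnb signrN mulNr.
Qed.

(** The second moment is the sum of the squares by orthogonality; the first moment is compared with
    it through |F| <= F^2 / (2 B) + B / 2. *)
Lemma avg_l2 k N (b : nat -> R) B : (N <= k)%N -> 0 < B ->
  \sum_(n < N) b n ^+ 2 <= B ^+ 2 ->
  avg k (fun t => `|\sum_(n < N) b n * sgnb (t n)|) <= B.
Proof.
move=> Nk B0 bB; pose F (t : nat -> bool) := \sum_(n < N) b n * sgnb (t n).
have F2 : avg k (fun t => F t ^+ 2) = \sum_(n < N) b n ^+ 2.
  transitivity (avg k (fun t => \sum_(n < N) \sum_(m < N)
      (b n * b m) * (sgnb (t n) * sgnb (t m)))).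
    congr avg; apply/funext => t; rewrite expr2 mulr_suml; apply: eq_bigr => n _.
    rewrite mulr_sumr; apply: eq_bigr => m _; by rewrite mulrACA.
  rewrite avg_sum; apply: eq_bigr => n _; rewrite avg_sum (bigD1 n)//= big1 ?addr0.
    by rewrite avgZ avg_orthogonal ?(leq_trans (ltn_ord _))// eqxx mulr1.
  move=> m mn; rewrite avgZ avg_orthogonal ?(leq_trans (ltn_ord _))//.
  by rewrite -[(_ == _)]/(n == m) eq_sym (negbTE mn) mulr0.
apply: (@le_trans _ _ (avg k (fun t => (2 * B)^-1 * F t ^+ 2 + B / 2))).
  apply: avg_le => t; rewrite -/(F t).
  have -> : (2 * B)^-1 * F t ^+ 2 + B / 2 =
      `|F t| + (2 * B)^-1 * (`|F t| - B) ^+ 2.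
    by rewrite -[F t ^+ 2]real_normK ?num_real//; field; rewrite gt_eqF.
  by rewrite lerDl mulr_ge0 ?invr_ge0 ?sqr_ge0// mulr_ge0// ltW.
rewrite avgD avgZ avg_cst F2.
have : (2 * B)^-1 * \sum_(n < N) b n ^+ 2 <= (2 * B)^-1 * B ^+ 2.
  by rewrite ler_wpM2l// invr_ge0 mulr_ge0// ltW.
have -> : (2 * B)^-1 * B ^+ 2 = B / 2 by field; rewrite gt_eqF.
lra.
Qed.

End Rademacher.

Section DualSums.
Variables (R : realType) (V : normedModType R).

Lemma dual_sumE (I : Type) (r : seq I) (P : pred I) (F : I -> dual V) x :
  (\sum_(i <- r | P i) F i) x = \sum_(i <- r | P i) F i x.
Proof. by elim/big_rec2 : _ => // i a f _ <-. Qed.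

Lemma dual_scaleE (a : R) (f : dual V) x : (a *: f) x = a * f x.
Proof. by []. Qed.

Lemma dual_addE (f g : dual V) x : (f + g) x = f x + g x.
Proof. by []. Qed.

Lemma dual_oppE (f : dual V) x : (- f) x = - f x.
Proof. by []. Qed.

End DualSums.

(** * Upper l2-estimates and square summability *)

Section L2Dominated.
Variables (R : realType).

(** The upper l2-estimate with constant [K]; a positive bound [B] replaces the l2-norm of [b], which
    avoids square roots. *)
Definition l2_dominated (V : normedModType R) (e : nat -> V) (K : R) : Prop :=
  forall N (b : nat -> R) B, 0 < B -> \sum_(n < N) b n ^+ 2 <= B ^+ 2 ->
    `|\sum_(n < N) b n *: e n| <= B * K.

(** Duality: with the coefficients [phi (e n)] the estimate reads S <= |phi| K sqrt S. This square
    summability is the source of all weak nullness below. *)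
Lemma l2_dominated_sum (V : normedModType R) (e : nat -> V) K (phi : dual V) N : 0 <= K ->
  l2_dominated e K -> \sum_(n < N) phi (e n) ^+ 2 <= (`|phi| * K) ^+ 2.
Proof.
move=> K0 eK; set S := \sum_(n < N) _.
have S0 : 0 <= S by apply: sumr_ge0 => n _; exact: sqr_ge0.
have [->|Sn] := eqVneq S 0; first exact: sqr_ge0.
have Sgt : 0 < Num.sqrt S by rewrite sqrtr_gt0 lt_def Sn.
have := eK N (fun n => phi (e n)) (Num.sqrt S) Sgt; rewrite sqr_sqrtr// => /(_ (lexx _)) h.
have : S <= `|phi| * (Num.sqrt S * K).
  rewrite [leLHS](_ : S = phi (\sum_(n < N) phi (e n) *: e n)); last first.
    by rewrite linear_sum; apply: eq_bigr => n _; rewrite linearZ expr2.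
  apply: le_trans (ler_norm _) _; apply: le_trans (dual_bound _ _) _.
  by apply: ler_wpM2l.
rewrite -{1}(sqr_sqrtr S0) mulrCA {1}expr2 ler_pM2l// => h2.
by rewrite -(sqr_sqrtr S0) ler_sqr ?nnegrE ?mulr_ge0// sqrtr_ge0.
Qed.

Lemma l2_dominated_tail (V : normedModType R) (e : nat -> V) K (phi : dual V) d :
  0 <= K -> l2_dominated e K -> 0 < d ->
  exists N0, forall J N, (N0 <= J)%N -> \sum_(J <= n < N) phi (e n) ^+ 2 <= d.
Proof.
move=> K0 eK d0; pose u n := \sum_(0 <= i < n) phi (e i) ^+ 2.
have ndu : nondecreasing_seq u.
  apply/nondecreasing_seqP => n; rewrite /u big_nat_recr//= lerDl; exact: sqr_ge0.
have cu : cvgn u.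
  apply: (nondecreasing_is_cvgn ndu).
  exists ((`|phi| * K) ^+ 2) => _ [n _ <-]; rewrite /u big_mkord.
  exact: l2_dominated_sum.
have /cvgrPdist_le/(_ _ d0)[N0 _ uN] := cu.
exists N0 => J N NJ; have [NJ'|JN] := leqP N J; first by rewrite big_geq// ltW.
have : \sum_(J <= n < N) phi (e n) ^+ 2 = u N - u J.
  rewrite /u (@big_cat_nat _ _ _ J 0 N xpredT (fun i => phi (e i) ^+ 2) (leq0n J) (ltnW JN)) /=.
  by rewrite [X in X - _]addrC addrK.
move=> ->; have := uN J NJ; rewrite ler_norml => /andP[_].
have := nondecreasing_cvgn_le ndu cu N; lra.
Qed.

(** Termwise, |c p| <= (d / 2) c^2 + p^2 / (2 d). *)
Lemma cauchy_schwarz_tail (c p : nat -> R) J N d : 0 < d ->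
  \sum_(J <= j < N) c j ^+ 2 <= 1 -> \sum_(J <= j < N) p j ^+ 2 <= d ^+ 2 ->
  `|\sum_(J <= j < N) c j * p j| <= d.
Proof.
move=> d0 c1 pd; apply: le_trans (ler_norm_sum _ _ _) _.
apply: (@le_trans _ _ (d / 2 * \sum_(J <= j < N) c j ^+ 2 +
  (2 * d)^-1 * \sum_(J <= j < N) p j ^+ 2)).
  rewrite !mulr_sumr -big_split/=; apply: ler_sum => j _; rewrite normrM.
  rewrite -[c j ^+ 2]real_normK ?num_real// -[p j ^+ 2]real_normK ?num_real//.
  rewrite -subr_ge0 [X in 0 <= X](_ : _ = (2 * d)^-1 * (d * `|c j| - `|p j|) ^+ 2).
    by rewrite mulr_ge0 ?sqr_ge0// invr_ge0 mulr_ge0// ltW.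
  by field; rewrite gt_eqF.
have : d / 2 * \sum_(J <= j < N) c j ^+ 2 <= d / 2.
  by apply: ler_piMr => //; rewrite divr_ge0// ltW.
have : (2 * d)^-1 * \sum_(J <= j < N) p j ^+ 2 <= (2 * d)^-1 * d ^+ 2.
  by rewrite ler_wpM2l// invr_ge0 mulr_ge0// ltW.
have -> : (2 * d)^-1 * d ^+ 2 = d / 2 by field; rewrite gt_eqF.
lra.
Qed.

Lemma l2_dominated_comb (V : normedModType R) (e : nat -> V) K (c : nat -> R) J N :
  l2_dominated e K -> \sum_(J <= j < N) c j ^+ 2 <= 1 ->
  `|\sum_(J <= j < N) c j *: e j| <= K.
Proof.
move=> eK c1; have := eK N (fun j => if (J <= j)%N then c j else 0) 1 ltr01.
rewrite mul1r expr1n -(big_mkord xpredT (fun j => (if (J <= j)%N then c j else 0) ^+ 2)).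
rewrite -(big_mkord xpredT (fun j => (if (J <= j)%N then c j else 0) *: e j)).
have H (W : zmodType) (F G : nat -> W) : (forall j, F j = if (J <= j)%N then G j else 0) ->
    \sum_(0 <= j < N) F j = \sum_(J <= j < N) G j.
  move=> FG; have [NJ|JN] := leqP N J.
    rewrite (big_geq NJ) big_nat_cond big1// => j /andP[/andP[_ jN] _].
    by rewrite FG leqNgt (leq_trans jN NJ).
  rewrite (@big_cat_nat _ _ _ J 0 N xpredT F (leq0n J) (ltnW JN)) /=.
  rewrite big_nat_cond big1 ?add0r.
    by apply: eq_big_nat => j /andP[Jj _]; rewrite FG Jj.
  by move=> j /andP[/andP[_ jJ] _]; rewrite FG leqNgt jJ.
rewrite (H _ _ (fun j => c j ^+ 2)); last by move=> j; case: ifP => // _; rewrite expr0n.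
rewrite (H _ _ (fun j => c j *: e j)); last by move=> j; case: ifP => // _; rewrite scale0r.
exact.
Qed.

End L2Dominated.

Section RademacherFunctionals.
Variables (R : realType) (V : normedModType R) (s : (nat -> bool) -> dual V).

(* A U-limit of finite averages stands in for the integral of
   [t |-> sgnb (t n) * s t x] over {-1,1}^N, which need not be defined: [t |-> s t x]
   is only a bounded function. *)
Definition rad_val n (x : V) : R :=
  ulim (fun k => avg k (fun t => sgnb R (t n) * s t x)).

Variable K : R.
Hypotheses (K0 : 0 <= K) (sK : forall t, `|s t| <= K).

Let sxK t x : `|s t x| <= K * `|x|.
Proof. by apply: le_trans (dual_bound _ _) _; rewrite ler_wpM2r. Qed.

Let rad_bdd n x : bdd (fun k => avg k (fun t => sgnb R (t n) * s t x)).
Proof.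
by exists (K * `|x|) => k; apply: avg_norm_le => t; rewrite normrM sgnb_norm mul1r.
Qed.

Lemma rad_l2 N (b : nat -> R) B x : 0 < B -> \sum_(n < N) b n ^+ 2 <= B ^+ 2 ->
  `|\sum_(n < N) b n * rad_val n x| <= B * K * `|x|.
Proof.
move=> B0 bB; rewrite (eq_bigr (fun n : 'I_N => ulim (fun k => avg k
    (fun t => b n * (sgnb R (t n) * s t x))))); last first.
  by move=> n _; rewrite -ulimZ//; congr ulim; apply/funext => k; rewrite avgZ.
have bF (n : 'I_N) : bdd (fun k => avg k (fun t => b n * (sgnb R (t n) * s t x))).
  rewrite [X in bdd X](_ : _ = (fun k => b n * avg k (fun t => sgnb R (t n) * s t x))).
    exact: bddZ.
  by apply/funext => k; rewrite avgZ.
rewrite -ulim_sum//; apply: ulim_norm_le; first exact: bdd_sum.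
apply: filterS (freeU_ge N) => k Nk; rewrite -avg_sum.
apply: le_trans (avg_norm _ _) _.
apply: (@le_trans _ _ (avg k (fun t => (K * `|x|) * `|\sum_(n < N) b n * sgnb R (t n)|))).
  apply: avg_le => t; under eq_bigr do rewrite mulrA.
  by rewrite -mulr_suml normrM mulrC ler_wpM2r.
by rewrite avgZ mulrC -[B * K * _]mulrA ler_wpM2r ?mulr_ge0// avg_l2.
Qed.

Lemma rad_exists : exists e : nat -> dual V,
  (forall n x, e n x = rad_val n x) /\ l2_dominated e K.
Proof.
have h n : exists f : dual V, forall x, f x = rad_val n x.
  have [||f fE] := @dualE _ _ (rad_val n) K; last by exists f => x; rewrite fE.
    move=> a x y; suff : rad_val n (a *: x + y) = a * rad_val n x + rad_val n y by [].
    rewrite /rad_val -ulimZ// -ulimD//; last exact: bddZ.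
    congr ulim; apply/funext => k; rewrite -avgZ -avgD; congr avg; apply/funext => t.
    rewrite (_ : s t (a *: x + y) = a * s t x + s t y); first by ring.
    by rewrite linearD linearZ.
  move=> x; apply: ulim_norm_le => //; apply: filterE => k.
  by apply: avg_norm_le => t; rewrite normrM sgnb_norm mul1r.
have [e eE] := choice h; exists e; split=> // N b B B0 bB.
apply: dual_norm_bound => [|x]; first by rewrite mulr_ge0// ltW.
rewrite dual_sumE (eq_bigr (fun n : 'I_N => b n * rad_val n x)); first exact: rad_l2.
by move=> n _; rewrite dual_scaleE eE.
Qed.

Lemma rad_biorthogonal (x : nat -> V) : (forall t j, s t (x j) = sgnb R (t j)) ->
  forall n m, rad_val n (x m) = (n == m)%:R.
Proof.
move=> sx n m; rewrite -[RHS]ulim_cst; apply: eq_ulim; last exact: bdd_cst.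
apply: filterS (freeU_ge (maxn n m).+1) => k; rewrite gtn_max => /andP[nk mk].
by rewrite -(avg_orthogonal R nk mk); congr avg; apply/funext => t; rewrite sx.
Qed.

End RademacherFunctionals.

(** * Lifting functionals through an embedding *)

Section StableCriterion.
Variables (R : realType) (X : normedModType R).
Variables (s : (nat -> bool) -> dual X) (K : R).
Hypotheses (K0 : 0 <= K) (sK : forall t, `|s t| <= K).

Lemma embedding_extension (Y : normedModType R) (T : {linear X -> Y}) a (f : dual X) :
  0 < a -> (forall x, a^-1 * `|x| <= `|T x|) ->
  exists2 g : dual Y, `|g| <= a * `|f| & forall x, g (T x) = f x.
Proof.
move=> a0 aT; apply: dual_extension.
- by rewrite mulr_ge0// ltW.
- exact: dual_linear.
- move=> x; apply: le_trans (ler_norm _) _; apply: le_trans (dual_bound _ _) _.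
  by rewrite [a * _]mulrC -mulrA ler_wpM2l// -ler_pdivrMl.
Qed.

(** All [s r] are extended to [Y] first and then averaged as in [rad_val]: the resulting [f j]
    extend [e j] and still satisfy an upper l2-estimate, with constant [a * K]. Hence l2-normalised
    combinations of late [f j] are weakly null, and the errors [u n] are extended with norms tending
    to 0. *)
Lemma weakly_null_stable (x : nat -> X) (xs u e : nat -> dual X) (J N : nat -> nat)
    (c : nat -> nat -> R) :
  bounded_set (range x) -> biorthogonal x xs ->
  (forall n y, e n y = rad_val s n y) ->
  (forall n, xs n = u n + \sum_(J n <= j < N n) c n j *: e j) ->
  (forall n, \sum_(J n <= j < N n) c n j ^+ 2 <= 1) ->
  `|u n| @[n --> \oo] --> (0 : R) -> J n @[n --> \oo] --> \oo ->
  wc0s_stable x xs.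
Proof.
move=> bx bio eE xsE c1 u0 Joo; split=> // Y T [a [b [a0 b0 Tab]]].
have aT z : a^-1 * `|z| <= `|T z| by have [] := Tab z.
have bT z : `|T z| <= b * `|z| by have [] := Tab z.
have /choice[t tE] : forall r, exists g : dual Y,
    `|g| <= a * `|s r| /\ forall z, g (T z) = s r z.
  by move=> r; have [g ? ?] := embedding_extension (s r) a0 aT; exists g.
have /choice[v vE] : forall n, exists g : dual Y,
    `|g| <= a * `|u n| /\ forall z, g (T z) = u n z.
  by move=> n; have [g ? ?] := embedding_extension (u n) a0 aT; exists g.
have aK0 : 0 <= a * K by rewrite mulr_ge0// ltW.
have taK r : `|t r| <= a * K.
  by apply: le_trans (tE r).1 _; rewrite ler_wpM2l// ltW.
have [f [fE fK]] := rad_exists aK0 taK.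
pose ys n := v n + \sum_(J n <= j < N n) c n j *: f j.
(* The average defining [f n] at [T z] is literally the one defining [e n] at [z]. *)
have fT n z : f n (T z) = e n z.
  rewrite fE eE; congr ulim; apply/funext => k; congr avg; apply/funext => r.
  by rewrite (tE r).2.
have ysT n z : ys n (T z) = xs n z.
  rewrite xsE !dual_addE (vE n).2; congr (_ + _); rewrite !dual_sumE.
  by apply: eq_bigr => j _; rewrite !dual_scaleE fT.
have [M [_ xM]] := bx.
have xM1 n : `|x n| <= `|M| + 1.
  by apply: (xM (`|M| + 1)); [rewrite (le_lt_trans (ler_norm M))// ltrDl|exists n].
have M1 : 0 < `|M| + 1 by apply: ltr_wpDl.
exists ys; split.
- by move=> n; apply/funext => z; exact: ysT.
- split.
    have [U uU] : exists U, forall n, `|u n| <= U.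
      have /cvgP/cvg_seq_bounded [U [_ UP]] := u0.
      exists (`|U| + 1) => n; rewrite -[`|u n|]ger0_norm//.
      by apply: UP => //; rewrite (le_lt_trans (ler_norm U))// ltrDl.
    exists (a * U + a * K); split; first exact: num_real.
    move=> r rM _ [n _ <-]; apply: le_trans (ltW rM).
    apply: le_trans (ler_normD _ _) _; apply: lerD; last exact: l2_dominated_comb.
    by apply: le_trans (vE n).1 _; rewrite ler_wpM2l// ltW.
  (* Lower bound for the norms: [ys n] takes the value 1 at [T (x n)], whose norm is at most
     [b * (|M| + 1)]. *)
  exists (b * (`|M| + 1))^-1; first by rewrite invr_gt0 mulr_gt0.
  move=> n; rewrite -div1r ler_pdivrMr ?mulr_gt0//.
  apply: (@le_trans _ _ `|ys n (T (x n))|); first by rewrite ysT bio eqxx normr1.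
  apply: le_trans (dual_bound _ _) _.
  rewrite ler_wpM2l//; apply: le_trans (bT _) _.
  by rewrite ler_wpM2l// ltW.
- move=> phi; apply/cvgrPdist_le => d d0.
  have d2 : 0 < d / 2 by rewrite divr_gt0.
  have [J0 J0P] := l2_dominated_tail phi aK0 fK (exprn_gt0 2 d2).
  (* Chosen so that [|v n| <= a * |u n|] yields [|phi (v n)| <= d / 2]; the summand 1 covers
     [phi = 0]. *)
  have C0 : 0 < 2 * (`|phi| + 1) * a by rewrite !mulr_gt0// ltr_wpDl.
  have /cvgrPdist_le/(_ _ (divr_gt0 d0 C0)) un := u0.
  have /(_ [set n | (J0 <= n)%N]) Jn := Joo.
  have Jn' : \forall n \near \oo, (J0 <= J n)%N by apply: Jn; exists J0.
  near=> n; rewrite sub0r normrN /ys linearD.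
  apply: le_trans (ler_normD _ _) _; rewrite [d]splitr lerD//.
    apply: le_trans (dual_bound _ _) _.
    have un' : `|u n| <= d / (2 * (`|phi| + 1) * a).
      by near: n; apply: filterS un => n; rewrite sub0r normrN normr_id.
    have h1 : `|v n| <= d / (2 * (`|phi| + 1)).
      apply: le_trans (vE n).1 _; rewrite -ler_pdivlMl//.
      apply: le_trans un' _; rewrite le_eqVlt; apply/orP; left; apply/eqP.
      by field; rewrite !gt_eqF//= ltr_wpDl.
    apply: le_trans (ler_wpM2l (normr_ge0 phi) h1) _.
    have p1 : 0 < `|phi| + 1 by rewrite ltr_wpDl.
    rewrite [leLHS](_ : _ = d / 2 * (`|phi| / (`|phi| + 1))); last by field; rewrite gt_eqF.
    apply: ler_piMr; first by rewrite ltW.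
    by rewrite ler_pdivrMr// mul1r lerDl.
  rewrite linear_sum (eq_bigr (fun j => c n j * phi (f j))); last by move=> j _; rewrite linearZ.
  apply: cauchy_schwarz_tail => //; apply: J0P.
  by near: n.
Unshelve. all: by end_near.
Qed.

End StableCriterion.

(** * Sequences equivalent to the unit vector basis of l1 *)

Section EllOneSequences.
Variables (R : realType).

Definition l1_lower (V : normedModType R) (K : R) (e : nat -> V) : Prop :=
  forall N (a : nat -> R), \sum_(i < N) `|a i| <= K * `|\sum_(i < N) a i *: e i|.

Lemma ell1_finite (a : nat -> R) N : exists2 u : ell1 R,
  (forall i, u i = if (i < N)%N then a i else 0) & `|u| = \sum_(i < N) `|a i|.
Proof.
pose f i : R^o := if (i < N)%N then a i else 0.
have fS n : (N <= n)%N -> [normed series f] n = \sum_(i < N) `|a i|.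
  move=> Nn; rewrite [LHS]big_mkord (big_ord_widen n (fun i => `|a i|) Nn).
  rewrite [RHS]big_mkcond/=; apply: eq_bigr => i _; rewrite /f.
  by case: ifP => // _; rewrite normr0.
have cf : [normed series f] n @[n --> \oo] --> (\sum_(i < N) `|a i| : R).
  by apply: cvg_near_cst; exists N.
have fP : f \in @ell1_pred R by rewrite inE; apply/cvg_ex; exists (\sum_(i < N) `|a i|).
exists (Ell1 fP) => //; exact: (cvg_lim _ cf).
Qed.

Lemma embeds_ell1_lower (X : normedModType R) : embeds (ell1 R) X ->
  exists e K M, [/\ 0 < K, l1_lower K (e : nat -> X) & forall n, `|e n| <= M].
Proof.
move=> [T [a [b [a0 b0 Tab]]]].
have /choice[u uP] : forall n, exists u : ell1 R,
    (forall i, u i = (i == n)%:R) /\ `|u| = 1.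
  move=> n; have [u uE nu] := ell1_finite (fun i => (i == n)%:R) n.+1; exists u; split.
    by move=> i; rewrite uE ltnS; case: leqP => // /ltn_eqF; rewrite eq_sym => ->.
  rewrite nu big_ord_recr/= eqxx normr1 big1 ?add0r// => i _.
  by rewrite ltn_eqF// normr0.
exists (T \o u), a, b; split=> // [N c|n]; last first.
  by apply: le_trans (Tab _).2 _; rewrite (uP n).2 mulr1.
have [v vE nv] := ell1_finite c N.
have -> : \sum_(i < N) c i *: (T \o u) i = T v.
  rewrite (_ : v = \sum_(i < N) c i *: u i).
    by rewrite linear_sum; apply: eq_bigr => i _; rewrite linearZ.
  apply/val_inj/funext => j; rewrite [LHS]vE.
  have -> : val (\sum_(i < N) c i *: u i) j = \sum_(i < N) c i * u i j.
    by elim/big_rec2 : _ => // i x y _ <-.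
  case: ltnP => jN.
    rewrite (bigD1 (Ordinal jN))//= (uP j).1 eqxx mulr1 big1 ?addr0// => i ij.
    by rewrite (uP i).1 (_ : (j == i) = false) ?mulr0// eq_sym; exact: negbTE.
  by rewrite big1// => i _; rewrite (uP i).1 gtn_eqF ?mulr0// (leq_trans _ jN).
by rewrite -nv -ler_pdivrMl//; have [] := Tab v.
Qed.

Lemma l1_lower_embeds (X : completeNormedModType R) (e : nat -> X) K M :
  0 < K -> l1_lower K e -> (forall n, `|e n| <= M) -> embeds (ell1 R) X.
Proof.
move=> K0 eK eM.
have M0 : 0 <= M by apply: le_trans (eM 0%N).
pose S (u : ell1 R) n := \sum_(0 <= i < n) (u i : R) *: e i.
have uM (u : ell1 R) i : `|(u i : R) *: e i| <= M * `|u i|.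
  by rewrite normrZ mulrC ler_wpM2r.
have cM (u : ell1 R) : cvgn (series (fun i => M * `|u i|)).
  by apply: (@is_cvg_seriesZ R (fun i => `|u i|)); exact: ell1_cvg.
have cS u : cvgn (S u).
  apply: (@normed_cvg _ _ (fun i => (u i : R) *: e i)).
  apply: (@series_le_cvg _ _ (fun i => M * `|u i|)) => //.
  - by move=> n; exact: normr_ge0.
  - by move=> n; apply: mulr_ge0.
  - by move=> n; exact: uM.
pose T u : X := limn (S u).
have lT : linear T.
  move=> a u v; apply: (@cvg_lim X) => //.
  have -> : S (a *: u + v) = (fun n => a *: S u n + S v n).
    apply/funext => n; rewrite /S scaler_sumr -big_split/=; apply: eq_bigr => i _.
    by rewrite scalerA -scalerDl.
  by apply: cvgD; [apply: cvgZl_tmp; exact: cS|exact: cS].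
pose L : {linear ell1 R -> X} := HB.pack T (GRing.isLinear.Build _ _ _ _ T lT).
exists L, K, (M + 1); split=> //; first by rewrite ltr_wpDl.
move=> u; have nS : `|S u n| @[n --> \oo] --> `|L u| by apply: cvg_norm; exact: cS.
have uS : [normed series u] n @[n --> \oo] --> `|u| by exact: ell1_cvg.
split.
  have KS : K * `|S u n| @[n --> \oo] --> K * `|L u|.
    by apply: cvgM nS; exact: cvg_cst.
  rewrite ler_pdivrMl//; apply: (ler_cvg_to uS KS).
  apply: nearW => n; rewrite /S [leLHS]big_mkord !big_mkord; exact: eK.
apply: (@le_trans _ _ (M * `|u|)); last by rewrite ler_wpM2r// lerDl.
have MuS : M * [normed series u] n @[n --> \oo] --> M * `|u|.
  by apply: cvgM uS; exact: cvg_cst.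
apply: (ler_cvg_to nS MuS).
apply: nearW => n; rewrite /S /series /= mulr_sumr.
by apply: le_trans (ler_norm_sum _ _ _) _; apply: ler_sum.
Qed.

Section Distortion.
Variables (X : normedModType R) (z : nat -> X).

Definition tail_lower n c := forall N (a : nat -> R),
  c * \sum_(n <= i < N) `|a i| <= `|\sum_(n <= i < N) a i *: z i|.

(** Consecutive blocks are flattened into one combination of the [z i]. As all blocks have the same
    l1-norm [d], a tail constant for [z] turns into an l1-estimate for the sequence of blocks. *)
Lemma tail_lower_block n (b : nat -> R) (nn : nat -> nat) (a : nat -> nat -> R) d :
  nn 0%N = n -> (forall j, (nn j <= nn j.+1)%N) ->
  (forall j, \sum_(nn j <= i < nn j.+1) `|a j i| = d) ->
  forall J, exists a', \sum_(j < J) b j *: \sum_(nn j <= i < nn j.+1) a j i *: z i =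
      \sum_(n <= i < nn J) a' i *: z i /\
    \sum_(j < J) d * `|b j| = \sum_(n <= i < nn J) `|a' i|.
Proof.
move=> nn0 nnS ad; have nJ J : (n <= nn J)%N.
  by elim: J => [|J IH]; rewrite ?nn0// (leq_trans IH).
elim=> [|J [a' [IH1 IH2]]]; first by exists (fun=> 0); rewrite !big_ord0 nn0 !big_geq.
pose a2 i := if (i < nn J)%N then a' i else b J * a J i.
have H (W : zmodType) (F G : R -> nat -> W) : 
    \sum_(n <= i < nn J.+1) F (a2 i) i =
    \sum_(n <= i < nn J) F (a' i) i + \sum_(nn J <= i < nn J.+1) F (b J * a J i) i.
  rewrite (@big_cat_nat _ _ _ (nn J) n (nn J.+1) xpredT (fun i => F (a2 i) i) (nJ J) (nnS J)) /=.
  by congr (_ + _); apply: eq_big_nat => i /andP[ni iJ]; rewrite /a2 ?iJ// ltnNge ni.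
exists a2; rewrite !big_ord_recr/= IH1 IH2; split.
  rewrite (H _ (fun x i => x *: z i) (fun x i => x *: z i)); congr (_ + _).
  by rewrite scaler_sumr; apply: eq_bigr => i _; rewrite scalerA.
rewrite (H _ (fun x i => `|x|) (fun x i => `|x|)); congr (_ + _).
by rewrite -(ad J) mulr_suml; apply: eq_bigr => i _; rewrite normrM mulrC.
Qed.

(* James: blocks on which the tail constants are nearly attained span almost
   isometric copies of l1 *)
Lemma l1_distortion K M eps : 0 < K -> l1_lower K z -> (forall n, `|z n| <= M) ->
  0 < eps -> exists e : nat -> X, (forall n, `|e n| <= 1) /\ l1_lower (1 + eps) e.
Proof.
move=> K0 zK zM e0; pose E := [set c | exists n, tail_lower n c].
have EK : E K^-1.
  by exists 0%N => N a; rewrite ler_pdivrMl// !big_mkord; exact: zK.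
have EM : ubound E M.
  move=> c [n /(_ n.+1 (fun=> 1))]; rewrite !big_nat1 normr1 mulr1 scale1r => h.
  exact: le_trans h (zM n).
have hE : has_sup E by split; [exists K^-1|exists M].
(* [th] is spent twice: the tail from [n0] has a constant above [cs / th], while the blocks violate
   the constant [cs * th]. The quotient of the two is [th ^+ 2 = 1 + eps]. *)
pose cs := sup E; pose th := Num.sqrt (1 + eps).
have th2 : th ^+ 2 = 1 + eps by rewrite sqr_sqrtr// addr_ge0// ltW.
have th1 : 1 < th by rewrite -sqrtr1 ltr_sqrt ?ltrDl// addr_gt0.
have th0 : 0 < th := lt_trans ltr01 th1.
have cs0 : 0 < cs.
  by apply: lt_le_trans (ub_le_sup hE.2 EK); rewrite invr_gt0.
have cth : 0 < cs * th by rewrite mulr_gt0.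
have [c0 [n0 c0P] c0lt] : exists2 c, E c & cs / th < c.
  by apply: sup_gt; [exact: hE.1|rewrite ltr_pdivrMr// ltr_pMr].
have blk n : exists Na : nat * (nat -> R), [/\ (n <= Na.1)%N,
    \sum_(n <= i < Na.1) `|Na.2 i| = (cs * th)^-1 &
    `|\sum_(n <= i < Na.1) Na.2 i *: z i| <= 1].
  have : ~ tail_lower n (cs * th).
    move=> h; have : cs * th <= cs by apply: ub_le_sup; [exact: hE.2|exists n].
    by rewrite leNgt ltr_pMr// th1.
  move=> /existsNP[N /existsNP[a /negP]]; rewrite -ltNge => h.
  have t0 : 0 < \sum_(n <= i < N) `|a i|.
    by rewrite -(pmulr_rgt0 _ cth); apply: le_lt_trans h.
  have ct0 : 0 < cs * th * \sum_(n <= i < N) `|a i| by rewrite mulr_gt0.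
  exists (N, fun i => (cs * th * \sum_(n <= i < N) `|a i|)^-1 * a i) => /=; split.
  - by case: leqP t0 => // Nn; rewrite big_geq ?ltxx// ltnW.
  - under eq_bigr do rewrite normrM ger0_norm ?invr_ge0 ?(ltW ct0)//.
    by rewrite -mulr_sumr invfM -mulrA mulVf ?mulr1// gt_eqF.
  - under eq_bigr do rewrite -scalerA.
    by rewrite -scaler_sumr normrZ ger0_norm ?invr_ge0 ?(ltW ct0)// ler_pdivrMl// mulr1 ltW.
have /choice[f fP] := blk.
pose nn j := iter j (fun n => (f n).1) n0.
pose e j := \sum_(nn j <= i < nn j.+1) (f (nn j)).2 i *: z i.
exists e; split; first by move=> n; have [] := fP (nn n).
move=> N b; have [|||a' [aE asum]] :=
  @tail_lower_block n0 b nn (fun j => (f (nn j)).2) (cs * th)^-1 _ _ _ N.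
- by [].
- by move=> j; have [] := fP (nn j).
- by move=> j; have [] := fP (nn j).
have := c0P (nn N) a'; rewrite -aE -asum -mulr_sumr -/(e _) => h.
rewrite -th2; set S := \sum_(i < N) `|b i| in h *.
have S0 : 0 <= S by apply: sumr_ge0.
have : th ^+ 2 * (c0 * ((cs * th)^-1 * S)) <= th ^+ 2 * `|\sum_(j < N) b j *: e j|.
  by rewrite ler_wpM2l// sqr_ge0.
apply: le_trans; rewrite -[leLHS]mul1r !mulrA ler_wpM2r//.
rewrite (_ : _ / _ = c0 / (cs / th)).
  by rewrite ler_pdivlMr ?mul1r ?divr_gt0// ltW.
by field; rewrite !gt_eqF.
Qed.

End Distortion.

Section PolySum.
Variables (V : lmodType R) (e : nat -> V).

(** Polynomials serve as the module of finitely supported sequences, with ['X^j] as unit vectors. *)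
Definition poly_comb (p : {poly R}) : V := \sum_(i < size p) p`_i *: e i.

Lemma poly_combE (p : {poly R}) N : (size p <= N)%N -> poly_comb p = \sum_(i < N) p`_i *: e i.
Proof.
move=> pN; rewrite /poly_comb (big_ord_widen N (fun i => p`_i *: e i) pN).
rewrite big_mkcond/=; apply: eq_bigr => i _; case: ltnP => // pi.
by rewrite nth_default ?scale0r.
Qed.

Lemma poly_comb_linear : linear poly_comb.
Proof.
move=> a p q; pose N := maxn (size (a *: p + q)) (maxn (size p) (size q)).
rewrite !(@poly_combE _ N) ?leq_max ?leqnn ?orbT// scaler_sumr -big_split/=.
by apply: eq_bigr => i _; rewrite coefD coefZ scalerA scalerDl.
Qed.

Lemma poly_combXn j : poly_comb 'X^j = e j.
Proof.
rewrite (@poly_combE _ j.+1) ?size_polyXn// big_ord_recr/= coefXn eqxx scale1r.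
by rewrite big1 ?add0r// => i _; rewrite coefXn ltn_eqF ?scale0r.
Qed.

End PolySum.

(** The lower l1-estimate is exactly the domination that [dual_extension] asks for when the values
    on the [e j] are prescribed signs. *)
Lemma sign_functionals (V : normedModType R) (e : nat -> V) K : 0 <= K -> l1_lower K e ->
  exists s : (nat -> bool) -> dual V,
    (forall t, `|s t| <= K) /\ forall t j, s t (e j) = sgnb R (t j).
Proof.
move=> K0 eK; suff /choice[s sP] : forall t : nat -> bool, exists f : dual V,
    `|f| <= K /\ forall j, f (e j) = sgnb R (t j).
  by exists s; split=> t; have [] := sP t.
move=> t; pose A : {linear {poly R} -> V} :=
  HB.pack (poly_comb e) (GRing.isLinear.Build _ _ _ _ _ (poly_comb_linear e)).
pose sg : nat -> R^o := fun j => sgnb R (t j).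
have [|f fK fA] := @dual_extension _ _ _ A (poly_comb sg) K K0 (poly_comb_linear sg).
  move=> p; apply: le_trans (eK (size p) (fun i => p`_i)).
  apply: le_trans (ler_norm _) _; apply: le_trans (ler_norm_sum _ _ _) _.
  by apply: ler_sum => i _; rewrite normrZ sgnb_norm mulr1.
by exists f; split=> // j; have := fA 'X^j; rewrite /= !poly_combXn.
Qed.

Lemma l1_lower_stable (X : normedModType R) (e : nat -> X) K : 0 <= K ->
  (forall n, `|e n| <= 1) -> l1_lower K e ->
  exists xs, M_bounded K e xs /\ wc0s_stable e xs.
Proof.
move=> K0 e1 eK; have [s [sK se]] := sign_functionals K0 eK.
have [xs [xsE xsK]] := rad_exists K0 sK.
have nxs n : `|xs n| <= K.
  have := l2_dominated_comb (c := fun=> 1) (J := n) (N := n.+1) xsK.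
  by rewrite !big_nat1 expr1n scale1r => /(_ (lexx _)).
have be : bounded_set (range e).
  exists 1; split; [exact: num_real|move=> r r1 _ [n _ <-]]; exact: le_trans (e1 n) (ltW r1).
exists xs; split; first split=> //.
- exists K; split; [exact: num_real|move=> r r1 _ [n _ <-]]; exact: le_trans (nxs n) (ltW r1).
- by move=> n; rewrite -[leRHS]mul1r ler_pM.
(* One-term blocks: [J n = n], [N n = n.+1], coefficient 1 and no error term. *)
apply: (@weakly_null_stable _ _ s K K0 sK e xs (fun=> 0) xs id S (fun _ _ => 1)) => //.
- by move=> n m; rewrite xsE; exact: rad_biorthogonal.
- by move=> n; rewrite big_nat1 scale1r add0r.
- by move=> n; rewrite big_nat1 expr1n.
- by rewrite normr0; exact: cvg_cst.
Qed.

End EllOneSequences.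

(** * Bounded functions and positive functionals *)

Section BoundedFunctions.
Variables (R : realType) (T : pointedType).

Definition bfun_pred : {pred T -> R^o} := mem [set f : T -> R^o | bdd (f : T -> R)].

Record bfun := Bfun { bfun_fun :> T -> R^o; bfunP : bfun_fun \in bfun_pred }.

HB.instance Definition _ := [isSub for bfun_fun].
HB.instance Definition _ := [Choice of bfun by <:].

Lemma bfun_submod_closed : submod_closed bfun_pred.
Proof.
split; first by rewrite inE; exact: bdd_cst.
move=> a f g; rewrite !inE => bf bg.
exact: (@bddD R T (fun t => a * f t) g (bddZ a bf) bg).
Qed.

HB.instance Definition _ := GRing.isSubmodClosed.Build _ _ bfun_pred bfun_submod_closed.
HB.instance Definition _ := [SubChoice_isSubLmodule of bfun by <:].

Definition bfun_norm (f : bfun) : R := sup (range (fun t => `|f t|)).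

Lemma bfun_bdd (f : bfun) : bdd (f : T -> R).
Proof. by have := bfunP f; rewrite inE. Qed.

Lemma bfun_norm_ub (f : bfun) t : `|f t| <= bfun_norm f.
Proof.
apply: ub_le_sup; last by exists t.
by have [M fM] := bfun_bdd f; exists M => _ [u _ <-]; exact: fM.
Qed.

Lemma bfun_norm_le (f : bfun) M : (forall t, `|f t| <= M) -> bfun_norm f <= M.
Proof.
move=> fM; apply: ge_sup; first by exists `|f point|, point.
by move=> _ [t _ <-].
Qed.

Lemma bfun_normD (f g : bfun) : bfun_norm (f + g) <= bfun_norm f + bfun_norm g.
Proof.
apply: bfun_norm_le => t; apply: le_trans (ler_normD (f t) (g t)) _.
by rewrite lerD// bfun_norm_ub.
Qed.

Lemma bfun_normZ (a : R) (f : bfun) : bfun_norm (a *: f) = `|a| * bfun_norm f.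
Proof.
have le_normZ b (g : bfun) : bfun_norm (b *: g) <= `|b| * bfun_norm g.
  apply: bfun_norm_le => t; rewrite -[(b *: g) t]/(b * g t).
  by rewrite normrM ler_wpM2l// bfun_norm_ub.
apply/eqP; rewrite eq_le le_normZ/=.
have [->|a0] := eqVneq a 0.
  by rewrite normr0 mul0r; apply: le_trans (bfun_norm_ub _ point).
have := le_normZ a^-1 (a *: f).
by rewrite scalerA mulVf// scale1r normfV ler_pdivlMl// normr_gt0.
Qed.

Lemma bfun_norm0_eq0 (f : bfun) : bfun_norm f = 0 -> f = 0.
Proof.
move=> f0; apply/val_inj/funext => t; apply/eqP; rewrite -[_ == _]normr_le0.
by have := bfun_norm_ub f t; rewrite f0.
Qed.

HB.instance Definition _ :=
  Lmodule_isNormed.Build R bfun bfun_normD bfun_normZ bfun_norm0_eq0.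

Lemma bfun_norm_ge (f : bfun) t : `|f t| <= `|f|.
Proof. exact: bfun_norm_ub. Qed.

(** Stability quantifies over complete targets, so this is what allows [bfun] as a test space. *)
Lemma bfun_complete (F : set_system bfun) : ProperFilter F -> cauchy F -> cvg F.
Proof.
move=> FF /cauchyP Fc.
have ev (e : R) : 0 < e -> exists f : bfun, F (fun g => forall t, `|f t - g t| <= e).
  move=> e0; have [f fe] := Fc e e0; exists f; apply: filterS fe => g.
  rewrite -ball_normE /= => fg t; apply: le_trans (ltW fg).
  exact: (bfun_norm_ge (f - g) t).
have ct t : cvg (((g : bfun) t : R) @[g --> F]).
  apply: cauchy_cvg; apply/cauchyP => e e0; have e2 : 0 < e / 2 by rewrite divr_gt0.
  have [f fe] := ev _ e2; exists (f t).
  apply: (@filterS _ F _ _ _ _ fe) => g /(_ t) h.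
  by rewrite -ball_normE /=; apply: le_lt_trans h _; rewrite ltr_pdivrMr// ltr_pMr// ltr1n.
pose l t : R := lim (((g : bfun) t : R) @[g --> F]).
have lP (e : R) (f : bfun) : F (fun g => forall t, `|f t - g t| <= e) ->
    forall t, `|f t - l t| <= e.
  move=> fe t; have h : `|f t - (g : bfun) t| @[g --> F] --> `|f t - l t|.
    by apply: cvg_norm; apply: cvgB; [exact: cvg_cst|exact: ct].
  have h2 : e @[g --> F] --> e by exact: cvg_cst.
  by apply: (ler_cvg_to h h2); apply: filterS fe => g; exact.
have bl : bdd l.
  have [f fe] := ev 1 ltr01; have [M fM] := bfun_bdd f; exists (M + 1) => t.
  have := lP _ _ fe t; have := fM t.
  have := ler_normB (f t) (f t - l t); rewrite opprB addrC subrK; lra.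
have lp : (l : T -> R^o) \in bfun_pred by rewrite inE.
apply/cvg_ex; exists (Bfun lp); apply/cvgrPdist_le => e e0.
have e2 : 0 < e / 2 by rewrite divr_gt0.
have [f fe] := ev _ e2; have fl := lP _ _ fe; apply: filterS fe => g gf; apply: bfun_norm_le => t.
rewrite -[((_ : bfun) - g) t]/(l t - g t).
have := fl t; have := gf t; have := ler_normD (f t - g t) (l t - f t).
rewrite [`|l t - f t|]distrC.
have -> : f t - g t + (l t - f t) = l t - g t by ring.
lra.
Qed.

HB.instance Definition _ := Uniform_isComplete.Build bfun bfun_complete.

(* [f] itself when it is bounded, and 0 otherwise *)
Definition to_bfun (f : T -> R) : bfun := insubd 0 (f : T -> R^o).

Lemma to_bfunE f : bdd f -> (to_bfun f : T -> R^o) = f.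
Proof. by move=> bf; rewrite /to_bfun insubdK// inE. Qed.

Lemma to_bfun_linear a f g : bdd f -> bdd g ->
  to_bfun (fun t => a * f t + g t) = a *: to_bfun f + to_bfun g.
Proof.
move=> bf bg; have bfg : bdd (fun t => a * f t + g t) by apply: bddD => //; exact: bddZ.
apply/val_inj/funext => t; transitivity (a * to_bfun f t + to_bfun g t) => //.
by rewrite -[LHS]/(bfun_fun (to_bfun _) t) !to_bfunE.
Qed.

Lemma to_bfun_norm f M : (forall t, `|f t| <= M) -> `|to_bfun f| <= M.
Proof. by move=> fM; apply: bfun_norm_le => t; rewrite to_bfunE//; exists M. Qed.

End BoundedFunctions.

Ltac solve_bdd := lazymatch goal with
  | |- bdd (fun t => @?f t + @?g t) => apply: (@bddD _ _ f g); solve_bdd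
  | |- bdd (fun t => @?f t * @?g t) => apply: (@bddM _ _ f g); solve_bdd
  | |- bdd (fun t => - @?f t) => apply: (@bddN _ _ f); solve_bdd
  | |- bdd (fun t => `| @?f t |) => apply: (@bdd_norm _ _ f); solve_bdd
  | |- bdd (fun t => @?f t ^+ ?n) => apply: (@bddX _ _ f n); solve_bdd
  | _ => first [assumption | exact: bdd_cst | eexists; eassumption | idtac]
  end.

Section PositiveFunctionals.
Variables (R : realType) (T : Type).

(** Integration against a finite, finitely additive measure. [L] is defined on all functions, but
    constrained only at bounded ones. *)
Definition posfun (L : (T -> R) -> R) : Prop :=
  (forall a f g, bdd f -> bdd g -> L (fun t => a * f t + g t) = a * L f + L g) /\
  (forall f, bdd f -> (forall t, 0 <= f t) -> 0 <= L f).

Variable L : (T -> R) -> R.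
Hypothesis posL : posfun L.

Lemma pos_eq f g : (forall t, f t = g t) -> L f = L g.
Proof. by move=> fg; congr L; apply/funext. Qed.

Lemma posD f g : bdd f -> bdd g -> L (fun t => f t + g t) = L f + L g.
Proof.
move=> bf bg; rewrite -[in RHS](mul1r (L f)) -posL.1//; apply: pos_eq => t.
by rewrite mul1r.
Qed.

Lemma pos0 : L (fun=> 0) = 0.
Proof.
have b0 : bdd (fun _ : T => 0 : R) by exact: bdd_cst.
have := posD b0 b0; rewrite (@pos_eq _ (fun=> 0)); last by move=> t; rewrite addr0.
lra.
Qed.

Lemma posZ a f : bdd f -> L (fun t => a * f t) = a * L f.
Proof.
move=> bf; rewrite -[RHS]addr0 -[X in _ + X]pos0 -posL.1//; last exact: bdd_cst.
by apply: pos_eq => t; rewrite addr0.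
Qed.

Lemma posB f g : bdd f -> bdd g -> L (fun t => f t - g t) = L f - L g.
Proof.
move=> bf bg; rewrite posD//; last exact: bddN.
congr (_ + _); rewrite -mulN1r -posZ//; apply: pos_eq => t; by rewrite mulN1r.
Qed.

Lemma pos_le f g : bdd f -> bdd g -> (forall t, f t <= g t) -> L f <= L g.
Proof.
move=> bf bg fg; rewrite -subr_ge0 -posB//; apply: posL.2; first by solve_bdd.
by move=> t; rewrite subr_ge0.
Qed.

Lemma pos_cst a : L (fun=> a) = a * L (fun=> 1).
Proof. by rewrite -posZ; [apply: pos_eq => t; rewrite mulr1|exact: bdd_cst]. Qed.

Lemma pos1 : 0 <= L (fun=> 1).
Proof. by apply: posL.2 => //; exact: bdd_cst. Qed.

Lemma pos_norm_le f M : (forall t, `|f t| <= M) -> `|L f| <= M * L (fun=> 1).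
Proof.
move=> fM; have bf : bdd f by exists M.
rewrite -pos_cst ler_norml; apply/andP; split.
  rewrite -mulN1r -posZ; last exact: bdd_cst.
  apply: pos_le => //; first by solve_bdd.
  by move=> t; have := fM t; rewrite ler_norml mulN1r => /andP[].
by apply: pos_le => //; [exact: bdd_cst|move=> t; exact: le_trans (ler_norm _) (fM t)].
Qed.

Lemma pos_sum (I : Type) (r : seq I) (P : pred I) (F : I -> T -> R) : (forall i, bdd (F i)) ->
  L (fun t => \sum_(i <- r | P i) F i t) = \sum_(i <- r | P i) L (F i).
Proof.
move=> bF; elim: r => [|i r IH].
  by rewrite big_nil -[RHS]pos0; apply: pos_eq => t; rewrite big_nil.
rewrite big_cons -IH; case: ifP => Pi.
  rewrite -posD//; last exact: bdd_sum.
  by apply: pos_eq => t; rewrite big_cons Pi.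
by apply: pos_eq => t; rewrite big_cons Pi.
Qed.

Lemma pos_bdd (f : nat -> T -> R) M : (forall n t, `|f n t| <= M) -> bdd (fun n => L (f n)).
Proof. by move=> fM; exists (M * L (fun=> 1)) => n; exact: pos_norm_le. Qed.

End PositiveFunctionals.

Section Domination.
Variables (R : realType) (T : pointedType).

(* The constraints [y g <= L h] for [`|g| <= h] form a cone to which
   [sublinear_separation] applies, with [p h] the norm of the positive part of [h]. *)
Lemma bfun_dual_dominated (y : dual (bfun R T)) : exists2 L : (T -> R) -> R, posfun L &
  forall f, bdd f -> `|y (to_bfun f)| <= L (fun t => `|f t|).
Proof.
pose pp (h : bfun R T) : bfun R T := to_bfun (fun t => Num.max 0 (h t)).
have bmax (h : bfun R T) : bdd (fun t => Num.max 0 (h t) : R).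
  have [M hM] := bfun_bdd h; exists M => t; have := hM t.
  have := le_trans (normr_ge0 _) (hM t).
  by case: (leP 0 (h t : R)) => _ M0 hM'; rewrite ?normr0.
have ppE h t : pp h t = Num.max 0 (h t) by rewrite /pp to_bfunE.
have pp0 h t : (0 : R) <= pp h t by rewrite ppE le_max lexx.
have pph (h : bfun R T) t : (h t : R) <= pp h t by rewrite ppE le_max lexx orbT.
have ppU (h : bfun R T) M : 0 <= M -> (forall t, (h t : R) <= M) -> `|pp h| <= M.
  move=> M0 hM; apply: bfun_norm_le => t; rewrite ger0_norm// ppE.
  by rewrite ge_max M0 hM.
have ppN (h : bfun R T) t : (h t : R) <= `|pp h|.
  by apply: le_trans (pph h t) _; apply: le_trans (ler_norm _) (bfun_norm_ge _ _).
pose p h := `|y| * `|pp h|.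
have sp : sublinear p.
  split=> [h k|a h a0].
    rewrite /p -mulrDr ler_wpM2l//; apply: ppU; first exact: addr_ge0.
    by move=> t; exact: (lerD (ppN h t) (ppN k t)).
  rewrite /p mulrCA; congr (_ * _); apply/eqP; rewrite eq_le; apply/andP; split.
    apply: ppU; first exact: mulr_ge0.
    by move=> t; exact: (ler_wpM2l a0 (ppN h t)).
  have [->|an] := eqVneq a 0; first by rewrite mul0r.
  have ap : 0 < a by rewrite lt_def an.
  rewrite -ler_pdivlMl//; apply: ppU; first by rewrite mulr_ge0// invr_ge0.
  by move=> t; rewrite ler_pdivlMl//; exact: (ppN (a *: h) t).
pose C := [set hr : bfun R T * R | exists2 g : bfun R T,
  (forall t, `|g t| <= hr.1 t) & hr.2 = y g].
have cC : cone C.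
  split.
  - by exists (0, 0), 0 => [t /=|]; rewrite ?linear0// normr0.
  - move=> [h r] [k s] [g1 /= g1h ->] [g2 /= g2h ->]; exists (g1 + g2); rewrite ?linearD//=.
    by move=> t; apply: le_trans (ler_normD _ _) _; apply: lerD.
  - move=> a [h r] a0 [g /= gh ->]; exists (a *: g); rewrite ?linearZ//=.
    move=> t; apply: (@le_trans _ _ `|a * g t|) => //.
    by rewrite normrM ger0_norm//; exact: (ler_wpM2l a0 (gh t)).
have [|l [ll lp lC]] := sublinear_separation sp cC.
  move=> [h r] [g /= gh ->]; apply: le_trans (ler_norm _) _.
  apply: le_trans (dual_bound _ _) _; rewrite ler_wpM2l//.
  by apply: bfun_norm_le => t; apply: le_trans (gh t) (ppN _ _).
pose l' : {linear bfun R T -> R^o} := HB.pack l (GRing.isLinear.Build _ _ _ _ l ll).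
exists (fun f => l (to_bfun f)).
  split=> [a f g bf bg|f bf f0]; first by rewrite to_bfun_linear// ll.
  have := lp (- to_bfun f); rewrite -[l]/(l' : _ -> _) linearN /p.
  rewrite (_ : `|pp _| = 0) ?mulr0 ?oppr_le0//.
  apply/eqP; rewrite eq_le normr_ge0 andbT; apply: ppU => // t.
  suff : - (to_bfun f t : R) <= 0 by [].
  by rewrite to_bfunE// oppr_le0.
move=> f bf.
have h (g : bfun R T) : (forall t, `|g t| <= `|f t|) -> y g <= l (to_bfun (fun t => `|f t|)).
  move=> gf; apply: (lC (to_bfun (fun t => `|f t|), y g : R)); exists g => //= t.
  by rewrite to_bfunE//; exact: bdd_norm.
rewrite ler_norml lerNl -linearN !h// => t; first by rewrite to_bfunE.
suff : `|- (to_bfun f t : R)| <= `|f t| by [].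
by rewrite to_bfunE// normrN.
Qed.

End Domination.

(** * Independent subsequences *)

Section WeakLimits.
Variables (R : realType) (T : Type) (L : (T -> R) -> R).
Hypothesis posL : posfun L.
Implicit Types (f g h : T -> R) (a b : nat -> T -> R).

Let K := L (fun=> 1).
Let K0 : 0 <= K := pos1 posL.

Definition unit_fun f := forall t, 0 <= f t <= 1.

Lemma unit_norm f : unit_fun f -> forall t, `|f t| <= 1.
Proof. by move=> uf t; have /andP[f0 f1] := uf t; rewrite ger0_norm. Qed.

Lemma unit_bdd f : unit_fun f -> bdd f.
Proof. by move=> uf; exists 1; exact: unit_norm. Qed.

Lemma unitM f g : unit_fun f -> unit_fun g -> unit_fun (fun t => f t * g t).
Proof.
move=> uf ug t; have /andP[f0 f1] := uf t; have /andP[g0 g1] := ug t.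
by rewrite mulr_ge0//= mulr_ile1.
Qed.

(** Stands for the pairing of [f] with the weak limit of [a] in the L^2 space of [L]; that limit is
    never constructed, only approximated. *)
Definition wlim a f : R := ulim (fun n => L (fun t => f t * a n t)).

Lemma wlim_bdd a f : (forall n, unit_fun (a n)) -> bdd f ->
  bdd (fun n => L (fun t => f t * a n t)).
Proof.
move=> ua [M fM]; apply: (pos_bdd posL (M := M)) => n t.
rewrite normrM; apply: le_trans (fM t); rewrite ler_piMr//; exact: unit_norm.
Qed.

Definition clamp (x : R) := Num.max 0 (Num.min 1 x).

Lemma clamp_unit x : 0 <= clamp x <= 1.
Proof. by rewrite /clamp le_max lexx/= ge_max ler01/= ge_min lexx. Qed.

Lemma clamp_dist x y : 0 <= y <= 1 -> (clamp x - y) ^+ 2 <= (x - y) ^+ 2.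
Proof.
move=> /andP[y0 y1]; rewrite -subr_ge0 subr_sqr /clamp.
case: (leP 1 x) => x1; [rewrite (max_r ler01) | case: (leP 0 x) => x0].
- by apply: mulr_ge0; lra.
- by rewrite subrr mul0r.
- by apply: mulr_le0; lra.
Qed.

(* The weak limit of [a] in L^2 is approximated by a [0,1]-valued function: a
   near minimiser of [g |-> |g - a|^2 - |a|^2]. *)
Lemma weak_limit a eps : (forall n, unit_fun (a n)) -> 0 < eps -> exists2 g, unit_fun g &
  forall f, (forall t, `|f t| <= 1) -> `|wlim a f - L (fun t => f t * g t)| <= eps.
Proof.
move=> ua e0; pose q h n t := h t ^+ 2 - 2 * h t * a n t.
pose Q h := ulim (fun n => L (q h n)).
have ba n : bdd (a n) by exact: unit_bdd.
have bq h n : bdd h -> bdd (q h n).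
  move=> bh; apply: bddD; first exact: bddX.
  by apply: bddN; apply: bddM => //; apply: bddZ.
have bQ h : bdd h -> bdd (fun n => L (q h n)).
  move=> bh; have E n : L (q h n) = L (fun t => h t ^+ 2) + (- 2) * L (fun t => h t * a n t).
    rewrite -posZ//; last exact: bddM.
    rewrite -posD//; [|exact: bddX|by apply: bddZ; exact: bddM].
    by apply: pos_eq => t; rewrite /q; ring.
  have [M LM] : bdd (fun n => L (fun t => h t ^+ 2) + (- 2) * L (fun t => h t * a n t)).
    apply: bddD; first exact: bdd_cst.
    by apply: bddZ; exact: wlim_bdd.
  by exists M => n; rewrite E.
have Qle h k : bdd h -> bdd k -> (forall n t, q h n t <= q k n t) -> Q h <= Q k.
  move=> bh bk hk; apply: ulim_le; [exact: bQ|exact: bQ|].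
  by apply: filterE => n; apply: (pos_le posL); [exact: bq|exact: bq|exact: hk].
pose c h t := clamp (h t).
have uc h : unit_fun (c h) by move=> t; exact: clamp_unit.
(* Clamping lets a near minimiser among [0,1]-valued functions be compared with the perturbations
   [g + s * f], which leave that class. *)
have Qc h : bdd h -> Q (c h) <= Q h.
  move=> bh; apply: Qle => // [|n t]; first exact: unit_bdd.
  have := clamp_dist (h t) (ua n t); rewrite /q /c; lra.
have Qexp g f s : bdd g -> bdd f -> Q (fun t => g t + s * f t) =
    Q g + (s * (2 * (L (fun t => f t * g t) - wlim a f)) + s ^+ 2 * L (fun t => f t ^+ 2)).
  move=> bg bf; have bfg : bdd (fun t => f t * g t) by exact: bddM.
  have bfa n : bdd (fun t => f t * a n t) by exact: bddM.
  have E n : L (q (fun t => g t + s * f t) n) = L (q g n) +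
    (s * (2 * L (fun t => f t * g t)) + s ^+ 2 * L (fun t => f t ^+ 2) +
      (- (2 * s)) * L (fun t => f t * a n t)).
    have bf2 : bdd (fun t => f t ^+ 2) by exact: bddX.
    rewrite mulrA -!posZ//.
    rewrite -!posD//; try (by apply: bq); try (by solve_bdd).
    by apply: pos_eq => t; rewrite /q; ring.
  transitivity (ulim (fun n => L (q g n) +
    (s * (2 * L (fun t => f t * g t)) + s ^+ 2 * L (fun t => f t ^+ 2) +
      (- (2 * s)) * L (fun t => f t * a n t)))).
    by congr ulim; apply/funext => n; exact: E.
  rewrite ulimD; [|exact: bQ|by apply: bddD; [exact: bdd_cst|apply: bddZ; exact: wlim_bdd]].
  rewrite ulimD; [|exact: bdd_cst|apply: bddZ; exact: wlim_bdd].
  rewrite ulim_cst ulimZ -/(wlim a f) -/(Q g); [ring|exact: wlim_bdd].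
pose E := [set Q g | g in unit_fun].
have E0 : E !=set0 by exists (Q (c (fun=> 0))), (c (fun=> 0)).
have Elb : lbound E (- (2 * K)).
  move=> _ [g ug <-]; apply: ulim_ge_cst; first by apply: bQ; exact: unit_bdd.
  apply: filterE => n; rewrite -mulNr -pos_cst//.
  apply: pos_le => //; [exact: bdd_cst|by apply: bq; exact: unit_bdd|].
  move=> t; rewrite /q; have /andP[? ?] := ug t; have /andP[? ?] := ua n t; nra.
(* With minimality defect [d ^+ 2] and perturbations [s = d] and [s = - d], the quadratic expansion
   bounds twice the deviation by [d * (1 + K) = eps]. *)
pose d := eps / (K + 1).
have K1 : 0 < K + 1 by rewrite ltr_wpDl.
have d0 : 0 < d by rewrite divr_gt0.
have [_ [g ug <-] gmin] := @inf_adherent _ E (d ^+ 2) (exprn_gt0 2 d0) (conj E0 (ex_intro _ _ Elb)).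
exists g => // f f1; have bg := unit_bdd ug; have bf : bdd f by exists 1.
have f2 : L (fun t => f t ^+ 2) <= K.
  apply: pos_le => //; [exact: bddX|exact: bdd_cst|move=> t].
  by rewrite -[f t ^+ 2]real_normK ?num_real// expr_le1.
have main s : Q g - d ^+ 2 <= Q (fun t => g t + s * f t).
  have bgf : bdd (fun t => g t + s * f t) by solve_bdd.
  apply: le_trans (Qc _ bgf); rewrite lerBlDr; apply: le_trans (ltW gmin) _.
  by rewrite lerD2r; apply: ge_inf; [exists (- (2 * K))|exists (c (fun t => g t + s * f t))].
have := main d; have := main (- d); rewrite !Qexp//.
set D := L _ - _; set F := L _ in f2 *; rewrite distrC sqrrN => h1 h2.
have F0 : 0 <= F by apply: posL.2 => [|t]; [exact: bddX|exact: sqr_ge0].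
have eE : eps = d * (K + 1) by rewrite /d divfK// gt_eqF.
have h3 : d ^+ 2 * F <= d ^+ 2 * K by rewrite ler_wpM2l// sqr_ge0.
have dd : d * (d * (K + 1)) = d ^+ 2 + d ^+ 2 * K by ring.
have h4 : d * (2 * D) <= d * (d * (K + 1)) by rewrite dd; lra.
have h5 : d * (- (2 * D)) <= d * (d * (K + 1)) by rewrite dd; lra.
rewrite ler_pM2l// in h4; rewrite ler_pM2l// in h5.
have dK : 0 < d * (K + 1) by rewrite mulr_gt0.
by rewrite -/D ler_norml eE; apply/andP; split; lra.
Qed.

Section DoubleLimit.
Variables a b : nat -> T -> R.
Hypotheses (ua : forall n, unit_fun (a n)) (ub : forall n, unit_fun (b n)).

Definition wlim2 f : R := ulim (fun m => ulim (fun n => L (fun t => f t * (a m t * b n t)))).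

Let bdd1 f m : (forall t, `|f t| <= 1) -> bdd (fun n => L (fun t => f t * (a m t * b n t))).
Proof.
move=> f1; apply: (pos_bdd posL (M := 1)) => n t.
rewrite normrM mulr_ile1//; exact: (unit_norm (unitM (ua m) (ub n))).
Qed.

Let bdd2 f : (forall t, `|f t| <= 1) ->
  bdd (fun m => ulim (fun n => L (fun t => f t * (a m t * b n t)))).
Proof.
move=> f1; exists (1 * K) => m; apply: ulim_norm_le; first exact: bdd1.
apply: filterE => n; apply: (pos_norm_le posL) => t.
rewrite normrM mulr_ile1//; exact: (unit_norm (unitM (ua m) (ub n))).
Qed.

(** The inner limit replaces [b n] by [g'], with [f * a m] as test function; the outer one then
    replaces [a m] by [g], with test function [f * g']. Each costs [eps / 2]. *)
Lemma wlim2_approx eps : 0 < eps -> exists g g', [/\ unit_fun g, unit_fun g',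
  forall f, (forall t, `|f t| <= 1) -> `|wlim2 f - L (fun t => f t * (g t * g' t))| <= eps,
  forall f, (forall t, `|f t| <= 1) -> `|wlim a f - L (fun t => f t * g t)| <= eps &
  forall f, (forall t, `|f t| <= 1) -> `|wlim b f - L (fun t => f t * g' t)| <= eps].
Proof.
move=> e0; have e2 : 0 < eps / 2 by rewrite divr_gt0.
have [g ug gP] := weak_limit ua e2; have [g' ug' gP'] := weak_limit ub e2.
exists g, g'; split=> // [f f1|f f1|f f1].
- have n1 h k : (forall t, `|h t| <= 1) -> unit_fun k -> forall t, `|h t * k t| <= 1.
    by move=> h1 uk t; rewrite normrM mulr_ile1//; exact: unit_norm.
  have B m : bdd (fun t => f t * g' t * a m t).
    by exists 1; apply: (n1 _ _) => //; exact: n1.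
  rewrite [eps]splitr.
  have -> : wlim2 f - L (fun t => f t * (g t * g' t)) =
      ulim (fun m => ulim (fun n => L (fun t => f t * (a m t * b n t))) -
        L (fun t => f t * g' t * a m t)) +
      (wlim a (fun t => f t * g' t) - L (fun t => f t * g' t * g t)).
    have bw : bdd (fun m => L (fun t => f t * g' t * a m t)).
      by apply: wlim_bdd => //; exists 1; exact: n1.
    rewrite (ulimD (g := fun m => - L (fun t => f t * g' t * a m t)))//; [|exact: bdd2|exact: bddN].
    have -> : ulim (fun m => - L (fun t => f t * g' t * a m t)) = - wlim a (fun t => f t * g' t).
      rewrite -mulN1r -ulimZ//; congr ulim; apply/funext => m; by rewrite mulN1r.
    rewrite -/(wlim2 f) addrA subrK; congr (_ - _); apply: pos_eq => t; ring.
  apply: le_trans (ler_normD _ _) _; apply: lerD; last by apply: gP; exact: n1.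
  apply: ulim_norm_le.
    apply: bddD; [exact: bdd2|apply: bddN; apply: wlim_bdd => //].
    by exists 1; exact: n1.
  apply: filterE => m.
  rewrite (_ : L (fun t => f t * g' t * a m t) = L (fun t => (f t * a m t) * g' t)).
    rewrite (_ : (fun n => L (fun t => f t * (a m t * b n t))) =
        (fun n => L (fun t => (f t * a m t) * b n t))).
      by apply: gP'; exact: n1.
    by apply/funext => n; apply: pos_eq => t; rewrite mulrA.
  by apply: pos_eq => t; rewrite mulrAC.
- by apply: le_trans (gP f f1) _; lra.
- by apply: le_trans (gP' f f1) _; lra.
Qed.

(** Expansion of L (q (g - s)^2) >= 0: a linearised Cauchy-Schwarz inequality, with the parameter
    [s] left free. *)
Lemma pos_square q g s : unit_fun q -> unit_fun g -> 0 <= s ->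
  2 * s * L (fun t => q t * g t) - s ^+ 2 * K <= L (fun t => q t * g t * g t).
Proof.
move=> uq ug s0; have bq := unit_bdd uq; have bg := unit_bdd ug.
have bqg : bdd (fun t => q t * g t) by exact: bddM.
have bqgg : bdd (fun t => q t * g t * g t) by exact: bddM.
have qK : L q <= K.
  by apply: pos_le => //; [exact: bdd_cst|move=> t; have /andP[]:= uq t].
have : 0 <= L (fun t => q t * (g t - s) ^+ 2).
  apply: posL.2 => [|t]; last by rewrite mulr_ge0 ?sqr_ge0//; have /andP[]:= uq t.
  apply: bddM => //; apply: bddX; apply: bddD => //; exact: bdd_cst.
have -> : L (fun t => q t * (g t - s) ^+ 2) =
    L (fun t => q t * g t * g t) + ((- (2 * s)) * L (fun t => q t * g t) + s ^+ 2 * L q).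
  rewrite -(posZ posL (s ^+ 2) bq) -(posZ posL (- (2 * s)) bqg).
  rewrite -(posD posL (bddZ _ bqg) (bddZ _ bq)).
  rewrite -(posD posL bqgg (bddD (bddZ _ bqg) (bddZ _ bq))).
  by apply: pos_eq => t; ring.
have : s ^+ 2 * L q <= s ^+ 2 * K by rewrite ler_wpM2l// sqr_ge0.
lra.
Qed.

(* If phi and psi are the weak L^2 limits of [a] and [b], then [wlim2 h] is the
   integral of [h * phi * psi], and the two conclusions say that those of
   [h * phi^2 * psi] and [h * phi * psi^2] are positive. *)
Lemma wlim2_growth h : unit_fun h -> 0 < wlim2 h -> \forall k \near freeU,
  0 < wlim2 (fun t => h t * a k t) /\ 0 < wlim2 (fun t => h t * b k t).
Proof.
(* With this [s] the quadratic loss [s ^+ 2 * K] is at most [s * c / 2], while the linear term of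
   [pos_square] is at least [3 / 2 * s * c]; hence the bound [s * c] in [sq]. *)
move=> uh; set c := wlim2 h => c0; pose s := c / (2 * (K + 1)).
have K1 : 0 < K + 1 by rewrite ltr_wpDl.
have s0 : 0 < s by rewrite divr_gt0// mulr_gt0.
have sK : s * K <= c / 2.
  rewrite (_ : s * K = c / 2 * (K / (K + 1))); last by rewrite /s; field; rewrite gt_eqF.
  apply: ler_piMr; first by rewrite ltW// divr_gt0.
  by rewrite ler_pdivrMr// mul1r lerDl.
(* The first bound gives [L (h g g') >= 3 / 4 * c]. The second leaves [s * c - 3 * eps > 0] after
   three approximations. *)
pose eps := Num.min (c / 4) (s * c / 4).
have e1 : eps <= c / 4 by rewrite ge_min lexx.
have e2 : eps <= s * c / 4 by rewrite ge_min lexx orbT.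
have e0 : 0 < eps by rewrite lt_min !divr_gt0// mulr_gt0.
have [g [g' [ug ug' wP aP bP]]] := wlim2_approx e0.
have ugg : unit_fun (fun t => g t * g' t) by exact: unitM.
have uhgg : unit_fun (fun t => h t * (g t * g' t)) by exact: unitM.
have hc : c - eps <= L (fun t => h t * (g t * g' t)).
  by have := wP h (unit_norm uh); rewrite ler_norml -/c; lra.
have sq q k : unit_fun q -> unit_fun k ->
    L (fun t => q t * k t) = L (fun t => h t * (g t * g' t)) ->
    s * c <= L (fun t => q t * k t * k t).
  move=> uq uk qk; apply: le_trans (pos_square uq uk (ltW s0)); rewrite qk.
  have : s * (s * K) <= s * (c / 2) by rewrite ler_pM2l.
  have : s * (c - c / 4) <= s * L (fun t => h t * (g t * g' t)).
    by rewrite ler_pM2l//; lra.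
  rewrite (_ : s ^+ 2 * K = s * (s * K)); last by ring.
  lra.
have gen (x : nat -> T -> R) k : (forall n, unit_fun (x n)) ->
    (forall f, (forall t, `|f t| <= 1) -> `|wlim x f - L (fun t => f t * k t)| <= eps) ->
    s * c <= L (fun t => h t * (g t * g' t) * k t) ->
    \forall n \near freeU, 0 < wlim2 (fun t => h t * x n t).
  move=> ux xP sc; have xl : s * c - eps <= wlim x (fun t => h t * (g t * g' t)).
    by have := xP _ (unit_norm uhgg); rewrite ler_norml; lra.
  have bx : bdd (fun n => L (fun t => h t * (g t * g' t) * x n t)).
    by apply: wlim_bdd => //; exact: unit_bdd.
  have xl2 : s * c - 2 * eps < wlim x (fun t => h t * (g t * g' t)) by lra.
  apply: filterS (near_ulim_gt bx xl2) => n hn.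
  have := wP _ (unit_norm (unitM uh (ux n))); rewrite ler_norml => /andP[+ _].
  rewrite (_ : L (fun t => h t * x n t * (g t * g' t)) =
      L (fun t => h t * (g t * g' t) * x n t)); last first.
    by apply: pos_eq => t; rewrite mulrAC.
  have : 0 < s * c by rewrite mulr_gt0.
  lra.
apply: filterI.
  apply: (gen a g) => //.
  rewrite (_ : L _ = L (fun t => (h t * g' t) * g t * g t)); last by apply: pos_eq => t; ring.
  apply: sq => //; first exact: unitM.
  by apply: pos_eq => t; ring.
apply: (gen b g') => //.
rewrite (_ : L _ = L (fun t => (h t * g t) * g' t * g' t)); last by apply: pos_eq => t; ring.
apply: sq => //; first exact: unitM.
by apply: pos_eq => t; ring.
Qed.

(** [Hs n] lists the 2^n products of [a] or [b] over the first [n] chosen indices, all with positive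
    [wlim2]. By [wlim2_growth] the good next indices for each product form a set of the ultrafilter,
    so one index serves the whole list. A product with positive [wlim2] is positive at some point,
    and that point realises its pattern. *)
Lemma independent_subsequence : 0 < wlim2 (fun=> 1) -> exists s : nat -> nat,
  forall N (e : nat -> bool), exists t, forall i, (i < N)%N ->
    0 < (if e i then b (s i) t else a (s i) t).
Proof.
move=> w1; pose ok (H : seq (T -> R)) := forall h, List.In h H -> unit_fun h /\ 0 < wlim2 h.
pose ext H k : seq (T -> R) :=
  List.map (fun h t => h t * a k t) H ++ List.map (fun h t => h t * b k t) H.
have okext H : ok H -> exists k, ok (ext H k).
  move=> okH; suff : \forall k \near freeU, forall h, List.In h H ->
      0 < wlim2 (fun t => h t * a k t) /\ 0 < wlim2 (fun t => h t * b k t).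
    move=> /(near_freeU_ex 0%N)[k _ kP]; exists k => f fH.
    have [fH1|fH1] := List.in_app_or _ _ _ fH;
      have [h [<- hH]] := (List.in_map_iff _ _ _).1 fH1.
      by split; [apply: unitM => //; exact: (okH h hH).1|exact: (kP h hH).1].
    by split; [apply: unitM => //; exact: (okH h hH).1|exact: (kP h hH).2].
  elim: H okH => [|h H IH] okH; first by apply: filterE => k h [].
  have okH' : ok H by move=> k kH; apply: okH; right.
  have [uh wh] := okH h (or_introl erefl).
  by apply: filterS2 (wlim2_growth uh wh) (IH okH') => k hk Hk h' [<-//|]; exact: Hk.
have /choice[F FP] : forall H, exists k, ok H -> ok (ext H k).
  by move=> H; have [/okext[k]|nH] := pselect (ok H); [exists k|exists 0%N].
pose Hs := fix Hs n := if n is n'.+1 then ext (Hs n') (F (Hs n')) else [:: (fun=> 1) : T -> R].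
have okHs n : ok (Hs n).
  elim: n => [|n IH]; last exact: FP.
  by move=> h [<-|[]//]; split => // t; rewrite ler01 lexx.
exists (fun n => F (Hs n)) => N e.
pose P n t := \prod_(i < n) (if e i then b (F (Hs i)) t else a (F (Hs i)) t).
have PH n : List.In (P n) (Hs n).
  elim: n => [|n IH]; first by left; apply/funext => t; rewrite /P big_ord0.
  apply: List.in_or_app; case E: (e n); [right|left];
  apply: (List.in_map_iff _ _ _).2; exists (P n); split=> //;
  by apply/funext => t; rewrite /P big_ord_recr/= E.
have [uP wP] := okHs N _ (PH N).
have [t tP] : exists t, 0 < P N t.
  apply: contrapT => /forallNP nP; move: wP; rewrite (_ : wlim2 _ = 0) ?ltxx//.
  rewrite -[RHS]ulim_cst; congr ulim; apply/funext => m.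
  rewrite -[RHS]ulim_cst; congr ulim; apply/funext => n.
  rewrite -(pos0 posL); apply: pos_eq => t.
  suff -> : P N t = 0 by rewrite mul0r.
  apply/eqP; rewrite eq_le; have /andP[-> _] := uP t; rewrite andbT leNgt; apply/negP; exact: nP.
exists t => i iN; rewrite lt_def; apply/andP; split.
  apply/eqP => z; move: tP; rewrite /P (bigD1 (Ordinal iN))//= z mul0r ltxx//.
by case: (e i); [have /andP[] := ub (F (Hs i)) t|have /andP[] := ua (F (Hs i)) t].
Qed.

End DoubleLimit.

End WeakLimits.

Section Oscillation.
Variables (R : realType) (T : Type) (L : (T -> R) -> R).
Hypothesis posL : posfun L.
Variables (x : nat -> T -> R) (M : R).
Hypotheses (M0 : 0 < M) (xM : forall n t, `|x n t| <= M).

Definition ind_lt (r : R) n t : R := (x n t < r)%R%:R.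
Definition ind_gt (s : R) n t : R := (s < x n t)%R%:R.

Lemma ind_lt_unit r n : unit_fun (ind_lt r n).
Proof. by move=> t; rewrite /ind_lt; case: ltP; rewrite ?lexx ?ler01. Qed.

Lemma ind_gt_unit s n : unit_fun (ind_gt s n).
Proof. by move=> t; rewrite /ind_gt; case: ltP; rewrite ?lexx ?ler01. Qed.

(** Points more than [2 * th] apart are separated by a whole cell of the grid of mesh [th], and a
    separating cell contributes [2 * M], the largest possible distance. Only finitely many cells
    occur, so the bound passes through [L] and both limits. *)
Lemma grid_bound th u v : 0 < th -> `|u| <= M -> `|v| <= M ->
  `|u - v| <= 2 * th + \sum_(i < (Num.truncn (2 * M / th)).+2)
    2 * M * ((u < - M + i%:R * th)%R%:R * (- M + i%:R * th + th < v)%R%:R +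
             (- M + i%:R * th + th < u)%R%:R * (v < - M + i%:R * th)%R%:R).
Proof.
move=> th0 uM vM.
have key u' v' : `|u'| <= M -> `|v'| <= M -> u' + 2 * th < v' ->
    exists i : 'I_(Num.truncn (2 * M / th)).+2,
      u' < - M + i%:R * th /\ - M + i%:R * th + th < v'.
  rewrite !ler_norml => /andP[u1 u2] /andP[v1 v2] uv.
  (* [u'] lies in cell [n], so cell [n.+1] starts above [u'] and ends at most at [u' + 2 * th]. This
     shift accounts for the second successor in the number of cells. *)
  pose n := Num.truncn ((u' + M) / th).
  have q0 : 0 <= (u' + M) / th by rewrite divr_ge0 ?(ltW th0)//; lra.
  have /andP[n1 n2] : n%:R <= (u' + M) / th < n.+1%:R by exact: truncn_itv.
  have nN : (n.+1 < (Num.truncn (2 * M / th)).+2)%N.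
    rewrite !ltnS; apply: le_truncn; rewrite ler_pM2r ?invr_gt0//; lra.
  exists (Ordinal nN) => /=; move: n1 n2; rewrite ler_pdivlMr// ltr_pdivrMr// => n1 n2.
  split; first by lra.
  rewrite -natr1 in n2 *; lra.
set S := \sum_(i < _) _.
have term0 (b c d e : bool) : 0 <= 2 * M * (b%:R * c%:R + d%:R * e%:R).
  by rewrite mulr_ge0// ?addr_ge0 ?mulr_ge0// ltW.
have S0 : 0 <= S by apply: sumr_ge0 => i _; exact: term0.
have uv2 : `|u - v| <= 2 * M.
  apply: le_trans (ler_normB _ _) _; lra.
have [small|] := leP `|u - v| (2 * th); first by lra.
rewrite ltr_normr => /orP[d|d].
  have [|i [i1 i2]] := key v u vM uM; first by lra.
  suff : 2 * M <= S by lra.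
  rewrite /S (bigD1 i)//= i1 i2 !mulr1n mulr1.
  apply: (@le_trans _ _ (2 * M * ((u < - M + i%:R * th)%R%:R *
      (- M + i%:R * th + th < v)%R%:R + 1))).
    by rewrite ler_pMr ?mulr_gt0// lerDr mulr_ge0.
  by rewrite lerDl; apply: sumr_ge0 => j _; exact: term0.
have [|i [i1 i2]] := key u v uM vM; first by lra.
suff : 2 * M <= S by lra.
rewrite /S (bigD1 i)//= i1 i2 !mulr1n mulr1.
apply: (@le_trans _ _ (2 * M * (1 + (- M + i%:R * th + th < u)%R%:R * (v < - M + i%:R * th)%R%:R))).
  by rewrite ler_pMr ?mulr_gt0// lerDl mulr_ge0.
by rewrite lerDl; apply: sumr_ge0 => j _; exact: term0.
Qed.

(** If no cell had a positive double limit, integrating [grid_bound] would give d <= 2 th K <= d /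
    2. Two alternatives arise since the outer index may be the one below [r] or the one above
    [s]. *)
Lemma oscillation :
  0 < ulim (fun m => ulim (fun k => L (fun t => `|x m t - x k t|))) ->
  exists r s, r < s /\ (0 < wlim2 L (ind_lt r) (ind_gt s) (fun=> 1) \/
                        0 < wlim2 L (ind_gt s) (ind_lt r) (fun=> 1)).
Proof.
set d := ulim _ => d0; apply: contrapT => nex.
pose K := L (fun=> 1); have K0 : 0 <= K := pos1 posL.
pose th := d / (4 * (K + 1)).
have K1 : 0 < K + 1 by rewrite ltr_wpDl.
have th0 : 0 < th by rewrite divr_gt0// mulr_gt0.
pose r (i : nat) : R := - M + i%:R * th; pose s i := r i + th.
pose N := (Num.truncn (2 * M / th)).+2.
have wAB i : wlim2 L (ind_lt (r i)) (ind_gt (s i)) (fun=> 1) <= 0.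
  rewrite leNgt; apply/negP => w; apply: nex; exists (r i), (s i); split; last by left.
  by rewrite ltrDl.
have wBA i : wlim2 L (ind_gt (s i)) (ind_lt (r i)) (fun=> 1) <= 0.
  rewrite leNgt; apply/negP => w; apply: nex; exists (r i), (s i); split; last by right.
  by rewrite ltrDl.
pose AB i m k t := 1 * (ind_lt (r i) m t * ind_gt (s i) k t).
pose BA i m k t := 1 * (ind_gt (s i) m t * ind_lt (r i) k t).
have AB1 i m k t : `|AB i m k t| <= 1.
  rewrite /AB mul1r; apply: (unit_norm (unitM (ind_lt_unit _ m) (ind_gt_unit _ k))).
have BA1 i m k t : `|BA i m k t| <= 1.
  rewrite /BA mul1r; apply: (unit_norm (unitM (ind_gt_unit _ m) (ind_lt_unit _ k))).
have inner (F : nat -> nat -> T -> R) C : (forall m k t, `|F m k t| <= C) ->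
    (forall m, bdd (fun k => L (F m k))) /\ bdd (fun m => ulim (fun k => L (F m k))).
  move=> FC; have b1 m : bdd (fun k => L (F m k)) by exact: (pos_bdd posL (M := C)).
  split=> //; exists (C * K) => m; apply: ulim_norm_le => //.
  by apply: filterE => k; exact: (pos_norm_le posL).
have [bAB1 bAB2] : (forall i m, bdd (fun k => L (AB i m k))) /\
    forall i, bdd (fun m => ulim (fun k => L (AB i m k))).
  by split=> i; have [] := inner (AB i) 1 (AB1 i).
have [bBA1 bBA2] : (forall i m, bdd (fun k => L (BA i m k))) /\
    forall i, bdd (fun m => ulim (fun k => L (BA i m k))).
  by split=> i; have [] := inner (BA i) 1 (BA1 i).
have [|bx1 bx2] := inner (fun m k t => `|x m t - x k t|) (2 * M).
  move=> m k t; rewrite normr_id; apply: le_trans (ler_normB _ _) _.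
  by have := xM m t; have := xM k t; lra.
have step m k : L (fun t => `|x m t - x k t|) <=
    2 * th * K + \sum_(i < N) 2 * M * (L (AB i m k) + L (BA i m k)).
  have bF (i : 'I_N) : bdd (fun t => 2 * M * (AB i m k t + BA i m k t)).
    by apply: bddZ; apply: bddD; exists 1; [exact: AB1|exact: BA1].
  have -> : 2 * th * K + \sum_(i < N) 2 * M * (L (AB i m k) + L (BA i m k)) =
      L (fun t => 2 * th + \sum_(i < N) 2 * M * (AB i m k t + BA i m k t)).
    rewrite posD//; [|exact: bdd_cst|exact: bdd_sum].
    rewrite [L (fun=> 2 * th)]pos_cst// pos_sum//; congr (_ + _); apply: eq_bigr => i _.
    rewrite posZ//; last by apply: bddD; exists 1; [exact: AB1|exact: BA1].
    by rewrite posD//; exists 1; [exact: AB1|exact: BA1].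
  apply: (pos_le posL).
  - exists (2 * M) => t; rewrite normr_id; apply: le_trans (ler_normB _ _) _.
    by have := xM m t; have := xM k t; lra.
  - by apply: bddD; [exact: bdd_cst|exact: bdd_sum].
  move=> t; apply: le_trans (grid_bound th0 (xM m t) (xM k t)) _.
  rewrite lerD2l; apply: ler_sum => i _; rewrite /AB /BA !mul1r /ind_lt /ind_gt /s /r.
  by rewrite lexx.
have bs1 m : bdd (fun k => \sum_(i < N) 2 * M * (L (AB i m k) + L (BA i m k))).
  by apply: bdd_sum => i; apply: bddZ; exact: bddD.
have bs2 : bdd (fun m => \sum_(i < N) 2 * M *
    (ulim (fun k => L (AB i m k)) + ulim (fun k => L (BA i m k)))).
  by apply: bdd_sum => i; apply: bddZ; exact: bddD.
have step2 m : ulim (fun k => L (fun t => `|x m t - x k t|)) <= 2 * th * K +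
    \sum_(i < N) 2 * M * (ulim (fun k => L (AB i m k)) + ulim (fun k => L (BA i m k))).
  have -> : \sum_(i < N) 2 * M * (ulim (fun k => L (AB i m k)) + ulim (fun k => L (BA i m k))) =
      ulim (fun k => \sum_(i < N) 2 * M * (L (AB i m k) + L (BA i m k))).
    rewrite ulim_sum; last by move=> i; apply: bddZ; exact: bddD.
    by apply: eq_bigr => i _; rewrite ulimZ ?ulimD//; exact: bddD.
  rewrite -(ulim_cst (2 * th * K)) -ulimD//; last exact: bdd_cst.
  by apply: ulim_le => //; [apply: bddD => //; exact: bdd_cst|exact: filterE].
have : d <= 2 * th * K + 0.
  apply: (@le_trans _ _ (2 * th * K + \sum_(i < N) 2 * M *
      (wlim2 L (ind_lt (r i)) (ind_gt (s i)) (fun=> 1) +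
       wlim2 L (ind_gt (s i)) (ind_lt (r i)) (fun=> 1)))); last first.
    rewrite lerD2l; apply: sumr_le0 => i _; apply: mulr_ge0_le0.
      by rewrite mulr_ge0// ltW.
    by have := wAB i; have := wBA i; lra.
  have -> : \sum_(i < N) 2 * M * (wlim2 L (ind_lt (r i)) (ind_gt (s i)) (fun=> 1) +
       wlim2 L (ind_gt (s i)) (ind_lt (r i)) (fun=> 1)) = ulim (fun m => \sum_(i < N) 2 * M *
      (ulim (fun k => L (AB i m k)) + ulim (fun k => L (BA i m k)))).
    rewrite ulim_sum; last by move=> i; apply: bddZ; exact: bddD.
    by apply: eq_bigr => i _; rewrite ulimZ ?ulimD//; exact: bddD.
  rewrite -(ulim_cst (2 * th * K)) -ulimD//; last exact: bdd_cst.
  by apply: ulim_le => //; [apply: bddD => //; exact: bdd_cst|exact: filterE].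
have -> : 2 * th * K = d / 2 * (K / (K + 1)) by rewrite /th; field; rewrite gt_eqF.
have : d / 2 * (K / (K + 1)) <= d / 2.
  apply: ler_piMr; first by rewrite ltW// divr_gt0.
  by rewrite ler_pdivrMr// mul1r lerDl.
lra.
Qed.

End Oscillation.

(** * Isometric embedding into bounded functions, and Rosenthal's criterion for l1 *)

Section NormingEmbedding.
Variables (R : realType) (X : normedModType R).

Lemma norming_functional (z : X) : exists2 f : dual X, `|f| <= 1 & f z = `|z|.
Proof.
pose A0 (a : R^o) : X := a *: z.
have lA : linear A0 by move=> b u v; rewrite /A0 scalerDl scalerA.
pose A : {linear R^o -> X} := HB.pack A0 (GRing.isLinear.Build _ _ _ _ A0 lA).
pose s (a : R^o) : R^o := a * `|z|.
have ls : linear s by move=> b u v; rewrite /s mulrDl -[b *: u]/(b * u) -mulrA.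
have [|f f1 fA] := @dual_extension _ _ _ A s 1 ler01 ls.
  by move=> a; rewrite mul1r normrZ ler_wpM2r// ler_norm.
by exists f => //; have := fA 1; rewrite /= /A0 /s scale1r mul1r.
Qed.

(** Evaluation on the dual unit ball, precomposed with the radial retraction of the whole dual onto
    it: this gives a bounded function on [dual X] without a subtype for the ball, and still linear
    in [z]. *)
Definition ball_eval (z : X) (t : dual X) : R := (Num.max 1 `|t|)^-1 * t z.

Lemma ball_evalE z (t : dual X) : `|t| <= 1 -> ball_eval z t = t z.
Proof. by move=> t1; rewrite /ball_eval max_l// invr1 mul1r. Qed.

Lemma ball_eval_norm z t : `|ball_eval z t| <= `|z|.
Proof.
rewrite /ball_eval; set m := Num.max _ _.
have m0 : 0 < m by rewrite lt_max ltr01.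
rewrite normrM gtr0_norm ?invr_gt0// ler_pdivrMl//.
by apply: le_trans (dual_bound _ _) _; rewrite ler_wpM2r// le_max lexx orbT.
Qed.

Lemma ball_eval_sum N (a : nat -> R) (x : nat -> X) t :
  ball_eval (\sum_(i < N) a i *: x i) t = \sum_(i < N) a i * ball_eval (x i) t.
Proof.
rewrite /ball_eval linear_sum mulr_sumr; apply: eq_bigr => i _.
by rewrite linearZ mulrCA.
Qed.

Definition bfun_embed (z : X) : bfun R (dual X) := to_bfun (ball_eval z).

Lemma bfun_embedE z : (bfun_embed z : dual X -> R^o) = ball_eval z.
Proof. by rewrite to_bfunE//; exists `|z|; exact: ball_eval_norm. Qed.

Lemma bfun_embed_linear : linear bfun_embed.
Proof.
move=> a u v; rewrite /bfun_embed -to_bfun_linear; last 2 first.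
- by exists `|u|; exact: ball_eval_norm.
- by exists `|v|; exact: ball_eval_norm.
congr to_bfun; apply/funext => t; rewrite /ball_eval linearD linearZ /=.
by rewrite mulrDr mulrCA.
Qed.

Lemma bfun_embed_norm z : `|bfun_embed z| = `|z|.
Proof.
apply/eqP; rewrite eq_le; apply/andP; split.
  by apply: to_bfun_norm; exact: ball_eval_norm.
have [f f1 fz] := norming_functional z.
apply: le_trans (bfun_norm_ge _ f); rewrite bfun_embedE ball_evalE// fz.
exact: ler_norm.
Qed.

(** Take [t] realising the signs of [a] and [u] realising the opposite ones. The values of the
    combination at [t] and [u] differ by at least [(q - r)] times the l1-norm of [a], and each is at
    most its norm. *)
Lemma l1_lower_of_patterns (x : nat -> X) (s : nat -> nat) r q : r < q ->
  (forall N (e : nat -> bool), exists t, forall i, (i < N)%N ->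
    if e i then q < ball_eval (x (s i)) t else ball_eval (x (s i)) t < r) ->
  l1_lower (2 / (q - r)) (x \o s).
Proof.
move=> rq pat N a; have qr : 0 < q - r by rewrite subr_gt0.
have [t tP] := pat N (fun i => 0 < a i); have [u uP] := pat N (fun i => ~~ (0 < a i)).
set z := \sum_(i < N) _ *: _; rewrite -mulrA mulrCA ler_pdivlMl//.
have -> : (q - r) * \sum_(i < N) `|a i| = \sum_(i < N) (q - r) * `|a i| by rewrite mulr_sumr.
have h : \sum_(i < N) (q - r) * `|a i| <= ball_eval z t - ball_eval z u.
  rewrite !ball_eval_sum -sumrB; apply: ler_sum => i _.
  rewrite -mulrBr; have := tP i (ltn_ord i); have := uP i (ltn_ord i).
  case: (ltP 0 (a i)) => /= a0 h1 h2.
    by rewrite gtr0_norm// mulrC ler_pM2l// /=; lra.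
  have an : 0 <= - a i by rewrite oppr_ge0.
  have h3 : q - r <= ball_eval (x (s i)) u - ball_eval (x (s i)) t by lra.
  by have := ler_wpM2l an h3; rewrite ler0_norm//=; lra.
apply: le_trans h _.
have := ball_eval_norm z t; have := ball_eval_norm z u; rewrite !ler_norml; lra.
Qed.

End NormingEmbedding.

(** * Weakly null sequences in the dual of a space of bounded functions *)

Section Sums.
Variable R : realType.

Lemma prod_one_sub_bounds (I : Type) (r : seq I) (a : I -> R) :
  (forall i, 0 <= a i <= 1) -> 0 <= \prod_(i <- r) (1 - a i) <= 1.
Proof.
move=> a01; elim: r => [|i r /andP[h0 h1]]; first by rewrite big_nil ler01 lexx.
rewrite big_cons; have /andP[ai0 ai1] := a01 i.
by rewrite mulr_ge0 ?subr_ge0//= mulr_ile1 ?subr_ge0// gerBl.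
Qed.

Lemma prod_one_sub_ge (I : Type) (r : seq I) (a : I -> R) : (forall i, 0 <= a i <= 1) ->
  1 - \sum_(i <- r) a i <= \prod_(i <- r) (1 - a i).
Proof.
move=> a01; elim: r => [|i r IH]; first by rewrite !big_nil subr0.
rewrite !big_cons; have /andP[ai0 ai1] := a01 i.
have /andP[p0 p1] := prod_one_sub_bounds r a01.
have : a i * \prod_(i <- r) (1 - a i) <= a i by rewrite ler_piMr.
rewrite mulrBl mul1r; lra.
Qed.

(** The [j]-th term is the probability that [j] is the last success in independent trials with
    success probabilities [a i]. *)
Lemma sum_mul_prod_one_sub N (a : nat -> R) : (forall i, 0 <= a i <= 1) ->
  \sum_(0 <= j < N) a j * \prod_(j.+1 <= i < N) (1 - a i) <= 1.
Proof.
move=> a01; elim: N => [|N IH]; first by rewrite big_geq.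
rewrite big_nat_recr//= [X in _ + a N * X]big_geq// mulr1.
have -> : \sum_(0 <= j < N) a j * \prod_(j.+1 <= i < N.+1) (1 - a i) =
    (\sum_(0 <= j < N) a j * \prod_(j.+1 <= i < N) (1 - a i)) * (1 - a N).
  rewrite mulr_suml; apply: eq_big_nat => j /andP[_ jN].
  by rewrite big_nat_recr//= mulrA.
have /andP[aN0 aN1] := a01 N.
have : (\sum_(0 <= j < N) a j * \prod_(j.+1 <= i < N) (1 - a i)) * (1 - a N) <= 1 * (1 - a N).
  by rewrite ler_wpM2r// subr_ge0.
lra.
Qed.

Lemma geometric_le1 k N : \sum_(k <= j < N) (2 ^+ j.+1)^-1 <= 1 :> R.
Proof.
have [Nk|kN] := leqP N k; first by rewrite big_geq// ler01.
rewrite (@telescope_sumr_eq _ k N (fun j => - (2 ^+ j)^-1)) ?(ltnW kN)//.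
  rewrite opprK addrC; apply: (@le_trans _ _ (2 ^+ k)^-1).
    by rewrite gerDl oppr_le0 invr_ge0 exprn_ge0.
  by rewrite invf_le1 ?exprn_gt0// exprn_ege1// ler1n.
move=> j _; rewrite opprK exprS invfM.
have : (2 ^+ j : R) != 0 by rewrite expf_neq0// pnatr_eq0.
move=> j0; by field.
Qed.

Lemma near_all_lt (T : Type) (F : set_system T) (P : nat -> T -> Prop) N : Filter F ->
  (forall n, \forall x \near F, P n x) -> \forall x \near F, forall n, (n < N)%N -> P n x.
Proof.
move=> FF FP; elim: N => [|N IH]; first by apply: filterE.
apply: filterS2 IH (FP N) => x IH PN n; rewrite ltnS leq_eqVlt => /predU1P[->//|]; exact: IH.
Qed.

End Sums.

Section SlidingHump.
Variables (R : realType) (T : pointedType).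
Local Notation B := (bfun R T).

Lemma to_bfun_sum (I : Type) (r : seq I) (P : pred I) (F : I -> T -> R) :
  (forall i, bdd (F i)) ->
  to_bfun (fun t => \sum_(i <- r | P i) F i t) = \sum_(i <- r | P i) to_bfun (F i).
Proof.
move=> bF; apply/val_inj/funext => t.
transitivity (\sum_(i <- r | P i) F i t).
  by rewrite -[LHS]/(bfun_fun (to_bfun _) t) to_bfunE//; exact: bdd_sum.
transitivity (\sum_(i <- r | P i) (to_bfun (F i) t : R)).
  by apply: eq_bigr => i _; rewrite to_bfunE.
elim: r => [|i r IH]; first by rewrite !big_nil.
by rewrite !big_cons; case: (P i) => //; rewrite IH.
Qed.

Lemma to_bfunB f g : bdd f -> bdd g ->
  to_bfun (fun t => f t - g t) = to_bfun f - to_bfun g :> B.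
Proof.
move=> bf bg; rewrite addrC -scaleN1r -to_bfun_linear//; congr to_bfun.
by apply/funext => t; rewrite mulN1r addrC.
Qed.

Variables (y : nat -> dual B) (La : nat -> (T -> R) -> R) (x : nat -> T -> R) (M : R).
Hypotheses (M0 : 0 < M) (xM : forall n t, `|x n t| <= M).
Hypothesis posLa : forall n, posfun (La n).
Hypothesis yLa : forall n f, bdd f -> `|y n (to_bfun f)| <= La n (fun t => `|f t|).
Hypothesis ynull : weakly_null y.
Hypothesis yx : forall n m, y n (to_bfun (x m)) = (n == m)%:R.

Let dist_bdd m k : bdd (fun t => `|x m t - x k t|).
Proof.
exists (2 * M) => t; rewrite normr_id; apply: le_trans (ler_normB _ _) _.
by have := xM m t; have := xM k t; lra.
Qed.

Let D n m k := La n (fun t => `|x m t - x k t|).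

Let D_bdd n m : bdd (D n m).
Proof.
apply: (pos_bdd (posLa n) (M := 2 * M)) => k t; rewrite normr_id.
by apply: le_trans (ler_normB _ _) _; have := xM m t; have := xM k t; lra.
Qed.

Let D_bdd2 n : bdd (fun m => ulim (D n m)).
Proof.
exists (2 * M * La n (fun=> 1)) => m; apply: ulim_norm_le; first exact: D_bdd.
apply: filterE => k; apply: (pos_norm_le (posLa n)) => t; rewrite normr_id.
by apply: le_trans (ler_normB _ _) _; have := xM m t; have := xM k t; lra.
Qed.

Hypothesis D0 : forall n, ulim (fun m => ulim (D n m)) <= 0.

(** The iterated limits vanish, so a suitable [m] is chosen first and then a later [k], each for the
    first [N] functionals at once. *)
Let cauchy_pair N e : 0 < e -> exists mk : nat * nat,
  [/\ (N <= mk.1)%N, mk.1 != mk.2 & forall n, (n < N)%N -> D n mk.1 mk.2 < e].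
Proof.
move=> e0; have /(near_freeU_ex N)[m Nm mP] : \forall m \near freeU,
    forall n, (n < N)%N -> ulim (D n m) < e.
  apply: near_all_lt => n; apply: near_ulim_lt; first exact: D_bdd2.
  exact: le_lt_trans (D0 n) e0.
have /(near_freeU_ex m.+1)[k mk kP] : \forall k \near freeU,
    forall n, (n < N)%N -> D n m k < e.
  have /(near_all_lt N) : forall n, \forall k \near freeU, (n < N)%N -> D n m k < e.
    move=> n; case: (ltnP n N) => nN; last by apply: filterE.
    apply: filterS (near_ulim_lt (D_bdd n m) (mP n nN)) => k ? _ //.
  by apply: filterS => k H n nN; exact: H.
by exists (m, k); split=> //=; rewrite neq_ltn mk.
Qed.

(** Normalises differences of the [x n] to sup norm at most 1; it is also the value of [v j] on
    [z j]. The choice [eta = c / 4] leaves room for three errors. *)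
Let c := (2 * M)^-1.
Let eta := c / 4.
Let c0 : 0 < c. Proof. by rewrite invr_gt0 mulr_gt0. Qed.
Let eta0 : 0 < eta. Proof. by rewrite divr_gt0. Qed.

(* If the [x n] were Cauchy in each L^1(La n), differences [z j] could be chosen that
   are small in L^1 for the earlier functionals.  The functions
   [g j N = z j * \prod_(j < i < N) (1 - `|z i|)] are almost disjoint, with
   [\sum_(j < N) `|g j N| <= 1], so sums of them over a sparse set [S] of indices define
   an element of the bidual on which [v k], for [k] in [S], does not tend to 0. *)
Lemma weakly_null_not_scattered : False.
Proof.
have /choice[F FP] : forall N, exists mk : nat * nat, [/\ (N <= mk.1)%N, mk.1 != mk.2 &
    forall n, (n < N)%N -> D n mk.1 mk.2 < 2 * M * (eta * (2 ^+ N.+1)^-1)].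
  by move=> N; apply: cauchy_pair; rewrite !mulr_gt0// invr_gt0 exprn_gt0.
(* Each starting index exceeds the previous [mm], so the smallness of [z j] covers all earlier
   functionals [v i]. *)
pose nn j := iter j (fun n => (F n).1.+1) 0%N.
pose mm j := (F (nn j)).1; pose kk j := (F (nn j)).2.
have nnmm j : (nn j <= mm j)%N by have [] := FP (nn j).
have nnS j : (nn j < nn j.+1)%N by rewrite ltnS; exact: nnmm.
have jnn j : (j <= nn j)%N by elim: j => // j IH; exact: leq_ltn_trans IH (nnS j).
have nn_homo i j : (i <= j)%N -> (nn i <= nn j)%N.
  by move=> ij; apply: (@homo_leq _ nn leq leqnn leq_trans (fun n => ltnW (nnS n))).
have mmnn i j : (i < j)%N -> (mm i < nn j)%N.
  by move=> ij; apply: leq_trans (nn_homo _ _ ij).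
pose z j t := c * (x (mm j) t - x (kk j) t).
have z1 j t : `|z j t| <= 1.
  rewrite normrM gtr0_norm// ler_pdivrMl ?mulr_gt0// mulr1.
  by apply: le_trans (ler_normB _ _) _; have := xM (mm j) t; have := xM (kk j) t; lra.
have bz j : bdd (z j) by exists 1.
have z01 t j : 0 <= `|z j t| <= 1 by rewrite normr_ge0 z1.
pose v j := y (mm j); pose la j := La (mm j).
have bx n : bdd (x n) by exists M.
have vz j : v j (to_bfun (z j)) = c.
  have -> : to_bfun (z j) = c *: (to_bfun (x (mm j)) - to_bfun (x (kk j))).
    rewrite -to_bfunB// -[RHS]addr0 -[X in _ + X](_ : to_bfun (fun=> 0) = 0).
      rewrite -to_bfun_linear; [|by apply: bddD => //; exact: bddN|exact: bdd_cst].
      by congr to_bfun; apply/funext => t; rewrite addr0.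
    apply/val_inj/funext => t.
    by rewrite -[LHS]/(bfun_fun (to_bfun _) t) to_bfunE//; exact: bdd_cst.
  rewrite linearZ linearB /= /v !yx eqxx; have [_ /negbTE -> _] := FP (nn j).
  by rewrite subr0; exact: mulr1.
have pla j : posfun (la j) by exact: posLa.
have vla j f : bdd f -> `|v j (to_bfun f)| <= la j (fun t => `|f t|) by exact: yLa.
have laz i j : (i < j)%N -> la i (fun t => `|z j t|) <= eta * (2 ^+ j.+1)^-1.
  move=> ij; have -> : la i (fun t => `|z j t|) = c * D (mm i) (mm j) (kk j).
    rewrite /D -posZ//; apply: pos_eq => t; by rewrite normrM gtr0_norm.
  rewrite ler_pdivrMl ?mulr_gt0//; have [_ _ /(_ _ (mmnn _ _ ij)) h] := FP (nn j).
  apply: le_trans (ltW h) _; rewrite ler_pM2l ?mulr_gt0// ler_pM2l//.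
  by rewrite lef_pV2 ?posrE ?exprn_gt0// ler_eXn2l ?ltr1n// ltnS.
pose g j N t := z j t * \prod_(j.+1 <= i < N) (1 - `|z i t|).
have gz j N t : `|g j N t| <= `|z j t|.
  have /andP[p0 p1] := prod_one_sub_bounds (index_iota j.+1 N) (z01 t).
  by rewrite normrM (ger0_norm p0) ler_piMr.
have g1 j N t : `|g j N t| <= 1 by exact: le_trans (gz j N t) (z1 j t).
have bg j N : bdd (g j N) by exists 1.
have zg j N t : `|z j t - g j N t| <= \sum_(j.+1 <= i < N) `|z i t|.
  have /andP[p0 p1] := prod_one_sub_bounds (index_iota j.+1 N) (z01 t).
  have := prod_one_sub_ge (index_iota j.+1 N) (z01 t).
  set P := \prod_(_ <- _) _ in p0 p1 *; set S := \sum_(_ <- _) _ => h.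
  have -> : z j t - g j N t = z j t * (1 - P) by rewrite /g -/P mulrBr mulr1.
  rewrite normrM [`|1 - P|]ger0_norm ?subr_ge0//.
  have : `|z j t| * (1 - P) <= 1 * (1 - P) by rewrite ler_wpM2r// subr_ge0.
  rewrite mul1r; lra.
pose G (S : nat -> bool) N t := \sum_(0 <= j < N | S j) g j N t.
have G1 S N t : `|G S N t| <= 1.
  apply: le_trans (ler_norm_sum _ _ _) _.
  apply: le_trans (sum_mul_prod_one_sub N (z01 t)).
  rewrite big_mkcond/=; apply: ler_sum => j _.
  have /andP[p0 p1] := prod_one_sub_bounds (index_iota j.+1 N) (z01 t).
  by case: (S j); [rewrite normrM (ger0_norm p0)|rewrite mulr_ge0].
have GE S N (w : dual B) : w (to_bfun (G S N)) = \sum_(0 <= j < N | S j) w (to_bfun (g j N)).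
  by rewrite to_bfun_sum// linear_sum.
have wb (w : dual B) f : (forall t, `|f t| <= 1) -> `|w (to_bfun f)| <= `|w|.
  move=> f1; apply: le_trans (dual_bound _ _) _; rewrite ler_piMr//.
  exact: to_bfun_norm.
have bw (w : dual B) (f : nat -> T -> R) : (forall n t, `|f n t| <= 1) ->
    bdd (fun n => w (to_bfun (f n)) : R).
  by move=> f1; exists `|w| => n; exact: wb.
(* The functions [G S N] need not converge as [N] grows, but they are bounded by 1, so their limit
   along the ultrafilter defines an element of the bidual, on which weak nullness applies. *)
have Psi S : exists P : dual (dual B), forall w : dual B, P w = ulim (fun N => w (to_bfun (G S N))).
  have [||P PE] := @dualE R (dual B) (fun w => ulim (fun N => w (to_bfun (G S N)))) 1.
  - move=> a w1 w2.
    suff : ulim (fun N => (a *: w1 + w2) (to_bfun (G S N))) =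
      a * ulim (fun N => w1 (to_bfun (G S N))) + ulim (fun N => w2 (to_bfun (G S N))) by [].
    rewrite -ulimZ; last exact: bw (G1 S).
    by rewrite -ulimD; [|apply: bddZ; exact: bw (G1 S)|exact: bw (G1 S)].
  - move=> w; rewrite mul1r; apply: ulim_norm_le; first exact: bw (G1 S).
    by apply: filterE => N; apply: wb; exact: G1.
  by exists P => w; rewrite PE.
have vnull (P : dual (dual B)) : P (v k) @[k --> \oo] --> (0 : R^o).
  have mmoo : mm k @[k --> \oo] --> \oo.
    move=> A [N _ NA]; exists N => // k /= Nk; apply: NA => /=.
    exact: leq_trans Nk (leq_trans (jnn k) (nnmm k)).
  exact: cvg_comp mmoo (ynull P).
pose a j k := ulim (fun N => v k (to_bfun (g j N))).
(* Weak nullness tested on the bidual element of the singleton [{j}]. *)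
have a0 j : a j k @[k --> \oo] --> (0 : R).
  have [P PE] := Psi (pred1 j); have := vnull P.
  rewrite (_ : (fun k => P (v k)) = a j)//; apply/funext => k; rewrite PE.
  apply: eq_ulim; last by apply: bw => n t; exact: g1.
  apply: filterS (freeU_ge j.+1) => N jN; rewrite GE -big_filter.
  rewrite (_ : [seq i <- index_iota 0 N | pred1 j i] = [:: j]) ?big_seq1//.
  rewrite (@eq_filter _ _ (pred1 j))//.
  by apply: filter_pred1_uniq; rewrite ?iota_uniq// mem_index_iota.
have /choice[Kf KfP] : forall n, exists k0, forall k, (k0 <= k)%N ->
    \sum_(j < n.+1) `|a j k| <= eta.
  move=> n; have n0 : 0 < eta / n.+1%:R by rewrite divr_gt0// ltr0n.
  have : \forall k \near \oo, forall j, (j < n.+1)%N -> `|a j k| <= eta / n.+1%:R.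
    apply: near_all_lt => j; have /cvgrPdist_le/(_ _ n0) := a0 j.
    by apply: filterS => k; rewrite sub0r normrN.
  move=> [k0 _ kP]; exists k0 => k k0k.
  apply: (@le_trans _ _ (\sum_(j < n.+1) eta / n.+1%:R)).
    by apply: ler_sum => j _; apply: kP.
  by rewrite sumr_const card_ord -[leLHS]mulr_natr divfK// pnatr_eq0.
(* The set [S] of these indices is so sparse that, at its next element, the terms of all earlier
   ones add up to at most [eta]. *)
pose Ml l := iter l (fun m => maxn (Kf m) m.+1) 0%N.
have MlS l : (Ml l < Ml l.+1)%N by rewrite /= leq_max leqnn orbT.
have MlK l : (Kf (Ml l) <= Ml l.+1)%N by rewrite /= leq_max leqnn.
have Mlh i j : (i <= j)%N -> (Ml i <= Ml j)%N.
  by move=> ij; apply: (@homo_leq _ Ml leq leqnn leq_trans (fun n => ltnW (MlS n))).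
have lMl l : (l <= Ml l)%N by elim: l => // l IH; exact: leq_ltn_trans IH (MlS l).
pose S j : bool := `[< exists l, j = Ml l >].
have [P PE] := Psi S.
suff Pv l : eta <= P (v (Ml l)).
  have e2 : 0 < eta / 2 by rewrite divr_gt0.
  have /cvgrPdist_le/(_ _ e2)[k0 _ kP] := vnull P.
  have := kP (Ml k0) (lMl k0); rewrite sub0r normrN => h.
  by have := le_trans (Pv k0) (le_trans (ler_norm _) h); lra.
set k := Ml l; have Sk : S k by apply/asboolP; exists l.
pose Bf N := \sum_(0 <= j < k | S j) v k (to_bfun (g j N)).
have bBf : bdd Bf by apply: bdd_sum => j; apply: bw => N t; exact: g1.
have Bge : - eta <= ulim Bf.
  rewrite ulim_sum; last by move=> j; apply: bw => N t; exact: g1.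
  suff : `|\sum_(0 <= j < k | S j) a j k| <= eta by rewrite ler_norml => /andP[].
  apply: le_trans (ler_norm_sum _ _ _) _.
  rewrite /k; case: l @k Sk Bf bBf => [|l] k Sk Bf bBf; first by rewrite big_geq// ltW.
  apply: le_trans (KfP (Ml l) (Ml l.+1) (MlK l)).
  rewrite -(big_mkord xpredT (fun j => `|a j (Ml l.+1)|)).
  rewrite big_mkcond/= (@big_cat_nat _ _ _ (Ml l).+1 0 (Ml l.+1))//=.
  rewrite [X in _ + X]big_nat_cond [X in _ + X]big1 ?addr0.
    by apply: ler_sum => j _; case: (S j).
  move=> j; rewrite andbT => /andP[lj jl]; case: ifP => // /asboolP[l' jE].
  move: lj jl; rewrite jE => lj jl.
  have [ll'|l'l] := leqP l.+1 l'.
    by have := leq_trans jl (Mlh _ _ ll'); rewrite ltnn.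
  by have := leq_trans lj (Mlh l' l l'l); rewrite ltnn.
(* The diagonal term is at least [c - eta], as [g k N] differs from [z k] by at most the sum of the
   later [|z i|]; the later terms cost another [eta]. With [eta] for the earlier terms in [Bf], at
   least [c - 3 * eta = eta] remains. *)
have main : \forall N \near freeU, Bf N + (c - 2 * eta) <= v k (to_bfun (G S N)).
  apply: filterS (freeU_ge k.+1) => N kN; rewrite GE.
  rewrite (@big_cat_nat _ _ _ k 0 N S _ (leq0n k) (ltnW kN)) /= lerD2l.
  rewrite big_mkcond big_ltn// Sk -[X in _ <= _ + X]big_mkcond/=.
  have h1 : c - eta <= v k (to_bfun (g k N)).
    have -> : v k (to_bfun (g k N)) = c - v k (to_bfun (fun t => z k t - g k N t)).
      by rewrite to_bfunB// linearB /= vz opprB addrC subrK.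
    rewrite lerD2l lerN2; apply: le_trans (ler_norm _) _.
    apply: le_trans (vla k _ _) _; first by apply: bddD => //; exact: bddN.
    apply: (@le_trans _ _ (la k (fun t => \sum_(k.+1 <= i < N) `|z i t|))).
      apply: (pos_le (pla k)); [|by apply: bdd_sum => i; exact: bdd_norm|exact: zg].
      by apply: bdd_norm; apply: bddD => //; exact: bddN.
    rewrite pos_sum//; last by move=> i; exact: bdd_norm.
    apply: (@le_trans _ _ (\sum_(k.+1 <= i < N) eta * (2 ^+ i.+1)^-1)).
      by apply: ler_sum_nat => i /andP[ki _]; exact: laz.
    by rewrite -mulr_sumr ler_piMr ?geometric_le1// ltW.
  have h2 : - eta <= \sum_(k.+1 <= i < N | S i) v k (to_bfun (g i N)).
    suff : `|\sum_(k.+1 <= i < N | S i) v k (to_bfun (g i N))| <= eta.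
      by rewrite ler_norml => /andP[].
    apply: le_trans (ler_norm_sum _ _ _) _.
    apply: (@le_trans _ _ (\sum_(k.+1 <= i < N) eta * (2 ^+ i.+1)^-1)).
      rewrite big_mkcond; apply: ler_sum_nat => i /andP[ki _].
      case: (S i); last by rewrite mulr_ge0 ?(ltW eta0)// invr_ge0 exprn_ge0.
      apply: le_trans (vla k _ (bg i N)) _; apply: le_trans (laz _ _ ki).
      by apply: (pos_le (pla k)); [exact: bdd_norm|exact: bdd_norm|move=> t; exact: gz].
    by rewrite -mulr_sumr ler_piMr ?geometric_le1// ltW.
  lra.
rewrite PE; apply: (@le_trans _ _ (ulim Bf + (c - 2 * eta))).
  have : c = 4 * eta by rewrite /eta; field.
  lra.
rewrite -(ulim_cst (c - 2 * eta)) -ulimD//; last exact: bdd_cst.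
apply: ulim_le => //; first by apply: bddD => //; exact: bdd_cst.
by apply: bw => N t; exact: G1.
Qed.

End SlidingHump.

Lemma stable_system_embeds_ell1 (R : realType) (X : completeNormedModType R)
    (x : nat -> X) (xs : nat -> dual X) :
  bounded_set (range x) -> wc0s_stable x xs -> embeds (ell1 R) X.
Proof.
move=> [M [_ xM]] [bio stable].
pose M' := `|M| + 1; have M0 : 0 < M' by rewrite ltr_wpDl.
have xM' n : `|x n| <= M'.
  by apply: (xM M'); [rewrite (le_lt_trans (ler_norm M))// ltrDl|exists n].
pose J : {linear X -> bfun R (dual X)} :=
  HB.pack (@bfun_embed R X) (GRing.isLinear.Build _ _ _ _ _ (@bfun_embed_linear R X)).
have [|y [yJ _ ynull]] := stable (bfun R (dual X)) J.
  exists 1, 1; split=> // z; rewrite invr1 !mul1r.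
  by rewrite -[J z]/(bfun_embed z) bfun_embed_norm.
pose X' n (t : dual X) := ball_eval (x n) t.
have XM n t : `|X' n t| <= M' by exact: le_trans (ball_eval_norm _ _) (xM' n).
have yX n m : y n (to_bfun (X' m)) = (n == m)%:R.
  by rewrite -bio -yJ.
have /choice[La LaP] : forall n, exists L : (dual X -> R) -> R, posfun L /\
    forall f, bdd f -> `|y n (to_bfun f)| <= L (fun t => `|f t|).
  by move=> n; have [L pL Ly] := bfun_dual_dominated (y n); exists L.
have [n Dn] : exists n, 0 < ulim (fun m => ulim (fun k => La n (fun t => `|X' m t - X' k t|))).
  apply: contrapT => /forallNP h.
  apply: (@weakly_null_not_scattered R (dual X) y La X' M') => //.
  - by move=> n; have [] := LaP n.
  - by move=> n; have [] := LaP n.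
  - by move=> n; rewrite leNgt; apply/negP; exact: h.
have pL := (LaP n).1.
have [r [q [rq w]]] := oscillation pL M0 XM Dn.
suff [s sP] : exists s : nat -> nat, forall N (e : nat -> bool), exists t, forall i, (i < N)%N ->
    if e i then q < ball_eval (x (s i)) t else ball_eval (x (s i)) t < r.
  apply: (@l1_lower_embeds _ _ (x \o s) (2 / (q - r)) M').
  - by rewrite divr_gt0// subr_gt0.
  - exact: l1_lower_of_patterns.
  - by move=> i; exact: xM'.
have lt0 (b : bool) : 0 < (b%:R : R) -> b by case: b => //; rewrite ltxx.
have [w1|w1] := w.
  have [s sP] := independent_subsequence pL (ind_lt_unit X' r) (ind_gt_unit X' q) w1.
  exists s => N e; have [t tP] := sP N e; exists t => i iN.
  by have := tP i iN; case: (e i) => /lt0.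
(* The two families have exchanged roles, so the pattern is negated. *)
have [s sP] := independent_subsequence pL (ind_gt_unit X' q) (ind_lt_unit X' r) w1.
exists s => N e; have [t tP] := sP N (fun i => ~~ e i); exists t => i iN.
by have := tP i iN; case: (e i) => /lt0.
Qed.

(** * Finite biorthogonal systems and Haar rotations *)

Section FiniteBiorthogonal.
Variables (R : realType) (X : normedModType R).
Local Notation pair := (X * dual X)%type.
Implicit Types (L D : seq pair) (p q : pair) (x : X) (f : dual X).

(** The Kronecker symbol compares pairs rather than positions; [uniq] makes the two agree. *)
Definition bior L : Prop := uniq L /\ {in L &, forall p q, p.2 q.1 = (p == q)%:R}.

(** [proj L x = x], and dually [coproj L f = f], is how membership in the span of the system is
    expressed: for biorthogonal systems both survive enlargement and rotation. *)
Definition proj L x : X := \sum_(q <- L) q.2 x *: q.1.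

Definition coproj L f : dual X := \sum_(q <- L) f q.1 *: q.2.

Lemma bior_perm L D : perm_eq L D -> bior L -> bior D.
Proof.
move=> LD [uL bL]; split; first by rewrite -(perm_uniq LD).
by move=> p q; rewrite -!(perm_mem LD); exact: bL.
Qed.

Lemma proj_perm L D : perm_eq L D -> proj L = proj D.
Proof. by move=> LD; apply/funext => x; exact: perm_big. Qed.

Lemma coproj_perm L D : perm_eq L D -> coproj L = coproj D.
Proof. by move=> LD; apply/funext => x; exact: perm_big. Qed.

Lemma proj_rcons L p x : proj (rcons L p) x = proj L x + p.2 x *: p.1.
Proof. by rewrite /proj -cats1 big_cat big_seq1. Qed.

Lemma coproj_rcons L p f : coproj (rcons L p) f = coproj L f + f p.1 *: p.2.
Proof. by rewrite /coproj -cats1 big_cat big_seq1. Qed.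

Lemma bior_rcons L p : bior L -> (forall q, q \in L -> q.2 p.1 = 0) ->
  (forall q, q \in L -> p.2 q.1 = 0) -> p.2 p.1 = 1 -> bior (rcons L p).
Proof.
move=> [uL bL] qp pq pp.
have pL : p \notin L.
  by apply/negP => /pq; rewrite pp => /eqP; rewrite oner_eq0.
split; first by rewrite rcons_uniq pL.
move=> a b; rewrite !mem_rcons !inE => /predU1P[->|aL] /predU1P[->|bL'].
- by rewrite pp eqxx.
- rewrite pq//; case: eqP => // pb; move: pL; by rewrite pb bL'.
- rewrite qp//; case: eqP => // pb; move: pL; by rewrite -pb aL.
- exact: bL.
Qed.

Lemma bior_rconsP L p : bior (rcons L p) -> [/\ bior L,
  forall q, q \in L -> q.2 p.1 = 0, forall q, q \in L -> p.2 q.1 = 0 & p.2 p.1 = 1].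
Proof.
rewrite /bior rcons_uniq => -[/andP[pL uL] bL].
have pin : p \in rcons L p by rewrite mem_rcons mem_head.
have qin q : q \in L -> q \in rcons L p by move=> qL; rewrite mem_rcons inE qL orbT.
split.
- by split=> // a b aL bL'; apply: bL; exact: qin.
- move=> q qL; rewrite (bL q p (qin q qL) pin); case: (eqVneq q p) => // qp.
  by move: pL; rewrite -qp qL.
- move=> q qL; rewrite (bL p q pin (qin q qL)); case: (eqVneq p q) => // qp.
  by move: pL; rewrite qp qL.
- by rewrite (bL p p pin pin) eqxx.
Qed.

Lemma coproj_val L f x : coproj L f x = \sum_(q <- L) f q.1 * q.2 x.
Proof. exact: dual_sumE. Qed.

Lemma dual_proj f L x : f (proj L x) = \sum_(q <- L) q.2 x * f q.1.
Proof. by rewrite linear_sum; apply: eq_bigr => q _; rewrite linearZ. Qed.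

Lemma projE L q x : bior L -> q \in L -> q.2 (proj L x) = q.2 x.
Proof.
move=> [uL bL] qL; rewrite dual_proj (bigD1_seq q)//= big_seq_cond big1 ?addr0.
  by rewrite bL// eqxx mulr1.
by move=> p /andP[pL pq]; rewrite bL// eq_sym (negbTE pq) mulr0.
Qed.

Lemma coprojE L q f : bior L -> q \in L -> coproj L f q.1 = f q.1.
Proof.
move=> [uL bL] qL; rewrite coproj_val (bigD1_seq q)//= big_seq_cond big1 ?addr0.
  by rewrite bL// eqxx mulr1.
by move=> p /andP[pL pq]; rewrite bL// (negbTE pq) mulr0.
Qed.

Lemma proj_fix_rcons L p x : bior (rcons L p) -> proj L x = x -> proj (rcons L p) x = x.
Proof.
move=> /bior_rconsP[bL qp pq pp] Lx; rewrite proj_rcons Lx.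
have -> : p.2 x = 0; last by rewrite scale0r addr0.
by rewrite -Lx dual_proj big_seq_cond big1// => q /andP[qL _]; rewrite pq// mulr0.
Qed.

Lemma coproj_fix_rcons L p f : bior (rcons L p) -> coproj L f = f -> coproj (rcons L p) f = f.
Proof.
move=> /bior_rconsP[bL qp pq pp] Lf; rewrite coproj_rcons Lf.
have -> : f p.1 = 0; last by rewrite scale0r addr0.
by rewrite -Lf coproj_val big_seq_cond big1// => q /andP[qL _]; rewrite qp// mulr0.
Qed.

Lemma proj_fix_cat L D x : bior (L ++ D) -> proj L x = x -> proj (L ++ D) x = x.
Proof.
elim/last_ind: D => [|D p IH]; first by rewrite cats0.
rewrite -rcons_cat => b Lx; apply: proj_fix_rcons => //.
by apply: IH => //; have [] := bior_rconsP b.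
Qed.

Lemma resid_valr L (z : X) (zs : dual X) : bior L ->
  (zs - coproj L zs) (z - proj L z) = zs (z - proj L z).
Proof.
move=> bL; rewrite dual_addE dual_oppE coproj_val big_seq_cond big1 ?subr0// => q /andP[qL _].
by rewrite linearB /= projE// subrr mulr0.
Qed.

Lemma resid_vall L (z : X) (zs : dual X) : bior L ->
  (zs - coproj L zs) (z - proj L z) = (zs - coproj L zs) z.
Proof.
move=> bL; set g := zs - coproj L zs; rewrite -[RHS]subr0.
transitivity (g z - g (proj L z)); first by rewrite linearB.
congr (_ - _); rewrite dual_proj big_seq_cond big1// => q /andP[qL _].
suff : q.2 z * (zs q.1 - coproj L zs q.1) = 0 by [].
by rewrite coprojE// subrr mulr0.
Qed.

(** A biorthogonal Gram-Schmidt step: both components are made to annihilate [L], then the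
    functional is rescaled by [t]. *)
Definition extension_pair L (z : X) (zs : dual X) : pair :=
  let t : R := (zs - coproj L zs) (z - proj L z) in (z - proj L z, t^-1 *: (zs - coproj L zs)).

Lemma bior_extend L (z : X) (zs : dual X) : bior L ->
  zs (z - proj L z) != 0 -> bior (rcons L (extension_pair L z zs)).
Proof.
move=> bL; rewrite -resid_valr//; rewrite /extension_pair; set t := _ (z - _) => t0.
apply: bior_rcons => // [q qL|q qL|]; last by exact: mulVf.
  by rewrite linearB /= projE// subrr.
suff : t^-1 * (zs q.1 - coproj L zs q.1) = 0 by [].
by rewrite coprojE// subrr mulr0.
Qed.

Lemma proj_extend L (z : X) (zs : dual X) : bior L ->
  zs (z - proj L z) != 0 -> proj (rcons L (extension_pair L z zs)) z = z.
Proof.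
move=> bL; rewrite -resid_valr// => t0.
suff E : (extension_pair L z zs).2 z = 1.
  by rewrite proj_rcons E scale1r addrC subrK.
suff : ((zs - coproj L zs) (z - proj L z))^-1 * (zs - coproj L zs) z = 1 by [].
by rewrite -(resid_vall z zs bL); exact: mulVf.
Qed.

Lemma coproj_extend L (z : X) (zs : dual X) : bior L ->
  zs (z - proj L z) != 0 -> coproj (rcons L (extension_pair L z zs)) zs = zs.
Proof.
move=> bL t0; rewrite coproj_rcons /= -resid_valr// scalerA.
by rewrite mulfV ?resid_valr// scale1r addrC subrK.
Qed.

(* With [a = 1 / sqrt 2] the pairs [p], [q] undergo the same rotation in X and in
   X^*, so biorthogonality and spans are preserved. *)
Definition rot_plus a p q : pair := (a *: (p.1 + q.1), a *: (p.2 + q.2)).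
Definition rot_minus a p q : pair := (a *: (p.1 - q.1), a *: (p.2 - q.2)).

Lemma bior_rot L a p q : 2 * a ^+ 2 = 1 -> bior (rcons (rcons L p) q) ->
  bior (rcons (rcons L (rot_plus a p q)) (rot_minus a p q)).
Proof.
move=> a2 /bior_rconsP[/bior_rconsP[bL rp pr pp] rq qr qq].
have pL : p \in rcons L p by rewrite mem_rcons mem_head.
have inL r : r \in L -> r \in rcons L p by move=> rL; rewrite mem_rcons inE rL orbT.
have pq := rq p pL; have qp := qr p pL.
have rqL r : r \in L -> r.2 q.1 = 0 by move=> /inL; exact: rq.
have qrL r : r \in L -> q.2 r.1 = 0 by move=> /inL; exact: qr.
have E (u v : dual X) (w z : X) (s t : R) :
  (a *: (u + s *: v)) (a *: (w + t *: z)) =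
    a ^+ 2 * (u w + t * u z + s * v w + s * t * v z).
  rewrite dual_scaleE dual_addE dual_scaleE !linearZ !linearD !linearZ /=.
  rewrite -![_ *: _]/(_ * _); ring.
have E1 (u v : dual X) (w : X) (s : R) : (a *: (u + s *: v)) w = a * (u w + s * v w) by [].
have E2 (u : dual X) (w z : X) (t : R) : u (a *: (w + t *: z)) = a * (u w + t * u z).
  by rewrite linearZ linearD linearZ.
have plusE : rot_plus a p q = (a *: (p.1 + 1 *: q.1), a *: (p.2 + 1 *: q.2)).
  by rewrite !scale1r.
have minusE : rot_minus a p q = (a *: (p.1 + (-1) *: q.1), a *: (p.2 + (-1) *: q.2)).
  by rewrite !scaleN1r.
have pr0 s r : r \in L -> (a *: (p.2 + s *: q.2)) r.1 = 0.
  by move=> rL; rewrite E1 pr// qrL// mulr0 addr0 mulr0.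
have rp0 s r : r \in L -> r.2 (a *: (p.1 + s *: q.1)) = 0.
  by move=> rL; rewrite E2 rp// rqL// mulr0 addr0 mulr0.
have st s t : (a *: (p.2 + s *: q.2)) (a *: (p.1 + t *: q.1)) = a ^+ 2 * (1 + s * t).
  by rewrite E pp pq qp qq; ring.
rewrite plusE minusE; apply: bior_rcons; first apply: bior_rcons => // [r rL|r rL|].
- exact: rp0.
- exact: pr0.
- by rewrite st -[RHS]a2; ring.
- move=> r; rewrite mem_rcons inE => /predU1P[->|rL]; last exact: rp0.
  by rewrite st; ring.
- move=> r; rewrite mem_rcons inE => /predU1P[->|rL]; last exact: pr0.
  by rewrite st; ring.
- by rewrite st -[RHS]a2; ring.
Qed.

(** An orthogonal change of basis applied to vectors and coefficients alike leaves a two-term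
    expansion unchanged; applied in X and in the dual, this is why rotations preserve [proj] and
    [coproj]. *)
Lemma rot_rank2 (V : lmodType R) (a : R) (u v : V) (s t : R) : 2 * a ^+ 2 = 1 ->
  (a * (s + t)) *: (a *: (u + v)) + (a * (s - t)) *: (a *: (u - v)) = s *: u + t *: v.
Proof.
move=> a2; rewrite !scalerA; set b := _ * a; set c := _ * a.
transitivity ((b + c) *: u + (b - c) *: v).
  by rewrite !scalerDr scalerN addrACA scalerDl scalerBl.
by congr (_ *: _ + _ *: _); rewrite -[RHS]mul1r -a2 /b /c; ring.
Qed.

Lemma proj_rot L a p q : 2 * a ^+ 2 = 1 ->
  proj (rcons (rcons L (rot_plus a p q)) (rot_minus a p q)) = proj (rcons (rcons L p) q).
Proof.
move=> a2; apply/funext => x; rewrite !proj_rcons -!addrA; congr (_ + _).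
exact: (rot_rank2 p.1 q.1 (p.2 x) (q.2 x) a2).
Qed.

Lemma coproj_rot L a p q : 2 * a ^+ 2 = 1 ->
  coproj (rcons (rcons L (rot_plus a p q)) (rot_minus a p q)) = coproj (rcons (rcons L p) q).
Proof.
move=> a2; apply/funext => f; rewrite !coproj_rcons -!addrA; congr (_ + _).
have fa y : f (a *: y) = a * f y by rewrite linearZ.
rewrite /= !fa linearD linearB /=; exact: (rot_rank2 p.2 q.2 (f p.1) (f q.1) a2).
Qed.

Lemma proj_lspan L x : bior L -> proj L x = x -> lspan [set q.1 | q in [set` L]] x.
Proof.
move=> bL Lx; exists (size L), (fun i => (tnth (in_tuple L) i).2 x),
  (fun i => (tnth (in_tuple L) i).1); split.
  by move=> i; exists (tnth (in_tuple L) i) => //=; exact: mem_tnth.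
by rewrite -{1}Lx /proj big_tnth.
Qed.

Lemma coproj_lspan L f : coproj L f = f -> lspan [set q.2 | q in [set` L]] f.
Proof.
move=> Lf; exists (size L), (fun i => f (tnth (in_tuple L) i).1),
  (fun i => (tnth (in_tuple L) i).2); split.
  by move=> i; exists (tnth (in_tuple L) i) => //=; exact: mem_tnth.
by rewrite -{1}Lf /coproj big_tnth.
Qed.

End FiniteBiorthogonal.

Section HaarConstants.
Variable R : realType.

Definition haar_a : R := (Num.sqrt 2)^-1.
Definition haar_C : R := 1 + Num.sqrt 2.

Lemma sqrt2_gt1 : 1 < Num.sqrt 2 :> R.
Proof. by rewrite -[ltLHS]sqrtr1 ltr_sqrt ?ltr1n. Qed.

Lemma sqr_sqrt2 : Num.sqrt 2 * Num.sqrt 2 = 2 :> R.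
Proof. by rewrite -expr2 sqr_sqrtr. Qed.

Lemma haar_a_gt0 : 0 < haar_a.
Proof. by rewrite invr_gt0 (lt_trans ltr01 sqrt2_gt1). Qed.

Lemma haar_a_lt1 : haar_a < 1.
Proof. by rewrite invf_lt1 ?sqrt2_gt1// (lt_trans ltr01 sqrt2_gt1). Qed.

Lemma haar_a_sqr : 2 * haar_a ^+ 2 = 1.
Proof. by rewrite /haar_a exprVn sqr_sqrtr// mulfV// pnatr_eq0. Qed.

Lemma haar_C_ge0 : 0 <= haar_C.
Proof. by rewrite addr_ge0// sqrtr_ge0. Qed.

Lemma haar_C_le3 : haar_C <= 3.
Proof.
have : Num.sqrt 2 <= 2 :> R.
  by rewrite -[leRHS]sqr_sqrt2 ler_pMr ?(ltW sqrt2_gt1)// (lt_trans ltr01 sqrt2_gt1).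
rewrite /haar_C; lra.
Qed.

(* [haar_C] is the sum of the geometric series [haar_a + haar_a ^ 2 + ...]. *)
Lemma haar_aC : (1 - haar_a) * haar_C = haar_a.
Proof.
have s0 : Num.sqrt 2 != 0 :> R by rewrite gt_eqF// (lt_trans ltr01 sqrt2_gt1).
apply: (mulfI s0); rewrite /haar_a /haar_C mulrA mulrBr mulfV// mulr1.
have := sqr_sqrt2; lra.
Qed.

End HaarConstants.

(** * Enlarging a finite system by one vector and one functional *)

Section Stages.
Variables (R : realType) (X : normedModType R) (e : nat -> X) (es : nat -> dual X) (K : R).
Hypotheses (K0 : 0 <= K) (e1 : forall n, `|e n| <= 1) (esK : forall n, `|es n| <= K).
Hypothesis es_e : forall n m, es n (e m) = (n == m)%:R.
Hypothesis es_null : forall x, es n x @[n --> \oo] --> (0 : R).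
Local Notation pair := (X * dual X)%type.
Implicit Types (L D : seq pair) (p q : pair) (x : X) (f : dual X).
Local Notation a := (haar_a R).
Local Notation C := (haar_C R).

Definition e_null f : Prop := f (e n) @[n --> \oo] --> (0 : R).

Lemma e_null_es j : e_null (es j).
Proof.
apply: cvg_near_cst; exists j.+1 => // n /= jn.
by rewrite es_e ltn_eqF.
Qed.

Lemma e_nullZ t f : e_null f -> e_null (t *: f).
Proof.
move=> Hf; rewrite /e_null -[X in _ --> X](mulr0 t).
exact: (cvgM (cvg_cst t) Hf).
Qed.

Lemma e_nullD f g : e_null f -> e_null g -> e_null (f + g).
Proof. by move=> Hf Hg; rewrite /e_null -[X in _ --> X](addr0 0); exact: (cvgD Hf Hg). Qed.

Lemma e_nullB f g : e_null f -> e_null g -> e_null (f - g).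
Proof. by move=> Hf Hg; rewrite -scaleN1r; apply: e_nullD => //; exact: e_nullZ. Qed.

(** The second condition keeps the supply of fresh pairs: late [e j] are almost annihilated by the
    functionals of [L]. *)
Definition admissible L : Prop := bior L /\ forall q, q \in L -> e_null q.2.

Lemma e_null_coproj L f : admissible L -> e_null (coproj L f).
Proof.
move=> [_]; rewrite /coproj; elim: L => [|p L IH] HL.
  by rewrite big_nil /e_null; exact: cvg_cst.
rewrite big_cons; apply: e_nullD; first by apply/e_nullZ/HL; rewrite mem_head.
by apply: IH => q qL; apply: HL; rewrite inE qL orbT.
Qed.

Lemma admissible_perm L D : perm_eq L D -> admissible L -> admissible D.
Proof.
move=> LD [bL HL]; split; first exact: bior_perm bL.
by move=> q; rewrite -(perm_mem LD); exact: HL.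
Qed.

Lemma admissible_rcons L p : admissible L -> bior (rcons L p) -> e_null p.2 ->
  admissible (rcons L p).
Proof.
move=> [_ HL] b Hp; split=> // q; rewrite mem_rcons inE => /predU1P[->//|]; exact: HL.
Qed.

Lemma admissible_rconsP L p : admissible (rcons L p) -> admissible L /\ e_null p.2.
Proof.
move=> [b H]; split; last by apply: H; rewrite mem_rcons mem_head.
by have [bL _ _ _] := bior_rconsP b; split=> // q qL; apply: H; rewrite mem_rcons inE qL orbT.
Qed.

Lemma admissible_extend L z zs : admissible L -> e_null zs ->
  zs (z - proj L z) != 0 -> admissible (rcons L (extension_pair L z zs)).
Proof.
move=> aL Hz nz; apply: admissible_rcons => //; first by apply: bior_extend => //; exact: aL.1.
by apply: e_nullZ; apply: e_nullB => //; exact: e_null_coproj.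
Qed.

Lemma sum_cvg0 (I : eqType) (L : seq I) (F : I -> nat -> R) :
  (forall i, i \in L -> F i n @[n --> \oo] --> (0 : R)) ->
  \sum_(i <- L) F i n @[n --> \oo] --> (0 : R).
Proof.
elim: L => [|i L IH] HL.
  by rewrite (_ : (fun n => _) = fun=> 0); [exact: cvg_cst|apply/funext => n; rewrite big_nil].
rewrite (_ : (fun n => _) = (fun n => F i n + \sum_(i <- L) F i n)); last first.
  by apply/funext => n; rewrite big_cons.
rewrite -[X in _ --> X](addr0 0); apply: cvgD; first by apply: HL; rewrite mem_head.
by apply: IH => j jL; apply: HL; rewrite inE jL orbT.
Qed.

(** For late [j] both [proj L (e j)] and [coproj L (es j)] are small, the former by [e_null], the
    latter because [es] is weak-star null; so [extension_pair] barely moves the pair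
    [(e j, es j)]. *)
Lemma fresh_pair L eta J : admissible L -> 0 < eta -> exists j p,
  [/\ (J <= j)%N, admissible (rcons L p), `|p.1 - e j| <= eta & `|p.2 - es j| <= eta].
Proof.
move=> aL eta0; have [bL HL] := aL.
pose al n := \sum_(q <- L) `|q.2 (e n)| * `|q.1|.
pose be n := \sum_(q <- L) `|es n q.1| * `|q.2|.
have al0 : al n @[n --> \oo] --> (0 : R).
  apply: sum_cvg0 => q qL; rewrite -(mul0r `|q.1|).
  apply: cvgM; last exact: cvg_cst.
  by rewrite -(@normr0 _ R); apply: cvg_norm; exact: HL.
have be0 : be n @[n --> \oo] --> (0 : R).
  apply: sum_cvg0 => q qL; rewrite -(mul0r `|q.2|).
  apply: cvgM; last exact: cvg_cst.
  by rewrite -(@normr0 _ R); apply: cvg_norm; exact: es_null.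
have K1 : 0 < 2 * K + 1 by rewrite ltr_wpDl// mulr_ge0.
have K2 : 0 < 2 * K * (K + 1) + 1 by rewrite ltr_wpDl// !mulr_ge0// addr_ge0.
(* The third bound gives [K * d <= 1 / 2], hence [t >= 1 / 2]; the second controls the total change
   [2 * K * d * (K + 1) + d] of the functional. *)
pose d := Num.min 1 (Num.min (eta / (2 * K * (K + 1) + 1)) (2 * K + 1)^-1).
have d0 : 0 < d by rewrite !lt_min ltr01 divr_gt0//= invr_gt0.
have d1 : d <= 1 by rewrite ge_min lexx.
have d2 : d * (2 * K * (K + 1) + 1) <= eta by rewrite -ler_pdivlMr// !ge_min lexx !orbT.
have d3 : K * d <= 1 / 2.
  have : d * (2 * K + 1) <= 1 by rewrite -ler_pdivlMr// div1r !ge_min lexx !orbT.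
  have := ltW d0; lra.
have [N _ NP] : \forall n \near \oo, al n <= d /\ be n <= d.
  apply: filterI.
    have /cvgrPdist_le/(_ _ d0) := al0; apply: filterS => n.
    by rewrite sub0r normrN => /(le_trans (ler_norm _)).
  have /cvgrPdist_le/(_ _ d0) := be0; apply: filterS => n.
  by rewrite sub0r normrN => /(le_trans (ler_norm _)).
pose j := maxn N J; have [ad bd] := NP j (leq_maxl N J).
have pe : `|proj L (e j)| <= d.
  apply: le_trans ad; apply: le_trans (ler_norm_sum _ _ _) _.
  by apply: ler_sum => q _; rewrite normrZ.
have ce : `|coproj L (es j)| <= d.
  apply: le_trans bd; apply: le_trans (ler_norm_sum _ _ _) _.
  by apply: ler_sum => q _; rewrite normrZ.
have deta : d <= eta.
  apply: le_trans d2; rewrite ler_pMr// lerDr !mulr_ge0// addr_ge0//.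
pose t := (es j - coproj L (es j)) (e j - proj L (e j)).
have tE : t = es j (e j - proj L (e j)) by rewrite /t resid_valr.
have t1 : `|1 - t| <= K * d.
  rewrite tE linearB /= es_e eqxx opprB addrC subrK.
  by apply: le_trans (dual_bound _ _) _; apply: ler_pM.
have thalf : 1 / 2 <= t.
  by have := le_trans (ler_norm _) t1; lra.
have t0 : 0 < t by lra.
exists j, (extension_pair L (e j) (es j)); split.
- exact: leq_maxr.
- apply: admissible_extend => //; first exact: e_null_es.
  by rewrite -tE gt_eqF.
- by rewrite /= addrC addKr normrN; exact: le_trans deta.
rewrite /= -/t.
have -> : t^-1 *: (es j - coproj L (es j)) - es j =
    (t^-1 - 1) *: (es j - coproj L (es j)) - coproj L (es j).
  by rewrite scalerBl scale1r opprB -!addrA; congr (_ + _); rewrite addrCA subrr addr0.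
apply: le_trans (ler_normB _ _) _; rewrite normrZ.
have h1 : `|t^-1 - 1| <= 2 * K * d.
  rewrite (_ : t^-1 - 1 = (1 - t) / t); last by rewrite mulrBl mul1r mulfV// gt_eqF.
  rewrite normrM [`|t^-1|]gtr0_norm ?invr_gt0// ler_pdivrMr//.
  apply: le_trans t1 _.
  have : K * d * (1 / 2) <= K * d * t by rewrite ler_wpM2l// mulr_ge0// ltW.
  lra.
have h2 : `|es j - coproj L (es j)| <= K + 1.
  by apply: le_trans (ler_normB _ _) _; apply: lerD => //; exact: le_trans d1.
have h3 : `|t^-1 - 1| * `|es j - coproj L (es j)| <= 2 * K * d * (K + 1) by exact: ler_pM.
apply: le_trans d2; lra.
Qed.

Hypothesis total : forall z : X, z != 0 -> exists2 g : dual X, e_null g & g z != 0.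

(** If [z] is already in the span, a fresh pair is appended all the same, so that the result always
    has the shape [insert_pair] takes. *)
Lemma add_vector L z : admissible L -> exists2 p, admissible (rcons L p) & proj (rcons L p) z = z.
Proof.
move=> aL; have [|nz] := eqVneq (z - proj L z) 0.
  move/eqP; rewrite subr_eq0 eq_sym => /eqP zL.
  have [j [p [_ aLp _ _]]] := fresh_pair 0%N aL ltr01.
  by exists p => //; apply: proj_fix_rcons => //; exact: aLp.1.
have [g Hg gz] := total nz; exists (extension_pair L z g).
  exact: admissible_extend.
by apply: proj_extend => //; exact: aL.1.
Qed.

Lemma add_functional L f : admissible L -> e_null f ->
  exists2 p, admissible (rcons L p) & coproj (rcons L p) f = f.
Proof.
move=> aL Hf; have [|nz] := eqVneq (f - coproj L f) 0.
  move/eqP; rewrite subr_eq0 eq_sym => /eqP fL.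
  have [j [p [_ aLp _ _]]] := fresh_pair 0%N aL ltr01.
  by exists p => //; apply: coproj_fix_rcons => //; exact: aLp.1.
have [z fz] : exists z, (f - coproj L f) z != 0.
  apply: contrapT => /forallNP h; move/eqP: nz; apply; apply/val_inj/funext => z.
  by apply/eqP/negPn/negP; exact: h.
rewrite -resid_vall ?resid_valr in fz; [|exact: aL.1|exact: aL.1].
exists (extension_pair L z f); first exact: admissible_extend.
by apply: coproj_extend => //; exact: aL.1.
Qed.

(** Within [r] of a combination of the [es j], [j >= J], with coefficients in the l2 unit ball: the
    form that [weakly_null_stable] accepts. *)
Definition near_es J r f : Prop := exists N u (c : nat -> R),
  [/\ f = u + \sum_(0 <= j < N) c j *: es j, forall j, (j < J)%N -> c j = 0,
      \sum_(0 <= j < N) c j ^+ 2 <= 1 & `|u| <= r].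

Lemma near_es_refl J f : near_es J `|f| f.
Proof. by exists 0%N, f, (fun=> 0); rewrite !big_geq// addr0. Qed.

Lemma near_es_le J J' r r' f : (J' <= J)%N -> r <= r' -> near_es J r f -> near_es J' r' f.
Proof.
move=> JJ rr [N [u [c [fE c0 c1 ur]]]]; exists N, u, c; split=> //.
  by move=> j jJ; apply: c0; exact: leq_trans jJ JJ.
exact: le_trans rr.
Qed.

(** The index [j] lies beyond the support of [c], so the new squared l2-norm is a^2 (|c|^2 + 1) <= 2
    a^2 = 1. *)
Lemma near_es_rot J r eta f (s : R) : s ^+ 2 = 1 -> near_es J r f -> exists N0, forall j g,
  (N0 <= j)%N -> `|g - es j| <= eta -> near_es J (a * (r + eta)) (a *: (f + s *: g)).
Proof.
move=> s2 [N [u [c [fE c0 c1 ur]]]]; exists (maxn N J) => j g.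
rewrite geq_max => /andP[Nj Jj] gj.
pose c' i := a * (if (i < N)%N then c i else if i == j then s else 0).
have split_sum (W : zmodType) (F : R -> nat -> W) : (forall i, F 0 i = 0) ->
    \sum_(0 <= i < j.+1) F (c' i) i = \sum_(0 <= i < N) F (a * c i) i + F (a * s) j.
  move=> F0; rewrite big_nat_recr//= /c' ltnNge Nj eqxx; congr (_ + _).
  rewrite (@big_cat_nat _ _ _ N 0 j xpredT _ (leq0n N) Nj) /=.
  rewrite [X in _ + X]big_nat_cond [X in _ + X]big1 ?addr0.
    by apply: eq_big_nat => i /andP[_ iN]; rewrite iN.
  move=> i /andP[/andP[Ni ij] _]; rewrite ltnNge Ni /= ltn_eqF// mulr0; exact: F0.
exists j.+1, (a *: (u + s *: (g - es j))), c'; split.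
- rewrite (split_sum _ (fun y i => y *: es i)); last by move=> i; rewrite scale0r.
  under eq_bigr do rewrite -scalerA.
  rewrite -scaler_sumr -scalerA -!scalerDr; congr (_ *: _).
  rewrite fE [s *: (g - _)]scalerBr -!addrA; congr (_ + _).
  by rewrite [- _ + _]addrC addrK addrC.
- move=> i iJ; rewrite /c'; case: ifP => _; first by rewrite c0// mulr0.
  by rewrite ltn_eqF ?mulr0// (leq_trans iJ Jj).
- rewrite (split_sum _ (fun y _ => y ^+ 2)); last by move=> i; rewrite expr0n.
  under eq_bigr do rewrite exprMn.
  rewrite -mulr_sumr exprMn s2 -mulrDr.
  have := haar_a_sqr R; have : a ^+ 2 * (\sum_(0 <= i < N) c i ^+ 2 + 1) <= a ^+ 2 * (1 + 1).
    by rewrite ler_wpM2l ?sqr_ge0// lerD2r.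
  lra.
- have s1 : `|s| = 1.
    apply/eqP; rewrite -(eqrXn2 (n := 2))// expr1n real_normK ?num_real//.
    exact/eqP.
  rewrite normrZ (ger0_norm (ltW (haar_a_gt0 R))) ler_pM2l ?haar_a_gt0//.
  by apply: le_trans (ler_normD _ _) _; rewrite normrZ s1 mul1r lerD.
Qed.

Lemma admissible_rot L p q : admissible (rcons (rcons L p) q) ->
  admissible (rcons (rcons L (rot_plus a p q)) (rot_minus a p q)).
Proof.
move=> aLpq; have b := bior_rot (haar_a_sqr R) aLpq.1.
have [/admissible_rconsP[aL Hp] Hq] := admissible_rconsP aLpq.
have [b' _ _ _] := bior_rconsP b.
apply: admissible_rcons => //; first apply: admissible_rcons => //.
  by apply: e_nullZ; exact: e_nullD.
by apply: e_nullZ; exact: e_nullB.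
Qed.

(** The map s |-> a (s + B) has fixed point C B, and its k-th iterate is a^k s + (1 - a^k) C B. *)
Lemma haar_step k (s B : R) :
  a ^+ k * (a * (s + B)) + (1 - a ^+ k) * C * B = a ^+ k.+1 * s + (1 - a ^+ k.+1) * C * B.
Proof.
apply/eqP; rewrite -subr_eq0 exprS.
rewrite (_ : _ - _ = a ^+ k * B * (a - (1 - a) * C)); last by ring.
by rewrite haar_aC subrr mulr0.
Qed.

(* Rotating [p] repeatedly with fresh pairs [(e j, es j)] yields the rows of a
   Haar matrix: the weight of [p] in each of the [2 ^ k] new pairs is [a ^+ k]. *)
Lemma rot_split k L p eta J r : 0 < eta -> admissible (rcons L p) -> near_es J r p.2 ->
  exists D, [/\ admissible (L ++ D), (0 < size D)%N,
    forall x, proj (rcons L p) x = x -> proj (L ++ D) x = x,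
    forall f, coproj (rcons L p) f = f -> coproj (L ++ D) f = f &
    forall q, q \in D -> `|q.1| <= a ^+ k * `|p.1| + (1 - a ^+ k) * C * (1 + eta) /\
      near_es J (a ^+ k * r + (1 - a ^+ k) * C * eta) q.2].
Proof.
move=> eta0; elim: k L p r => [|k IH] L p r aLp pn.
  exists [:: p]; rewrite cats1; split=> // q; rewrite inE => /eqP ->.
  by rewrite expr0 subrr !mul0r !addr0 !mul1r; split.
have [N1 N1P] := near_es_rot eta (expr1n _ _ : (1 : R) ^+ 2 = 1) pn.
have m1 : (-1 : R) ^+ 2 = 1 by rewrite sqrrN expr1n.
have [N2 N2P] := near_es_rot eta m1 pn.
have [j [q [jN aLpq qe qes]]] := fresh_pair (maxn N1 N2) aLp eta0.
have := jN; rewrite geq_max => /andP[jN1 jN2].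
set B := 1 + eta; have qB : `|q.1| <= B.
  by rewrite -[q.1](subrK (e j)) addrC; apply: le_trans (ler_normD _ _) _; apply: lerD.
have a0 := haar_a_gt0 R.
have ak0 : 0 <= a ^+ k by rewrite exprn_ge0// ltW.
pose pp := rot_plus a p q; pose pm := rot_minus a p q.
have aR : admissible (rcons (rcons L pp) pm) by exact: admissible_rot.
have npp : near_es J (a * (r + eta)) pp.2.
  by have := N1P j q.2 jN1 qes; rewrite scale1r.
have npm : near_es J (a * (r + eta)) pm.2.
  by have := N2P j q.2 jN2 qes; rewrite scaleN1r.
have bpp : `|pp.1| <= a * (`|p.1| + B).
  rewrite normrZ gtr0_norm// ler_pM2l//.
  by apply: le_trans (ler_normD _ _) _; rewrite lerD2l.
have bpm : `|pm.1| <= a * (`|p.1| + B).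
  rewrite normrZ gtr0_norm// ler_pM2l//.
  by apply: le_trans (ler_normB _ _) _; rewrite lerD2l.
(* The two rotated pairs are brought to the end of the list in turn, where the induction hypothesis
   acts. *)
have P1 : perm_eq (rcons (rcons L pp) pm) (rcons (rcons L pm) pp).
  by rewrite -!cats1 -!catA perm_cat2l (perm_catC [:: pp] [:: pm]).
have [D1 [aD1 sD1 xD1 fD1 bD1]] := IH _ _ _ (admissible_perm P1 aR) npp.
have P2 : perm_eq (rcons L pm ++ D1) (rcons (L ++ D1) pm).
  by rewrite -!cats1 -!catA perm_cat2l perm_catC.
have [D2 [aD2 sD2 xD2 fD2 bD2]] := IH _ _ _ (admissible_perm P2 aD1) npm.
exists (D1 ++ D2); rewrite catA; split=> //.
- by rewrite size_cat addn_gt0 sD1.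
- move=> x Lx; apply: xD2; rewrite -(proj_perm P2); apply: xD1; rewrite -(proj_perm P1).
  rewrite proj_rot; last exact: haar_a_sqr.
  by apply: proj_fix_rcons => //; exact: aLpq.1.
- move=> f Lf; apply: fD2; rewrite -(coproj_perm P2); apply: fD1; rewrite -(coproj_perm P1).
  rewrite coproj_rot; last exact: haar_a_sqr.
  by apply: coproj_fix_rcons => //; exact: aLpq.1.
move=> v; rewrite mem_cat => vD; rewrite -!haar_step.
case/orP: vD => [/bD1|/bD2] [h1 h2]; split=> //.
  by apply: le_trans h1 _; rewrite lerD2r ler_wpM2l.
by apply: le_trans h1 _; rewrite lerD2r ler_wpM2l.
Qed.

(** [k] is taken so large that the share [a ^+ k] of the uncontrolled pair [p] in each new pair is
    below [eta]; the fresh pairs contribute at most [C * (1 + eta)] to the vectors. *)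
Lemma insert_pair L p eta J : 0 < eta -> admissible (rcons L p) ->
  exists D, [/\ admissible (L ++ D), (0 < size D)%N,
    forall x, proj (rcons L p) x = x -> proj (L ++ D) x = x,
    forall f, coproj (rcons L p) f = f -> coproj (L ++ D) f = f &
    forall q, q \in D -> `|q.1| <= C * (1 + eta) + eta /\ near_es J ((C + 1) * eta) q.2].
Proof.
move=> eta0 aLp; pose B := `|p.1| + `|p.2| + 1.
have B0 : 0 < B by rewrite ltr_wpDl// addr_ge0.
have a0 := haar_a_gt0 R; have a1 := haar_a_lt1 R.
have [k kB] : exists k, a ^+ k * B <= eta.
  have : a ^+ n @[n --> \oo] --> (0 : R) by apply: cvg_expr; rewrite gtr0_norm.
  move=> /cvgrPdist_le/(_ _ (divr_gt0 eta0 B0))[k _ /(_ k (leqnn k))].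
  rewrite sub0r normrN ger0_norm ?exprn_ge0 ?(ltW a0)// => h.
  by exists k; rewrite -ler_pdivlMr.
have [D [aD sD xD fD bD]] := rot_split k eta0 aLp (near_es_refl J p.2).
exists D; split=> // q /bD[h1 h2].
have ak0 : 0 <= a ^+ k by rewrite exprn_ge0// ltW.
have ak1 : a ^+ k <= 1 by rewrite exprn_ile1// ltW.
have C0 := haar_C_ge0 R.
have g1 : a ^+ k * `|p.1| <= eta.
  by apply: le_trans kB; rewrite ler_wpM2l// /B -addrA lerDl addr_ge0.
have g2 : a ^+ k * `|p.2| <= eta.
  by apply: le_trans kB; rewrite ler_wpM2l// /B addrAC lerDr addr_ge0.
have g3 M : 0 <= M -> (1 - a ^+ k) * C * M <= C * M.
  by move=> M0; rewrite ler_wpM2r// ler_piMl// gerBl.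
split.
  have B1 : 0 <= 1 + eta by rewrite addr_ge0// ltW.
  by have := g3 _ B1; lra.
by apply: near_es_le h2 => //; have := g3 _ (ltW eta0); lra.
Qed.

Lemma stage L z f eta J : admissible L -> e_null f -> 0 < eta ->
  exists D, [/\ admissible (L ++ D), (0 < size D)%N, proj (L ++ D) z = z,
    coproj (L ++ D) f = f &
    forall q, q \in D -> `|q.1| <= C * (1 + eta) + eta /\ near_es J ((C + 1) * eta) q.2].
Proof.
move=> aL Hf eta0; have [p ap pz] := add_vector z aL.
have [D1 [aD1 sD1 xD1 fD1 bD1]] := insert_pair J eta0 ap.
have [q aq qf] := add_functional aD1 Hf.
have [D2 [aD2 sD2 xD2 fD2 bD2]] := insert_pair J eta0 aq.
exists (D1 ++ D2); rewrite catA; split=> //.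
- by rewrite size_cat addn_gt0 sD1.
- by apply: proj_fix_cat; [exact: aD2.1|exact: xD1].
- exact: fD2.
- by move=> v; rewrite mem_cat => /orP[/bD1|/bD2].
Qed.

End Stages.

(** * Linear spans and weak-star density *)

Section LinearSpan.
Variables (R : realType).

Section Module.
Variable V : lmodType R.
Implicit Types A B : set V.

Lemma lspan_sub A B : A `<=` B -> lspan A `<=` lspan B.
Proof. by move=> AB v [n [a [u [Au ->]]]]; exists n, a, u; split=> // i; exact: AB. Qed.

Lemma lspan0 A : lspan A 0.
Proof.
exists 0%N, (fun=> 0), (fun=> 0); split; first by case.
by rewrite big_ord0.
Qed.

Lemma lspan_gen A v : A v -> lspan A v.
Proof. by move=> Av; exists 1%N, (fun=> 1), (fun=> v); split=> //; rewrite big_ord1 scale1r. Qed.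

Lemma lspanZ A t v : lspan A v -> lspan A (t *: v).
Proof.
move=> [n [a [u [Au ->]]]]; exists n, (fun i => t * a i), u; split=> //.
by rewrite scaler_sumr; apply: eq_bigr => i _; rewrite scalerA.
Qed.

Lemma lspanD A v w : lspan A v -> lspan A w -> lspan A (v + w).
Proof.
move=> [n [a [u [Au ->]]]] [m [b [z [Az ->]]]].
pose sel (T : Type) (f : 'I_n -> T) (g : 'I_m -> T) (i : 'I_(n + m)) :=
  match fintype.split i with inl j => f j | inr j => g j end.
have selL T f g i : @sel T f g (lshift m i) = f i.
  by rewrite /sel; have := unsplitK (inl i : 'I_n + 'I_m) => /= ->.
have selR T f g i : @sel T f g (rshift n i) = g i.
  by rewrite /sel; have := unsplitK (inr i : 'I_n + 'I_m) => /= ->.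
exists (n + m)%N, (sel _ a b), (sel _ u z); split.
  by move=> i; rewrite /sel; case: (fintype.split i).
rewrite big_split_ord /=; congr (_ + _); apply: eq_bigr => i _; first by rewrite !selL.
by rewrite !selR.
Qed.

Lemma lspan_sum A (I : eqType) (r : seq I) (F : I -> V) :
  (forall i, i \in r -> lspan A (F i)) -> lspan A (\sum_(i <- r) F i).
Proof.
elim: r => [|i r IH] h; first by rewrite big_nil; exact: lspan0.
rewrite big_cons; apply: lspanD; first by apply: h; rewrite mem_head.
by apply: IH => j jr; apply: h; rewrite inE jr orbT.
Qed.

End Module.

Variable X : normedModType R.

Lemma lspan_cspan (A : set X) v : lspan A v -> cspan A v.
Proof. exact: subset_closure. Qed.

(** Extending step by step, one finds a finite biorthogonal system with functionals in the span of
    [A] whose [proj] fixes every point of [s]; then [coproj L f] agrees with [f] there. *)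
Lemma finite_interpolation (A : set (dual X)) :
  (forall z : X, z != 0 -> exists2 g : dual X, lspan A g & g z != 0) ->
  forall (f : dual X) (s : seq X), exists2 h, lspan A h & forall z, z \in s -> h z = f z.
Proof.
move=> tot f s.
have [L [bL LA Ls]] : exists L : seq (X * dual X), [/\ bior L,
    forall q, q \in L -> lspan A q.2 & forall z, z \in s -> proj L z = z].
  elim: s => [|z s [L [bL LA Ls]]]; first by exists [::]; split=> //; split.
  have [|nz] := eqVneq (z - proj L z) 0.
    move/eqP; rewrite subr_eq0 eq_sym => /eqP zL; exists L; split=> // y.
    by rewrite inE => /predU1P[->|/Ls].
  have [g Ag gz] := tot _ nz; have b := bior_extend bL gz.
  exists (rcons L (extension_pair L z g)); split=> //.
    move=> q; rewrite mem_rcons inE => /predU1P[->|/LA//] /=.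
    apply: lspanZ; apply: lspanD => //; rewrite -scaleN1r; apply: lspanZ.
    by apply: lspan_sum => p pL; apply: lspanZ; exact: LA.
  move=> y; rewrite inE => /predU1P[->|/Ls yL]; first exact: proj_extend.
  exact: proj_fix_rcons.
exists (coproj L f); first by apply: lspan_sum => q qL; apply: lspanZ; exact: LA.
move=> z zs; rewrite coproj_val -{2}(Ls z zs) dual_proj.
by apply: eq_bigr => q _; rewrite mulrC.
Qed.

(** The sets of interpolants of [f] on finite subsets of X form a filter base that converges to [f]
    pointwise. *)
Lemma total_weak_star_dense (xs : nat -> dual X) :
  (forall z : X, z != 0 -> exists2 g : dual X, lspan (range xs) g & g z != 0) ->
  total_functionals xs.
Proof.
move=> tot; rewrite /total_functionals -subTset => f _.
pose A (s : seq X) : set (dual X) :=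
  [set h | lspan (range xs) h /\ forall z, z \in s -> h z = f z].
pose F : set_system (dual X) := filter_from setT A.
have FF : ProperFilter F.
  apply: filter_from_proper; last first.
    by move=> s _; have [h ? ?] := finite_interpolation tot f s; exists h.
  apply: filter_from_filter; first by exists [::].
  move=> s t _ _; exists (s ++ t) => // h [hs ht]; split; split=> // z zs; apply: ht;
  by rewrite mem_cat zs ?orbT.
have Fl : F (lspan (range xs)) by exists [::] => // h [].
have cvgF : (F : set_system (weak_star X)) --> (f : weak_star X).
  move=> B /= [] B' [] [] W oW <- Wf OB.
  have pF : {ptws, (fun h : dual X => (dual_fun h : X -> R^o)) @ F --> dual_fun f}.
    apply/pointwise_cvgP => z; apply: cvg_near_cst; exists [:: z] => // h [_ hz].
    by apply: hz; rewrite mem_head.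
  have nW : nbhs (dual_fun f : {ptws X -> R^o}) W by apply: open_nbhs_nbhs.
  by apply: (filterS OB); exact: (pF W nW).
move=> B fB; have FB : F B by exact: cvgF.
exact: (@filter_ex _ F FF _ (filterI Fl FB)).
Qed.

End LinearSpan.

(** * Fundamental total systems *)

Section AdaptedSequence.
Variables (R : realType) (X : normedModType R).

Lemma increasing_choice (P : nat -> nat -> Prop) :
  (forall n N, exists2 j, (N <= j)%N & P n j) ->
  exists s : nat -> nat, (forall n, (s n < s n.+1)%N) /\ forall n, P n (s n).
Proof.
move=> h; have /choice[F FP] : forall nN : nat * nat, exists j, (nN.2 <= j)%N /\ P nN.1 j.
  by move=> [n N]; have [j ? ?] := h n N; exists j.
pose s := fix s n := if n is n'.+1 then F (n'.+1, (s n').+1) else F (0%N, 0%N).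
exists s; split=> [n|[|n]].
- by have [] := FP (n.+1, (s n).+1).
- by have [] := FP (0%N, 0%N).
- by have [] := FP (n.+1, (s n).+1).
Qed.

(* [e n] is half the difference of two terms of [e0] on which [g 0, ..., g n] almost
   agree. *)
Lemma weakly_null_signs (e0 : nat -> X) (s0 : (nat -> bool) -> dual X) (K : R) (g : nat -> dual X) :
  (forall n, `|e0 n| <= 1) -> (forall t, `|s0 t| <= K) ->
  (forall t j, s0 t (e0 j) = sgnb R (t j)) ->
  exists e s, [/\ forall n : nat, `|e n : X| <= 1, forall t : nat -> bool, `|s t : dual X| <= K,
    forall t j, s t (e j) = sgnb R (t j) &
    forall i, g i (e n) @[n --> \oo] --> (0 : R)].
Proof.
move=> e1 sK se; pose l i := ulim (fun n => g i (e0 n)).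
have bg i : bdd (fun n => g i (e0 n) : R).
  exists `|g i| => n; apply: le_trans (dual_bound _ _) _; exact: ler_piMr.
pose P n j := forall i, (i < n.+1)%N -> `|g i (e0 j) - l i| < n.+1%:R^-1.
have [s [sS sP]] : exists s : nat -> nat, (forall n, (s n < s n.+1)%N) /\ forall n, P n (s n).
  apply: increasing_choice => n N; apply: near_freeU_ex.
  by apply: near_all_lt => i; apply: near_ulim => //; rewrite invr_gt0 ltr0n.
have s_lt i j : (i < j)%N -> (s i < s j)%N.
  by apply: (@homo_ltn _ s (fun a b => a < b)%N ltn_trans).
have s_inj : injective s.
  move=> i j sij; have [ij|ij|//] := ltngtP i j.
    by have := s_lt _ _ ij; rewrite sij ltnn.
  by have := s_lt _ _ ij; rewrite sij ltnn.
pose e n := (2^-1 : R) *: (e0 (s n.*2) - e0 (s n.*2.+1)).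
(* Opposite signs at the two indices entering [e n] make the half difference take the value
   [sgnb R (t n)]; injectivity of [s] excludes conflicts. *)
pose t' (t : nat -> bool) k :=
  `[< exists n, (k = s n.*2 /\ t n) \/ (k = s n.*2.+1 /\ ~~ t n) >].
have t'0 t n : t' t (s n.*2) = t n.
  apply/asboolP/idP => [[m [[/s_inj/double_inj->//]|[/s_inj + _]]]|tn]; last by exists n; left.
  by move=> /(congr1 odd) /=; rewrite !odd_double.
have t'1 t n : t' t (s n.*2.+1) = ~~ t n.
  apply/asboolP/idP => [[m [[/s_inj + _]|[/s_inj[/double_inj->]//]]]|tn]; last by exists n; right.
  by move=> /(congr1 odd) /=; rewrite !odd_double.
exists e, (s0 \o t'); split.
- move=> n; rewrite normrZ gtr0_norm ?invr_gt0// ler_pdivrMl// mulr1.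
  by apply: le_trans (ler_normB _ _) _; rewrite -[2]/(1 + 1) lerD.
- by move=> t; exact: sK.
- move=> t j /=; rewrite linearZ linearB /= !se t'0 t'1.
  by case: (t j); rewrite /sgnb /= -[_ *: _]/(_ * _) ?expr0 ?expr1; field.
move=> i; apply: (@squeeze_cvgr _ _ _ _ (fun n => - harmonic n) (fun n => harmonic n)).
- exists i => // n /= ni; rewrite -ler_norml.
  rewrite linearZ linearB /= -[_ *: _]/(_ * _) normrM gtr0_norm ?invr_gt0// ler_pdivrMl//.
  have i0 : (i < n.*2.+1)%N by rewrite ltnS (leq_trans ni)// -addnn leq_addr.
  have i1 : (i < n.*2.+2)%N by exact: ltnW.
  have := sP n.*2 i i0; have := sP n.*2.+1 i i1.
  have h0 : n.*2.+1%:R^-1 <= n.+1%:R^-1 :> R.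
    by rewrite lef_pV2 ?posrE ?ltr0n// ler_nat ltnS -addnn leq_addr.
  have h1 : n.*2.+2%:R^-1 <= n.+1%:R^-1 :> R.
    by rewrite lef_pV2 ?posrE ?ltr0n// ler_nat ltnS -addnn (leq_trans (leq_addr n n)).
  have dist (u v y h h' : R) : `|u - y| < h -> `|v - y| < h' -> `|u - v| <= h + h'.
    move=> uy vy; rewrite -[u](subrK y) -addrA; apply: le_trans (ler_normD _ _) _.
    by apply: lerD; [exact: ltW|rewrite distrC ltW].
  move=> hB hA; apply: le_trans (dist _ _ _ _ _ hA hB) _.
  by rewrite /harmonic -[2]/(1 + 1) mulrDl mul1r lerD.
- by rewrite -oppr0; apply: cvgN; exact: cvg_harmonic.
- exact: cvg_harmonic.
Qed.

Lemma separable_dense_sequence : separable X ->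
  exists d : nat -> X, forall x (r : R), 0 < r -> exists n, `|x - d n| < r.
Proof.
move=> [A [/countable_injP[f fi] dA]].
exists (fun n => xget 0 [set z | A z /\ f z = n]) => x r r0.
have [||z [xz Az]] := dA (ball x r).
- by exists x; exact: ballxx.
- exact: ball_open.
exists (f z); have [Ay fy] : [set y | A y /\ f y = f z] (xget 0 [set y | A y /\ f y = f z]).
  by apply: xgetPex; exists z.
have -> : xget 0 [set y | A y /\ f y = f z] = z by apply: fi; rewrite ?inE.
by move: xz; rewrite -ball_normE.
Qed.

Lemma norming_sequence (d : nat -> X) :
  (forall x (r : R), 0 < r -> exists n, `|x - d n| < r) ->
  exists g : nat -> dual X, (forall i, `|g i| <= 1) /\
    forall x (r : R), 0 < r -> exists i, `|x| - r < g i x.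
Proof.
move=> dd; have /choice[g gP] : forall i, exists g : dual X, `|g| <= 1 /\ g (d i) = `|d i|.
  by move=> i; have [g ? ?] := norming_functional (d i); exists g.
exists g; split=> [i|x r r0]; first by have [] := gP i.
have r2 : 0 < r / 2 by rewrite divr_gt0.
have [i xi] := dd x _ r2; exists i; have [gi1 gid] := gP i.
have -> : g i x = `|d i| + g i (x - d i) by rewrite linearB /= gid addrC subrK.
have h1 : `|g i (x - d i)| <= `|x - d i|.
  by apply: le_trans (dual_bound _ _) _; rewrite ler_piMl.
have h2 : `|x| <= `|d i| + `|x - d i|.
  by rewrite -{1}[x](subrK (d i)) addrC; exact: ler_normD.
move: h1; rewrite ler_norml => /andP[h1 _]; lra.
Qed.

End AdaptedSequence.

(** * Assembling the infinite system *)

Section Assembly.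
Variables (R : realType) (X : normedModType R).
Local Notation C := (haar_C R).
Local Notation pair := (X * dual X)%type.

Lemma bidual_eval (x : X) : exists phi : dual (dual X), forall f : dual X, phi f = f x.
Proof.
have [||phi E] := @dualE R (dual X) (fun f => f x) `|x|.
- by move=> a f g.
- by move=> f; rewrite mulrC; exact: dual_bound.
by exists phi => f; rewrite E.
Qed.

Lemma l2_dominated_weak_star_null (es : nat -> dual X) K (x : X) : 0 <= K ->
  l2_dominated es K -> es n x @[n --> \oo] --> (0 : R).
Proof.
move=> K0 esK; have [phi phiE] := bidual_eval x.
apply/cvgrPdist_le => r r0; have [N NP] := l2_dominated_tail phi K0 esK (exprn_gt0 2 r0).
exists N => // n /= Nn; have := NP n n.+1 Nn; rewrite big_nat1 phiE sub0r normrN => h.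
by rewrite -ler_sqr ?nnegrE ?(ltW r0)// real_normK ?num_real.
Qed.

Section Construction.
Variables (e : nat -> X) (s : (nat -> bool) -> dual X) (es : nat -> dual X) (K : R).
Variables (d : nat -> X) (g : nat -> dual X) (delta : R).
Hypotheses (K0 : 0 <= K) (e1 : forall n, `|e n| <= 1) (sK : forall t, `|s t| <= K).
Hypothesis esE : forall n x, es n x = rad_val s n x.
Hypothesis es_l2 : l2_dominated es K.
Hypothesis es_e : forall n m, es n (e m) = (n == m)%:R.
Hypothesis dense_d : forall x (r : R), 0 < r -> exists n, `|x - d n| < r.
Hypothesis norming_g : forall x (r : R), 0 < r -> exists i, `|x| - r < g i x.
Hypothesis g_e : forall i, g i (e n) @[n --> \oo] --> (0 : R).
Hypothesis delta0 : 0 < delta.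

Lemma adapted_system : exists x xs,
  [/\ fundamental x, forall i, lspan (range xs) (g i), wc0s_stable x xs,
      forall n, `|x n| <= C * (1 + delta) + delta &
      forall n, `|xs n| <= (C + 1) * delta + K].
Proof.
have esK n : `|es n| <= K.
  have := l2_dominated_comb (c := fun=> 1) (J := n) (N := n.+1) es_l2.
  by rewrite !big_nat1 expr1n scale1r => /(_ (lexx _)).
have es0 x : es n x @[n --> \oo] --> (0 : R) by exact: l2_dominated_weak_star_null es_l2.
have tot z : z != 0 -> exists2 f : dual X, e_null e f & f z != 0.
  move=> z0; have z1 : 0 < `|z| by rewrite normr_gt0.
  have [i gi] := norming_g z z1; exists (g i); first exact: g_e.
  by rewrite gt_eqF// -(subrr `|z|).
have C0 := haar_C_ge0 R.
(* Bounded by [delta] for the uniform norm bounds, and tending to 0 so that the errors of the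
   functionals vanish. *)
pose eta n : R := delta * n.+1%:R^-1.
have eta0 n : 0 < eta n by rewrite mulr_gt0// invr_gt0 ltr0n.
have eta_le m n : (m <= n)%N -> eta n <= eta m.
  by move=> mn; rewrite ler_pM2l// lef_pV2 ?posrE ?ltr0n// ler_nat ltnS.
have eta_delta n : eta n <= delta.
  by rewrite ler_piMr ?(ltW delta0)// invf_le1 ?ltr0n// ler1n.
have /choice[F FP] : forall nL : nat * seq pair, exists D, admissible e nL.2 ->
    [/\ admissible e (nL.2 ++ D), (0 < size D)%N, proj (nL.2 ++ D) (d nL.1) = d nL.1,
    coproj (nL.2 ++ D) (g nL.1) = g nL.1 &
    forall q, q \in D -> `|q.1| <= C * (1 + eta nL.1) + eta nL.1 /\
      near_es es nL.1 ((C + 1) * eta nL.1) q.2].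
  move=> [n L]; have [aL|naL] := pselect (admissible e L); last by exists [::].
  have [D DP] := stage K0 e1 esK es_e es0 tot (d n) n aL (g_e n) (eta0 n).
  by exists D.
pose Ls := fix Ls n := if n is n'.+1 then Ls n' ++ F (n', Ls n') else [::].
have aLs n : admissible e (Ls n).
  by elim: n => [|n IH]; [split=> //; split|have [] := FP (n, Ls n) IH].
have sLs n : (size (Ls n) < size (Ls n.+1))%N.
  by rewrite /= size_cat -[ltnLHS]addn0 ltn_add2l; have [] := FP (n, Ls n) (aLs n).
have nLs n : (n <= size (Ls n))%N by elim: n => // n IH; exact: leq_ltn_trans IH (sLs n).
have ext m n : (m <= n)%N -> exists2 D, Ls n = Ls m ++ D & forall q, q \in D ->
    `|q.1| <= C * (1 + delta) + delta /\ near_es es m ((C + 1) * eta m) q.2.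
  elim: n => [|n IH]; first by rewrite leqn0 => /eqP ->; exists [::].
  rewrite leq_eqVlt => /predU1P[->|]; first by exists [::]; rewrite ?cats0.
  rewrite ltnS => mn; have [D LsD DP] := IH mn.
  exists (D ++ F (n, Ls n)); first by rewrite /= LsD -catA -LsD.
  move=> q; rewrite mem_cat => /orP[/DP//|qF].
  have [_ _ _ _ /(_ q qF)[/= q1 q2]] := FP (n, Ls n) (aLs n).
  split; last first.
    by apply: near_es_le q2 => //; rewrite ler_wpM2l ?addr_ge0// eta_le.
  apply: le_trans q1 _; apply: lerD => //; rewrite ler_wpM2l//.
  by rewrite lerD2l.
(* The lists grow by appending at least one pair per stage, so position [n] exists in [Ls n.+1] and
   never changes afterwards. *)
pose p0 : pair := (0, 0); pose p n := nth p0 (Ls n.+1) n.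
have pin n : p n \in Ls n.+1 by rewrite mem_nth// nLs.
have pE m n : (n < size (Ls m))%N -> nth p0 (Ls m) n = p n.
  move=> nm; have [mn|nm'] := leqP m n.+1.
    by have [D E _] := ext _ _ mn; rewrite /p E nth_cat nm.
  by have [D E _] := ext _ _ (ltnW nm'); rewrite E nth_cat nLs.
pose x n := (p n).1; pose xs n := (p n).2.
have bio : biorthogonal x xs.
  move=> n m; pose M := (maxn n m).+1.
  have nM : (n < size (Ls M))%N by apply: leq_trans (nLs M); rewrite ltnS leq_maxl.
  have mM : (m < size (Ls M))%N by apply: leq_trans (nLs M); rewrite ltnS leq_maxr.
  have [[uL bL] _] := aLs M.
  rewrite /x /xs -(pE M n nM) -(pE M m mM) bL ?mem_nth// nth_uniq//.
have tail m n : (size (Ls m) <= n)%N ->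
    `|x n| <= C * (1 + delta) + delta /\ near_es es m ((C + 1) * eta m) (xs n).
  move=> mn; have mn1 : (m <= n.+1)%N by apply: leq_trans (nLs m) (leqW mn).
  have [D E DP] := ext _ _ mn1; apply: DP; rewrite /x /xs /p E nth_cat ltnNge mn /=.
  by apply: mem_nth; rewrite -(ltn_add2l (size (Ls m))) subnKC// -size_cat -E nLs.
have memx m q : q \in Ls m -> exists2 n, q = p n & True.
  by move=> qL; exists (index q (Ls m)) => //; rewrite -(pE m) ?nth_index// index_mem.
have span_x m z : proj (Ls m) z = z -> lspan (range x) z.
  move=> /(proj_lspan (aLs m).1); apply: lspan_sub => _ [q qL <-].
  by have [n -> _] := memx m q qL; exists n.
have span_xs m f : coproj (Ls m) f = f -> lspan (range xs) f.
  move=> /coproj_lspan; apply: lspan_sub => _ [q qL <-].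
  by have [n -> _] := memx m q qL; exists n.
have xbd n : `|x n| <= C * (1 + delta) + delta by have [] := tail 0%N n (leq0n n).
have xsbd n : `|xs n| <= (C + 1) * delta + K.
  have [_ [N [u [c [-> _ c1 ur]]]]] := tail 0%N n (leq0n n).
  apply: le_trans (ler_normD _ _) _; apply: lerD; last exact: l2_dominated_comb es_l2 c1.
  by apply: le_trans ur _; rewrite ler_wpM2l ?addr_ge0.
exists x, xs; split=> //.
- rewrite /fundamental -subTset => z _ B /nbhs_ballP[r /= r0 rB].
  have [i di] := dense_d z r0; exists (d i); split.
    by apply: (span_x i.+1); have [] := FP (i, Ls i) (aLs i).
  by apply: rB; rewrite -ball_normE.
- by move=> i; apply: (span_xs i.+1); have [] := FP (i, Ls i) (aLs i).
(* The last stage completed before position [n]: the pair [p n] was added later, hence is close to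
   combinations of [es j] with [j >= J n]. Stage 0 is empty, so the default 0 of the maximum is
   legitimate. *)
pose J n := \max_(m < n.+1 | (size (Ls m) <= n)%N) m.
have JP n : (size (Ls (J n)) <= n)%N.
  rewrite /J; apply: (big_ind (fun m => (size (Ls m) <= n)%N)) => // a b an bn.
  by rewrite /maxn; case: ifP.
have Joo : J n @[n --> \oo] --> \oo.
  move=> A [m _ mA]; exists (size (Ls m)) => // n /= mn; apply: mA => /=.
  have mn1 : (m < n.+1)%N by rewrite ltnS; exact: leq_trans (nLs m) mn.
  exact: (@leq_bigmax_cond _ (fun i : 'I_n.+1 => (size (Ls i) <= n)%N)
    (fun i => i : nat) (Ordinal mn1)).
have /choice[w wP] : forall n, exists w : nat * dual X * (nat -> R),
    [/\ xs n = w.1.2 + \sum_(J n <= j < w.1.1) w.2 j *: es j,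
     \sum_(J n <= j < w.1.1) w.2 j ^+ 2 <= 1 & `|w.1.2| <= (C + 1) * eta (J n)].
  move=> n; have [_ [N [u [c [-> c0 c1 ur]]]]] := tail _ _ (JP n).
  have cut (W : zmodType) (G : nat -> W) : (forall j, (j < J n)%N -> G j = 0) ->
      \sum_(0 <= j < N) G j = \sum_(J n <= j < N) G j.
    move=> G0; have [NJ|JN] := leqP N (J n).
      rewrite (big_geq NJ) big_nat_cond big1// => j /andP[/andP[_ jN] _].
      by apply: G0; exact: leq_trans jN NJ.
    rewrite (@big_cat_nat _ _ _ (J n) 0 N xpredT G (leq0n _) (ltnW JN)) /=.
    rewrite big_nat_cond big1 ?add0r// => j /andP[/andP[_ jJ] _]; exact: G0.
  exists (N, u, c); split=> //=.
    by rewrite cut// => j jJ; rewrite c0// scale0r.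
  by rewrite -(cut _ (fun j => c j ^+ 2))// => j jJ; rewrite c0// expr0n.
apply: (@weakly_null_stable _ _ s K K0 sK x xs (fun n => (w n).1.2) es J
  (fun n => (w n).1.1) (fun n => (w n).2)) => //.
- exists (C * (1 + delta) + delta); split; first exact: num_real.
  by move=> r rM _ [n _ <-]; exact: le_trans (xbd n) (ltW rM).
- by move=> n; have [] := wP n.
- by move=> n; have [] := wP n.
- apply: (@squeeze_cvgr _ _ _ _ (fun=> 0) (fun n => (C + 1) * eta (J n))).
  + by apply: nearW => n; rewrite normr_ge0 /=; have [] := wP n.
  + exact: cvg_cst.
  have h : (C + 1) * eta m @[m --> \oo] --> (0 : R).
    rewrite -(mulr0 (C + 1)); apply: cvgM; first exact: cvg_cst.
    rewrite -(mulr0 delta); apply: cvgM; [exact: cvg_cst|exact: cvg_harmonic].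
  exact: (cvg_comp _ _ Joo h).
Qed.

End Construction.

(** The span contains the [g i], which already give [|x| <= sup]; this is the case [tau = 1], and
    the others follow. *)
Lemma norms_of_norming_sequence (g xs : nat -> dual X) tau : 1 <= tau ->
  xs 0%N != 0 -> (forall i, `|g i| <= 1) -> (forall i, lspan (range xs) (g i)) ->
  (forall x (r : R), 0 < r -> exists i, `|x| - r < g i x) ->
  norms tau (cspan (range xs)).
Proof.
move=> tau1 xs0 g1 gxs gn x; set S := [set _ | _ in _].
have Sub : ubound S `|x|.
  move=> _ [f [_ f0] <-]; rewrite ler_pdivrMr; last by rewrite normr_gt0; exact/eqP.
  by apply: le_trans (ler_norm _) _; rewrite mulrC; exact: dual_bound.
have inS f : cspan (range xs) f -> f != 0 -> f x / `|f| <= sup S.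
  move=> cf f0; apply: ub_le_sup; first by exists `|x|.
  by exists f => //; split=> //; exact/eqP.
have supx : `|x| <= sup S.
  have [x0|x0] := eqVneq x 0.
    have := inS (xs 0%N) (lspan_cspan (lspan_gen (ex_intro2 _ _ 0%N I erefl))) xs0.
    by rewrite x0 linear0 mul0r normr0.
  apply/ler_addgt0Pl => r r0; have nx : 0 < `|x| by rewrite normr_gt0.
  (* Capping the error by [|x|] makes [g i x] positive, hence [g i] nonzero. *)
  pose r' := Num.min r `|x|; have r'0 : 0 < r' by rewrite lt_min r0.
  have [i gi] := gn x r' r'0.
  have r'x : r' <= `|x| by rewrite ge_min lexx orbT.
  have r'r : r' <= r by rewrite ge_min lexx.
  have gx0 : 0 < g i x by apply: le_lt_trans gi; rewrite subr_ge0.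
  have gi0 : g i != 0 by apply/eqP => g0; move: gx0; rewrite g0 ltxx.
  have := inS (g i) (lspan_cspan (gxs i)) gi0.
  have : g i x <= g i x / `|g i|.
    by rewrite ler_pdivlMr ?normr_gt0// ler_piMr// ltW.
  lra.
by apply: (le_trans supx); rewrite ler_peMl// (le_trans _ supx).
Qed.

End Assembly.

Lemma separable_stable_system (R : realType) (X : completeNormedModType R) (eps : R) :
  embeds (ell1 R) X -> separable X -> 0 < eps ->
  exists (x : nat -> X) (xs : nat -> dual X),
    [/\ M_bounded ((1 + Num.sqrt 2) + eps) x xs, fundamental x, total_functionals xs,
        wc0s_stable x xs & norms (2 + eps) (cspan (range xs))].
Proof.
move=> em sep eps0.
(* With c <= 3 and delta <= 1, (c + 4 delta)(1 + 5 delta) <= c + (15 + 4 + 20) delta. *)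
pose delta := Num.min 1 (eps / 39).
have delta0 : 0 < delta by rewrite lt_min ltr01 divr_gt0.
have delta1 : delta <= 1 by rewrite ge_min lexx.
have deltae : 39 * delta <= eps by rewrite mulrC -ler_pdivlMr// ge_min lexx orbT.
have [z [K' [M [K'0 zK' zM]]]] := embeds_ell1_lower em.
have [e0 [e01 e0K]] := l1_distortion K'0 zK' zM delta0.
set K := 1 + delta in e0K; have K0 : 0 <= K by rewrite addr_ge0// ltW.
have [s0 [s0K s0e]] := sign_functionals K0 e0K.
have [d dd] := separable_dense_sequence sep.
have [g [g1 gn]] := norming_sequence dd.
have [e [s [e1 sK se ge]]] := weakly_null_signs g e01 s0K s0e.
have [es [esE esl2]] := rad_exists K0 sK.
have es_e n m : es n (e m) = (n == m)%:R by rewrite esE; exact: rad_biorthogonal.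
have [x [xs [fx gxs st xb xsb]]] :=
  adapted_system K0 e1 sK esE esl2 es_e dd gn ge delta0.
have xs0 : xs 0%N != 0.
  by apply/eqP => h; have := st.1 0%N 0%N; rewrite h eqxx => /esym/eqP; rewrite oner_eq0.
exists x, xs; split=> //.
- split.
  + exists (haar_C R * (1 + delta) + delta); split; [exact: num_real|move=> r r1 _ [n _ <-]].
    exact: le_trans (xb n) (ltW r1).
  + exists ((haar_C R + 1) * delta + K); split; [exact: num_real|move=> r r1 _ [n _ <-]].
    exact: le_trans (xsb n) (ltW r1).
  move=> n; rewrite -/(haar_C R).
  apply: (@le_trans _ _ ((haar_C R * (1 + delta) + delta) * ((haar_C R + 1) * delta + K))).
    by apply: ler_pM.
  have C0 := haar_C_ge0 R; have C3 := haar_C_le3 R; have d0 := ltW delta0.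
  rewrite /K; set c := haar_C R in C0 C3 *.
  have h1 : c * delta <= 3 * delta by rewrite ler_wpM2r.
  apply: (@le_trans _ _ ((c + 4 * delta) * (1 + 5 * delta))).
    by apply: ler_pM; nra.
  have h2 : delta * delta <= delta by rewrite ler_piMr.
  rewrite mulrDl !mulrDr; nra.
- apply: total_weak_star_dense => w w0; have nw : 0 < `|w| by rewrite normr_gt0.
  have [i gi] := gn w _ nw; exists (g i) => //.
  by rewrite gt_eqF// -(subrr `|w|).
- by apply: (norms_of_norming_sequence _ xs0 g1 gxs gn); lra.
Qed.

Unset Implicit Arguments.

Theorem theorem2 (R : realType) (X : completeNormedModType R)
    (hX : infinite_dim X) :
  let a := embeds (ell1 R) X in
  let b := exists (x : nat -> X) (xs : nat -> dual X),
    bounded_system x xs /\ wc0s_stable x xs in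
  let c := exists (x : nat -> X) (xs : nat -> dual X),
    [/\ bounded_system x xs, fundamental x, total_functionals xs & wc0s_stable x xs] in
  [/\ a <-> b,
      separable X -> (a <-> c) /\ (b <-> c),
      forall eps : R, 0 < eps -> b ->
        exists (x : nat -> X) (xs : nat -> dual X),
          M_bounded (1 + eps) x xs /\ wc0s_stable x xs &
      forall eps : R, 0 < eps -> separable X -> c ->
        exists (x : nat -> X) (xs : nat -> dual X),
          [/\ M_bounded ((1 + Num.sqrt 2) + eps) x xs,
              fundamental x, total_functionals xs, wc0s_stable x xs &
              norms (2 + eps) (cspan (range xs))]].
Proof.
move=> a b c.
have ab eps : 0 < eps -> a -> exists (x : nat -> X) (xs : nat -> dual X),
    M_bounded (1 + eps) x xs /\ wc0s_stable x xs.
  move=> eps0 em; have [z [K [M [K0 zK zM]]]] := embeds_ell1_lower em.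
  have [e [e1 eK]] := l1_distortion K0 zK zM eps0.
  have E0 : 0 <= 1 + eps by rewrite addr_ge0// ltW.
  by have [xs xsP] := l1_lower_stable E0 e1 eK; exists e, xs.
have ba : b -> a.
  by move=> [x [xs [[M [bx _ _]] st]]]; exact: stable_system_embeds_ell1 bx st.
have a_b : a -> b.
  by move=> /(ab 1 ltr01)[x [xs [xM st]]]; exists x, xs; split=> //; exists (1 + 1).
have cb : c -> b by move=> [x [xs [bd _ _ st]]]; exists x, xs.
have ac : separable X -> a -> c.
  move=> sep em; have [x [xs [xM fx tx st _]]] := separable_stable_system em sep ltr01.
  by exists x, xs; split=> //; exists (1 + Num.sqrt 2 + 1).
split.
- by split.
- move=> sep; split; split=> [h|h].
  + exact: ac.
  + exact/ba/cb.
  + exact/ac/ba.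
  + exact: cb.
(* The given system is discarded: it only yields a copy of l1, from which a system with the required
   constant is built afresh. *)
- by move=> eps eps0 /ba; exact: ab.
- by move=> eps eps0 sep /cb/ba em; exact: separable_stable_system.
Qed.
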